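(* Let $T>0$. (1) Assume that for every $t\in[0,T]$ the distributions $\lambda^{(N)}_t=\frac1N\sum_{i=1}^N\delta_{\rho^{(N)}_i((0,t])}$ on $\mathbb{R}_+$ converge weakly as $N\to\infty$ to a probability distribution $\lambda_t$, and that the set of continuous functions $\mathcal I=\{r^{(N)}_i:[0,T]\to\mathbb{R}_+:\ i=1,\dots,N,\ N\in\mathbb{N}\}$, $r^{(N)}_i(t)=\rho^{(N)}_i((0,t])$, is uniformly equicontinuous, namely $$\lim_{\delta\downarrow0}\ \sup_{r\in\mathcal I}\ \sup_{s,t\in[0,T];\ |s-t|\le\delta}|r(s)-r(t)|=0.$$ Then, with $Y^{(N)}_C(t)=\frac1N\sum_{i=1}^N\mathbf 1_{\{\tau^{(N)}_{i,1}\le t\}}$ and $y_C(t)=1-\int_0^\infty e^{-s}\lambda_t(ds)$, $$\mathrm P\Big[\lim_{N\to\infty}\sup_{t\in[0,T]}|Y^{(N)}_C(t)-y_C(t)|=0\Big]=1.$$ (2) Assume that $\mathcal I$ is uniformly equicontinuous in the sense of (1). Assume also that $\mu^{(N)}_0\to\mu_0$ weakly as $N\to\infty$ for a probability distribution $\mu_0$ on $\mathcal M(\mathbb{R}_+)\times[0,1)$ and that for each $(s,t)$ with $t\ge s\ge0$, $\lambda^{(N)}_{s,t}:=\int\delta_{\rho((s,t])}\Lambda^{(N)}(d\rho)$ converges weakly as $N\to\infty$ to $\lambda_{s,t}:=\int\delta_{\rho((s,t])}\Lambda(d\rho)$, where $\Lambda^{(N)}=\mu^{(N)}_0(\cdot\times[0,1))$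 and $\Lambda=\mu_0(\cdot\times[0,1))$. Assume further that the set of functions $$\mathcal J=\{r:[0,T]\to\mathbb{R}_+:\ r(t)=\rho((0,t]),\ t\in[0,T],\ \rho\in\operatorname{supp}\Lambda\}$$ is uniformly equicontinuous, and that $y_A(t-t_1,t)$ and $y_B(y,t)$ are uniformly continuous in $(t_1,t)$ ($0\le t_1\le t\le T$) and in $(y,t)$ ($0\le y<1$, $0\le t\le T$), respectively. Then, almost surely, $\mu^{(N)}_\cdot$ converges to $\mu_\cdot$ as $N\to\infty$ uniformly in $t\in[0,T]$, as a sequence of probability measure valued functions $t\mapsto\mu_t$ with the supremum norm.
   Context: $\mathbb{R}_+=[0,\infty)$; $\delta_c$ is the unit point mass at $c$ (on any space). $\mathcal M(\mathbb{R}_+)$ is the space of Radon measures on the Borel sets of $\mathbb{R}_+$ with the vague topology: $\rho_n\to\rho$ iff $\int f\,d\rho_n\to\int f\,d\rho$ for all continuous $f$ with compact support; it is Polish, as is $\mathcal M(\mathbb{R}_+)\times[0,1)$. For each positive integer $N$, $\nu^{(N)}_1,\dots,\nu^{(N)}_N$ are independent Poisson random measures on $\mathbb{R}_+$, defined on a probability space $(\Omega,\mathcal F,\mathrm P)$, with intensity measures $\rho^{(N)}_i\in\mathcal M(\mathbb{R}_+)$, i.e. $\mathrm E[\nu^{(N)}_i(A)]=\rho^{(N)}_i(A)$; each $\rho^{(N)}_i$ is continuous ($\rho^{(N)}_i(\{t\})=0$ for all $t\ge0$). As part of the setting, with probability $1$, $\nu^{(N)}_i=\sum_{j=1}^\infty\delta_{\tau^{(N)}_{i,j}}$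 with $0<\tau^{(N)}_{i,1}<\tau^{(N)}_{i,2}<\cdots$, and $\tau^{(N)}_{i,j}\ne\tau^{(N)}_{i',j'}$ if $(i,j)\neq(i',j')$. Let $x^{(N)}_1,\dots,x^{(N)}_N$ be a permutation of $1,\dots,N$. The stochastic ranking process is $X^{(N)}=(X^{(N)}_1,\dots,X^{(N)}_N)$ with $X^{(N)}_i(t)=x^{(N)}_i+\sum_{i':\,x^{(N)}_{i'}>x^{(N)}_i}\mathbf 1_{\{\tau^{(N)}_{i',1}\le t\}}$ for $0\le t<\tau^{(N)}_{i,1}$, and $X^{(N)}_i(t)=1+\sum_{i'=1}^N\mathbf 1_{\{\exists j':\ \tau^{(N)}_{i,j}<\tau^{(N)}_{i',j'}\le t\}}$ for $\tau^{(N)}_{i,j}\le t<\tau^{(N)}_{i,j+1}$, $j=1,2,\dots$. Put $Y^{(N)}_i(t)=\frac1N(X^{(N)}_i(t)-1)$ and $\mu^{(N)}_t=\frac1N\sum_{i=1}^N\delta_{(\rho^{(N)}_i,Y^{(N)}_i(t))}$, $t\ge0$; in particular $\mu^{(N)}_0=\frac1N\sum_{i=1}^N\delta_{(\rho^{(N)}_i,(x^{(N)}_i-1)/N)}$. In (2), $y_A(t_0,t)=1-\int e^{-\rho((t-t_0,t])}\Lambda(d\rho)$ ($0\le t_0\le t$), $y_B(y,t)=1-\int e^{-\rho((0,t])}\mu_0(d\rho\times[y,1))$ ($t\ge0$, $0\le y<1$), $y_C(t)=y_A(t,t)=y_B(0,t)$, $t_0(y,t)=\inf\{s\in[0,t]: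 y_A(s,t)\ge y\}$, $\hat y(y,t)=\inf\{x\in[0,1): y_B(x,t)\ge y\}$, and $\mu_t$ is the probability measure on $\mathcal M(\mathbb{R}_+)\times[0,1)$ with $\mu_t(d\rho\times[y,1))=e^{-\rho((t-t_0(y,t),t])}\Lambda(d\rho)$ for $0\le y\le y_C(t)$ and $\mu_t(d\rho\times[y,1))=e^{-\rho((0,t])}\mu_0(d\rho\times[\hat y(y,t),1))$ for $y_C(t)\le y<1$. Uniform convergence means $\sup_{t\in[0,T]}\pi(\mu^{(N)}_t,\mu_t)\to0$, where $\pi$ is the following metric for the weak topology. Fix a countable family of compactly supported continuous $e_n:\mathbb{R}_+\to\mathbb{R}$ such that $d((\rho_1,y_1),(\rho_2,y_2))=|y_1-y_2|+\sum_n2^{-n}(1\wedge|\int e_n\,d\rho_1-\int e_n\,d\rho_2|)$ is a metric on $\mathcal M(\mathbb{R}_+)\times[0,1)$ compatible with its topology. For each $k\in\mathbb{N}$ fix a countable set $\{f_{k,i}\}_i$ of continuous compactly supported functions on $\mathbb{R}^k\times[0,1)$ such that convergence of the integrals of all $f_{k,i}$ along a sequence of probability measures to those of a probability measure implies weak convergence. Let $\{f_n\}$ enumerate all functions $(\rho,y)\mapsto f_{k,i}(\int e_1d\rho,\dots,\int e_kd\rho,y)$. Then $\pi(\mu,\nu)=\sum_{n}2^{-n}\big(|\int f_n\,d\mu-\int f_n\,d\nu|\wedge1\big)$. *)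

(* Defs.v *)
From HB Require Import structures.
From mathcomp Require Import all_boot all_order all_algebra.
From mathcomp Require Export perm.
From mathcomp Require Export all_classical all_reals all_analysis.
From mathcomp Require Export measurable_realfun.
Set Implicit Arguments.
Unset Strict Implicit.
Unset Printing Implicit Defensive.
Import Order.TTheory GRing.Theory Num.Theory.
Import numFieldNormedType.Exports.

Local Open Scope classical_set_scope.
Local Open Scope ring_scope.

(* R_+ = [0, +oo[ and [0, 1[ with the subspace topology. *)
Definition Rplus (R : realType) : Type := set_type (`[0, +oo[%classic : set R).
Definition Ico01 (R : realType) : Type := set_type (`[0, 1[%classic : set R).

HB.instance Definition _ (R : realType) := PseudoMetric.on (Rplus R).
HB.instance Definition _ (R : realType) := SubType.on (Rplus R).
HB.instance Definition _ (R : realType) := PseudoMetric.on (Ico01 R).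
HB.instance Definition _ (R : realType) := SubType.on (Ico01 R).

Lemma zero_Rplus (R : realType) : (0 : R) \in (`[0, +oo[%classic : set R).
Proof. by rewrite inE /= in_itv /= lexx. Qed.

Lemma zero_Ico01 (R : realType) : (0 : R) \in (`[0, 1[%classic : set R).
Proof. by rewrite inE /= in_itv /= lexx ltr01. Qed.

HB.instance Definition _ (R : realType) :=
  isPointed.Build (Rplus R) (exist _ 0 (zero_Rplus R)).
HB.instance Definition _ (R : realType) :=
  isPointed.Build (Ico01 R) (exist _ 0 (zero_Ico01 R)).

(* Lets borel apply to products. *)
HB.instance Definition _ (T U : ptopologicalType) := Topological.on (T * U)%type.

Definition borel (T : ptopologicalType) : measurableType (@open T).-sigma :=
  g_sigma_algebraType (@open T).

Definition compactly_supported_continuous (R : realType) (T : topologicalType)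
    (f : T -> R) : Prop :=
  continuous f /\ exists2 K, compact K & forall x, ~ K x -> f x = 0.

(* Weak convergence on the Borel sets of T. The measures are passed as set
   functions, so that image measures and mixtures written as explicit formulas
   can be used directly. *)
Definition weak_cvg (R : realType) (T : ptopologicalType)
    (m_ : nat -> set (borel T) -> \bar R) (m : set (borel T) -> \bar R) : Prop :=
  forall f : T -> R, continuous f -> (exists M, forall x, `|f x| <= M) ->
    (fun N => \int[m_ N]_x (f x)%:E)%E @ \oo --> (\int[m]_x (f x)%:E)%E.

Definition measure_support (R : realType) (T : ptopologicalType)
    (m : set (borel T) -> \bar R) : set T :=
  [set x | forall U : set T, open U -> U x -> (0 < m U)%E].

Definition empirical (R : realType) (T : ptopologicalType) (N : nat)
    (z : 'I_N -> T) : set (borel T) -> \bar R :=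
  fun A => ((N%:R^-1)%:E * \sum_(i < N) (\d_(z i : borel T) A : \bar R))%E.

Arguments empirical {R T N} z.

(* Radon measures on R_+. In the library a measure also takes values on
   non-measurable sets; these are fixed to 0 here so that Leibniz equality of
   two Radon measures is equality on Borel sets (and hence the vague topology is
   Hausdorff). *)
Record radon (R : realType) := Radon {
  radon_measure :> {measure set (borel (Rplus R)) -> \bar R} ;
  radon_compact : forall K : set (Rplus R), compact K ->
    (radon_measure K < +oo)%E ;
  radon_nonmeasurable : forall A : set (borel (Rplus R)), ~ measurable A ->
    radon_measure A = 0%E }.

Section zero_radon.
Context (R : realType).
Let m0 : {measure set (borel (Rplus R)) -> \bar R} := mzero.
Let m0_compact (K : set (Rplus R)) : compact K -> (m0 K < +oo)%E.
Proof. by move=> _; rewrite /m0 /mzero ltry. Qed.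
Let m0_nonmeasurable (A : set (borel (Rplus R))) : ~ measurable A -> m0 A = 0%E.
Proof. by []. Qed.
Definition radon0 : radon R := Radon m0_compact m0_nonmeasurable.
End zero_radon.

HB.instance Definition _ (R : realType) := gen_eqMixin (radon R).
HB.instance Definition _ (R : realType) := gen_choiceMixin (radon R).
HB.instance Definition _ (R : realType) := isPointed.Build (radon R) (radon0 R).

(* The vague topology: the coarsest one making rho |-> \int f d rho continuous
   for every continuous f with compact support. *)
Definition vague_eval (R : realType) (rho : radon R) :
    {ptws {f : Rplus R -> R | compactly_supported_continuous f} -> R} :=
  fun f => \int[rho]_x (sval f x).

HB.instance Definition _ (R : realType) :=
  Topological.copy (radon R) (initial_topology (@vague_eval R)).

Definition mass (R : realType) (rho : radon R) (s t : R) : R :=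
  fine (rho [set u | s < \val u <= t]).

Lemma mass_Rplus (R : realType) (rho : radon R) (s t : R) :
  mass rho s t \in (`[0, +oo[%classic : set R).
Proof. by rewrite inE /= in_itv /= andbT fine_ge0. Qed.

Definition massRp (R : realType) (rho : radon R) (s t : R) : Rplus R :=
  exist _ (mass rho s t) (mass_Rplus rho s t).

Definition modulus (R : realType) (T : R) (F : set (R -> R)) (delta : R) :
    \bar R :=
  ereal_sup [set z | exists r s t,
    [/\ F r, 0 <= s <= T, 0 <= t <= T, `|s - t| <= delta &
        z = (`|r s - r t|)%:E]].

Definition uniformly_equicontinuous (R : realType) (T : R) (F : set (R -> R)) :
    Prop :=
  modulus T F delta @[delta --> 0^'+] --> 0%E.

Definition uniformly_continuous_on (R : realType) (D : set (R * R))
    (g : R * R -> R) : Prop :=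
  forall e : R, 0 < e -> exists2 delta : R, 0 < delta &
    forall p q, D p -> D q -> `|p - q| < delta -> `|g p - g q| < e.

Section random_measures.
Context d (Om : measurableType d) (R : realType) (P : probability Om R).

(* Mutual independence of finitely many sigma-algebras; since each of them
   contains the whole space, the product rule for subfamilies is included. *)
Definition independent_systems (n : nat) (F : 'I_n -> set (set Om)) : Prop :=
  forall A : 'I_n -> set Om, (forall i, F i (A i)) ->
    fine (P (\bigcap_i A i)) = \prod_(i < n) fine (P (A i)).

Definition sigma_random_measure d' (S : measurableType d') (nu : R.-ker Om ~> S) :
    set (set Om) :=
  <<s \bigcup_(A in measurable) g_sigma_algebra_preimage (fun w => nu w A) >>.

(* Poisson random measure with intensity rho (the second argument of
   poisson_prob is a dummy). *)
Definition poisson_random_measure d' (S : measurableType d')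
    (nu : R.-ker Om ~> S) (rho : {measure set S -> \bar R}) : Prop :=
  [/\ forall A, measurable A -> (rho A < +oo)%E -> forall k : nat,
        P [set w | nu w A = k%:R%:E] = poisson_prob (fine (rho A)) 0 [set k],
      forall A, measurable A -> rho A = +oo%E ->
        {ae P, forall w, nu w A = +oo%E} &
      forall n (A : 'I_n -> set S), (forall i, measurable (A i)) ->
        trivIset [set: 'I_n] A ->
        independent_systems
          (fun i => g_sigma_algebra_preimage (fun w => nu w (A i)))].

End random_measures.

Section ranking_process.
Context (R : realType) (N : nat).
Variables (x : {perm 'I_N}) (tau : 'I_N -> nat -> Rplus R).

(* Indices start from 0: tau i j is the point tau_(i, j+1), and the initial
   rank x_i is (x i).+1. When the points of particle i increase to infinity and
   the first one is at most t, there is exactly one index as in last_jump. *)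
Definition last_jump (i : 'I_N) (t : R) : nat :=
  xget 0%N [set j | \val (tau i j) <= t < \val (tau i j.+1)].

Definition ranking (i : 'I_N) (t : R) : nat :=
  if t < \val (tau i 0%N) then
    ((x i).+1 + \sum_(i' < N | (x i < x i')%N) (\val (tau i' 0%N) <= t)%R)%N
  else
    (1 + \sum_(i' < N)
       `[< exists j',
             (\val (tau i (last_jump i t)) < \val (tau i' j') <= t)%R >])%N.

(* (X_i(t) - 1) / N as a point of [0, 1[. The default value of insubd is only
   reached on the null event where the points of a particle do not increase to
   infinity. *)
Definition position (i : 'I_N) (t : R) : Ico01 R :=
  insubd (point : Ico01 R) ((ranking i t).-1%:R / N%:R).

Definition initial_position (i : 'I_N) : Ico01 R :=
  insubd (point : Ico01 R) ((x i)%:R / N%:R).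

Definition jumped_fraction (t : R) : R :=
  (\sum_(i < N) (\val (tau i 0%N) <= t)%R)%N%:R / N%:R.

Definition simple_points (m : 'I_N -> {measure set (borel (Rplus R)) -> \bar R}) :
    Prop :=
  [/\ forall i (A : set (borel (Rplus R))), measurable A ->
        m i A = (\sum_(j <oo) (\d_(tau i j : borel (Rplus R)) A : \bar R))%E,
      forall i, 0 < \val (tau i 0%N),
      forall i j, \val (tau i j) < \val (tau i j.+1) &
      forall i j i' j', (i, j) <> (i', j') -> tau i j <> tau i' j'].

End ranking_process.

Arguments initial_position {R N} x i.

Section limit_measure.
Context (R : realType).

(* m(. x [y, 1)); with y = 0 this is the first marginal m(. x [0, 1)). *)
Definition slice (m : set (borel (radon R * Ico01 R)%type) -> \bar R) (y : R) :
    set (borel (radon R)) -> \bar R :=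
  fun A => m (A `*` [set z : Ico01 R | y <= \val z]).

(* The law of rho((s, t]) under Lam. *)
Definition mass_law (Lam : set (borel (radon R)) -> \bar R) (s t : R) :
    set (borel (Rplus R)) -> \bar R :=
  fun B => (\int[Lam]_rho \d_(massRp rho s t : borel (Rplus R)) B)%E.

Variable mu0 : set (borel (radon R * Ico01 R)%type) -> \bar R.
Let Lam := slice mu0 0.

Definition yA (t0 t : R) : R :=
  1 - fine (\int[Lam]_rho (expR (- mass rho (t - t0) t))%:E)%E.

Definition yB (y t : R) : R :=
  1 - fine (\int[slice mu0 y]_rho (expR (- mass rho 0 t))%:E)%E.

Definition yC (t : R) : R := yA t t.

Definition t0_of (y t : R) : R := inf [set s | 0 <= s <= t /\ y <= yA s t].

Definition yhat (y t : R) : R := inf [set u | 0 <= u < 1 /\ y <= yB u t].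

Definition is_limit_measure (t : R)
    (mut : set (borel (radon R * Ico01 R)%type) -> \bar R) : Prop :=
  forall A : set (borel (radon R)), measurable A ->
    (forall y, 0 <= y <= yC t ->
      slice mut y A =
      (\int[Lam]_(rho in A) (expR (- mass rho (t - t0_of y t) t))%:E)%E) /\
    (forall y, yC t <= y < 1 ->
      slice mut y A =
      (\int[slice mu0 (yhat y t)]_(rho in A) (expR (- mass rho 0 t))%:E)%E).

End limit_measure.

Section weak_metric.
Context (R : realType).

Definition metrizes (T : topologicalType) (dist : T -> T -> \bar R) : Prop :=
  [/\ forall p q, (0 <= dist p q < +oo)%E,
      forall p q, dist p q = 0%E <-> p = q,
      forall p q, dist p q = dist q p,
      forall p q r, (dist p r <= dist p q + dist q r)%E &
      forall p (U : set T), nbhs p U <->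
        exists2 e : R, 0 < e & [set q | (dist p q < e%:E)%E] `<=` U].

(* Sums over n >= 1 are indexed from 0, with weights 2^-(n+1). *)
Definition state_dist (e : nat -> Rplus R -> R) (p q : radon R * Ico01 R) :
    \bar R :=
  ((`|\val p.2 - \val q.2|)%:E + \sum_(n <oo)
    (2 ^- n.+1 * Num.min 1 `|\int[p.1]_u e n u - \int[q.1]_u e n u|)%:E)%E.

Definition convergence_determining (T : ptopologicalType) (g : nat -> T -> R) :
    Prop :=
  forall (m_ : nat -> probability (borel T) R) (m : probability (borel T) R),
    (forall i, (fun n => \int[m_ n]_x g i x) @ \oo --> \int[m]_x g i x) ->
    weak_cvg (fun n => m_ n : set (borel T) -> \bar R) m.

(* (rho, y) |-> g(\int e_1 d rho, ..., \int e_k d rho, y) *)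
Definition cylinder (e : nat -> Rplus R -> R) (k : nat)
    (g : 'rV[R]_k * Ico01 R -> R) (p : radon R * Ico01 R) : R :=
  g (\row_(j < k) \int[p.1]_u e j u, p.2).

Record weak_metric_data (e : nat -> Rplus R -> R)
    (fk : forall k, nat -> 'rV[R]_k * Ico01 R -> R)
    (f : nat -> radon R * Ico01 R -> R) : Prop := {
  e_cc : forall n, compactly_supported_continuous (e n) ;
  e_metric : metrizes (state_dist e) ;
  fk_cc : forall k i, (0 < k)%N -> compactly_supported_continuous (fk k i) ;
  fk_determining : forall k, (0 < k)%N -> convergence_determining (fk k) ;
  f_enum : range f =
    [set g | exists k i, (0 < k)%N /\ g = cylinder e (fk k i)] }.

Definition weak_dist (f : nat -> radon R * Ico01 R -> R)
    (m1 m2 : set (borel (radon R * Ico01 R)%type) -> \bar R) : \bar R :=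
  (\sum_(n <oo) (2 ^- n.+1 *
    Num.min `|fine (\int[m1]_p (f n p)%:E) - fine (\int[m2]_p (f n p)%:E)| 1)%:E)%E.

End weak_metric.

(* Used for nonnegative g only. *)
Definition sup_cvg0 (R : realType) (T : R) (g : nat -> R -> \bar R) : Prop :=
  (fun N => ereal_sup [set g N t | t in [set t | 0 <= t <= T]]) @ \oo --> 0%E.

(* Main.v *)
(* Whether a particle sits at a relative rank at least y at time t is decided by
   its initial rank and its jumps: if a = 0 or u = 0, the particles with initial
   position at least u and no jump in (a, t] form the bottom part of the ranking at
   time t.  So do the particles at position at least y; hence one of the two sets
   contains the other and they differ by as many particles as their cardinals do.
   Everything thus reduces to the averages
     1/N sum_i h(rho_i) 1_{x_i/N >= u} 1_{no jump of i in (a, b]},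
   whose expectation has the factor exp(-rho_i((a, b])) in place of the last
   indicator.  For fixed (u, a, b) a Chernoff bound and Borel-Cantelli give almost
   sure convergence to int h(rho) 1_{y >= u} exp(-rho((a, b])) d mu_0; as the
   averages are monotone in each of u, a, b, convergence on a grid makes it uniform.
   With h = 1 and (u, a) = (yhat, 0) or (0, t - t_0) the limit is 1 - y, so the two
   sets above have almost the same cardinal, and the general h gives the limit of
   the measure of particles above y.  Cylinder functions are uniformly
   approximated by combinations of functions h(rho) 1_{position >= y}.  The limit
   law mu_t itself is the image of mu_0 x (uniform law) under the map that samples
   a position from the tail y |-> P(position >= y | initial state). *)
Require Import Defs.
From HB Require Import structures.
From mathcomp Require Import all_boot all_order all_algebra perm.
From mathcomp Require Import all_classical all_reals all_analysis.
From mathcomp Require Import measurable_realfun.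
From mathcomp Require Import ring lra.
Set Implicit Arguments.
Unset Strict Implicit.
Unset Printing Implicit Defensive.
Import Order.TTheory GRing.Theory Num.Theory.
Import numFieldNormedType.Exports.
Local Open Scope classical_set_scope.
Local Open Scope ring_scope.

(** * A law of large numbers for triangular arrays of independent events *)

(** Neither [rho |-> rho((a, b])] nor the indicator of [y >= u] is continuous, so weak convergence
    of the initial laws cannot be applied to the averages directly, and both are smoothed. The error
    in the mass is bounded by masses of short intervals: these are uniformly small over all
    particles by equicontinuity of [I], and [mu0]-almost everywhere by that of [J], as the support
    of the first marginal has full measure. The error in the rank is bounded before the limit by
    counting, since initial ranks form a permutation, and in the limit by placing the ramp to the
    left of [u]. The same counting gives the averages a modulus of continuity up to [1/N], which the
    limit inherits; this makes finite grids sufficient. As [yhat] and [t_0] vary with [t],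
    uniformity in [(u, a, b)] jointly is what gives uniformity in [t]. Sampling needs a tail
    continuous from the left; it is so because [t_0] and [yhat] are infima, even where [yA] or [yB]
    has flat pieces. *)

Lemma expR_le_quadratic (R : realType) (v : R) : v <= 2^-1 ->
  expR v <= 1 + v + 2 * v ^+ 2.
Proof.
move=> v2.
have h : expR v * (1 - v) <= 1.
  have e : 1 - v <= expR (- v) by exact: expR_ge1Dx.
  have e0 := expR_gt0 v.
  have e1 : expR v * expR (- v) = 1 by rewrite -expRD subrr expR0.
  nra.
have e0 := expR_gt0 v.
have : 0 < 1 - v by lra.
(* The product is [1 + v ^+ 2 * (1 - 2 * v)], whence the restriction on [v]. *)
have : 1 <= (1 + v + 2 * v ^+ 2) * (1 - v) by nra.
nra.
Qed.

Lemma bernoulli_mgf_le (R : realType) (p u : R) : 0 <= p <= 1 -> `|u| <= 2^-1 ->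
  expR (u * (1 - p)) * p + expR (u * (0 - p)) * (1 - p) <= expR (2 * u ^+ 2).
Proof.
move=> /andP[p0 p1]; rewrite ler_norml => /andP[u1 u2].
have h1 : expR (u * (1 - p)) <= 1 + u * (1 - p) + 2 * (u * (1 - p)) ^+ 2.
  by apply: expR_le_quadratic; nra.
have h2 : expR (u * (0 - p)) <= 1 + u * (0 - p) + 2 * (u * (0 - p)) ^+ 2.
  by apply: expR_le_quadratic; nra.
have h3 : 1 + 2 * u ^+ 2 <= expR (2 * u ^+ 2) by exact: expR_ge1Dx.
have h4 : 0 <= u ^+ 2 by rewrite sqr_ge0.
have h5 : p * (1 - p) <= 1 by nra.
apply: le_trans h3.
(* The linear terms cancel because the variable is centred; the quadratic ones add up to
   [2 * u ^+ 2] times the variance [p * (1 - p)]. *)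
apply: (@le_trans _ _ (1 + 2 * u ^+ 2 * (p * (1 - p)))); last nra.
have : expR (u * (1 - p)) * p <=
  (1 + u * (1 - p) + 2 * (u * (1 - p)) ^+ 2) * p by apply: ler_wpM2r.
have : expR (u * (0 - p)) * (1 - p) <=
  (1 + u * (0 - p) + 2 * (u * (0 - p)) ^+ 2) * (1 - p).
  by apply: ler_wpM2r => //; lra.
nra.
Qed.

Section independent_events.
Context d (Om : measurableType d) (R : realType) (P : probability Om R).
Variables (n : nat) (E : 'I_n -> set Om).
Hypothesis mE : forall i, measurable (E i).
Hypothesis indE : independent_systems P
  (fun i => [set A | A = E i \/ A = ~` E i]).
Let p i := fine (P (E i)).

Let p01 i : 0 <= p i <= 1.
Proof.
rewrite /p fine_ge0//= -lee_fin fineK ?fin_num_measure//.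
exact: probability_le1.
Qed.

Let pC i : fine (P (~` E i)) = 1 - p i.
Proof. by rewrite probability_setC// fineB ?fin_num_measure. Qed.

(** Expanding over the patterns [f] of occurring and failing events turns the integrand into a
    nonnegative combination of indicators of the intersections [BI f], and the product rule gives
    the probability of each of these. *)
Lemma expectation_prod_events (a b : 'I_n -> R) :
  (forall i, 0 <= a i) -> (forall i, 0 <= b i) ->
  (\int[P]_w (\prod_(i < n) (if w \in E i then a i else b i))%:E =
   (\prod_(i < n) (a i * p i + b i * (1 - p i)))%:E)%E.
Proof.
move=> a0 b0.
pose c i (j : bool) := if j then a i else b i.
pose B i (j : bool) := if j then E i else ~` E i.
have mB i j : measurable (B i j).
  by rewrite /B; case: j => //; exact: measurableC.
pose BI (f : {ffun 'I_n -> bool}) := \bigcap_i B i (f i).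
have mBI f : measurable (BI f).
  by apply: fin_bigcap_measurable.
have cE w : \prod_(i < n) (if w \in E i then a i else b i) =
   \sum_(f : {ffun 'I_n -> bool}) (\prod_i c i (f i)) * \1_(BI f) w.
  transitivity (\prod_(i < n) \sum_(j : bool) c i j * \1_(B i j) w).
    apply: eq_bigr => i _; rewrite big_bool/= /c /B !indicE in_setC.
    by case: (w \in E i) => /=; rewrite ?mulr1 ?mulr0 ?addr0 ?add0r.
  rewrite bigA_distr_bigA/=; apply: eq_bigr => f _.
  rewrite big_split/=; congr (_ * _).
  have [wB|wB] := boolP (w \in BI f).
    rewrite indicE wB/=; apply: big1 => i _; rewrite indicE mem_set//.
    by move: wB; rewrite inE; exact.
  rewrite indicE (negbTE wB)/=.
  have : ~ (forall i, B i (f i) w).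
    by move=> h; move: wB; rewrite notin_setE; apply => i _; exact: h.
  move=> /existsNP[i wi]; rewrite (bigD1 i)//= indicE memNset ?mul0r//.
have c0 (f : {ffun 'I_n -> bool}) : 0 <= \prod_i c i (f i).
  by apply: prodr_ge0 => i _; rewrite /c; case: (f i).
under eq_integral do rewrite cE -sumEFin.
rewrite ge0_integral_sum//=; last 2 first.
  - move=> f; apply/measurable_EFinP/measurable_funM => //.
  - by move=> f w _; rewrite lee_fin mulr_ge0.
transitivity (\sum_(f : {ffun 'I_n -> bool})
   (\prod_i (c i (f i) * fine (P (B i (f i)))))%:E)%E.
  apply: eq_bigr => f _; under eq_integral do rewrite EFinM.
  rewrite ge0_integralZl//=; last 2 first.
  - by apply/measurable_EFinP.
  - by rewrite lee_fin.
  rewrite integral_indic// setIT big_split/= EFinM; congr (_ * _)%E.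
  rewrite -(indE (A := fun i => B i (f i))).
    by rewrite fineK// fin_num_measure//; exact: mBI.
  by move=> i; rewrite /B; case: (f i); [left|right].
rewrite sumEFin; congr EFin.
rewrite -(bigA_distr_bigA (fun i j => c i j * fine (P (B i j))))/=.
apply: eq_bigr => i _; rewrite big_bool/= pC//.
Qed.

Lemma chernoff_events (c : 'I_n -> R) (e : R) : 0 < e <= 1 ->
  (forall i, `|c i| <= 1) ->
  (P [set w | n%:R * e <= \sum_(i < n) c i * ((w \in E i)%:R - p i)]%R <=
   (expR (- (e ^+ 2 / 8)) ^+ n)%:E)%E.
Proof.
move=> /andP[e0 e1] c1.
(* This value minimises the exponent [2 * th ^+ 2 - th * e], with minimum [- (e ^+ 2 / 8)]; since
   [e <= 1], it also keeps [th * c i] within the range of [bernoulli_mgf_le]. *)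
pose th := e / 4.
pose S w := \sum_(i < n) c i * ((w \in E i)%:R - p i).
have mS : measurable_fun setT S.
  apply: measurable_sum => i; apply: measurable_funM => //.
  apply: measurable_funB => //.
  have -> : (fun w => (w \in E i)%:R) = \1_(E i) :> (Om -> R).
    by apply/funext => w; rewrite indicE.
  by [].
pose B := [set w | n%:R * e <= S w].
have mB : measurable B.
  rewrite -[X in measurable X]setTI.
  have -> : B = S @^-1` `[n%:R * e, +oo[%classic.
    by apply/seteqP; split => w /=; rewrite in_itv/= andbT.
  exact: mS.
have I1 : (\int[P]_w (expR (th * S w))%:E <= (expR (2 * th ^+ 2) ^+ n)%:E)%E.
  have -> : (\int[P]_w (expR (th * S w))%:E = \int[P]_w
      (\prod_(i < n) (if w \in E i then expR (th * c i * (1 - p i))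
                      else expR (th * c i * (0 - p i))))%:E)%E.
    apply: eq_integral => w _; congr EFin.
    rewrite /S mulr_sumr expR_sum; apply: eq_bigr => i _.
    by rewrite mulrA; case: (w \in E i).
  rewrite expectation_prod_events; try by move=> ?; exact: expR_ge0.
  rewrite lee_fin -[X in _ <= _ ^+ X]card_ord -prodr_const.
  apply: ler_prod => i _; apply/andP; split.
    have /andP[? ?] := p01 i.
    by rewrite addr_ge0// mulr_ge0// ?expR_ge0//; lra.
  have ce : `|th * c i| <= e / 4.
    rewrite normrM /th ger0_norm; last by lra.
    by have := c1 i; have := normr_ge0 (c i); nra.
  apply: le_trans (bernoulli_mgf_le (p01 i) _) _; first by lra.
  rewrite ler_expR.
  have : (th * c i) ^+ 2 <= th ^+ 2.
    rewrite -real_normK ?num_real// ler_sqr ?nnegrE//.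
    by rewrite /th; lra.
  lra.
(* Markov's inequality for the exponential of [th * S w]. *)
have I2 : ((expR (th * (n%:R * e)))%:E * P B <=
    \int[P]_w (expR (th * S w))%:E)%E.
  rewrite -[X in (_ * P X)%E]setIT -integral_indic//.
  rewrite -ge0_integralZl//=; last first.
    by apply/measurable_EFinP.
  apply: ge0_le_integral => //=.
  - by apply: measurable_funeM; exact/measurable_EFinP.
  - apply/measurable_EFinP/measurableT_comp => //.
    exact: measurable_funM.
  - move=> w _; rewrite -EFinM lee_fin indicE.
  have [wB|_] := boolP (w \in _); last by rewrite mulr0 expR_ge0.
  move: wB; rewrite inE/= => wB.
  by rewrite mulr1 ler_expR ler_wpM2l// /th; lra.
have := le_trans I2 I1.
rewrite -(@fineK _ (P _)) ?fin_num_measure// -EFinM !lee_fin => H.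
suff : fine (P B) <= expR (- (e ^+ 2 / 8)) ^+ n.
  by rewrite -lee_fin fineK// fin_num_measure.
have -> : expR (- (e ^+ 2 / 8)) ^+ n =
    expR (- (th * (n%:R * e))) * expR (2 * th ^+ 2) ^+ n.
  rewrite -2!expRM_natl -expRD; congr expR; by rewrite /th; field.
have e2 : expR (- (th * (n%:R * e))) * expR (th * (n%:R * e)) = 1.
  by rewrite -expRD addNr expR0.
apply: (@le_trans _ _ (expR (- (th * (n%:R * e))) *
    (expR (th * (n%:R * e)) * fine (P B)))); first by rewrite mulrA e2 mul1r.
by rewrite ler_wpM2l// expR_ge0.
Qed.

End independent_events.

Lemma borel_cantelli_ae d (Om : measurableType d) (R : realType)
    (P : probability Om R) (F : nat -> set Om) (q : R) (C : R) :
  (forall n, measurable (F n)) -> 0 <= q < 1 ->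
  (forall n, (P (F n) <= (C * q ^+ n)%:E)%E) ->
  {ae P, forall w, \forall n \near \oo, ~ F n w}.
Proof.
move=> mF /andP[q0 q1] PF.
have C0 : 0 <= C.
  by have := le_trans (measure_ge0 P (F 0%N)) (PF 0%N); rewrite expr0 mulr1 lee_fin.
exists (lim_sup_set F); split.
- by apply: bigcap_measurable => // n _; apply: bigcup_measurable.
- apply: lim_sup_set_cvg0 => //.
  apply: (@le_lt_trans _ _ (\sum_(n <oo) (geometric C q n)%:E)%E).
    by apply: lee_nneseries => // n _; exact: PF.
  have := @cvg_geometric_series _ C q; rewrite ger0_norm// => /(_ q1) h.
  have -> : (\sum_(n <oo) (geometric C q n)%:E)%E = (C * (1 - q)^-1)%:E.
    apply/cvg_lim => //.
    have -> : (fun n => (\sum_(0 <= i < n) (geometric C q i)%:E)%E) =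
              EFin \o series (geometric C q).
      by apply/funext => n /=; rewrite sumEFin.
    by apply: cvg_EFin => //; apply: nearW.
  by rewrite ltry.
- move=> w /= nw n _ ; apply: contrapT => h; apply: nw.
  exists n => // k /= nk Fk; apply: h; exists k => //.
Qed.

Lemma measurable_sum_indicators d (Om : measurableType d) (R : realType)
    (n : nat) (E : 'I_n -> set Om) (c p : 'I_n -> R) :
  (forall i, measurable (E i)) ->
  measurable_fun setT (fun w => \sum_(i < n) c i * ((w \in E i)%:R - p i)).
Proof.
move=> mE; apply: measurable_sum => i; apply: measurable_funM => //.
apply: measurable_funB => //.
have -> : (fun w => (w \in E i)%:R) = \1_(E i) :> (Om -> R).
  by apply/funext => w; rewrite indicE.
by [].
Qed.

Lemma lln_events d (Om : measurableType d) (R : realType)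
    (P : probability Om R) (E : forall N, 'I_N -> set Om)
    (c : forall N, 'I_N -> R) (M : R) :
  (forall N (i : 'I_N), measurable (E N i)) ->
  (forall N, independent_systems P
     (fun i => [set A | A = E N i \/ A = ~` E N i])) ->
  (forall N (i : 'I_N), `|c N i| <= M) ->
  {ae P, forall w, (fun N => N%:R^-1 *
    \sum_(i < N) c N i * ((w \in E N i)%:R - fine (P (E N i)))) @ \oo --> (0 : R)}.
Proof.
move=> mE indE cM.
(* [chernoff_events] asks for weights of size at most 1; adding 1 keeps the divisor positive when
   [M] is 0. *)
pose M1 := 1 + `|M|.
have M10 : 0 < M1 by rewrite /M1; have := normr_ge0 M; lra.
pose c1 N (i : 'I_N) := c N i / M1.
have c1_le1 N i : `|c1 N i| <= 1.
  rewrite /c1 normrM normfV (gtr0_norm M10).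
  rewrite ler_pdivrMr// mul1r (le_trans (cM _ _))// /M1.
  by have := ler_norm M; lra.
pose S (c : forall N, 'I_N -> R) N w :=
  \sum_(i < N) c N i * ((w \in E N i)%:R - fine (P (E N i))).
have mS c' N : measurable_fun setT (S c' N).
  exact: measurable_sum_indicators.
(* The accuracies run through [k.+1%:R^-1], so that only countably many null sets are united. *)
have H k : {ae P, forall w, \forall N \near \oo,
    ~ N%:R * k.+1%:R^-1 <= `|S c1 N w|}.
  pose e : R := k.+1%:R^-1.
  have e01 : 0 < e <= 1 by rewrite /e invr_gt0 ltr0n/= invf_le1 ?ler1n ?ltr0n.
  apply: (@borel_cantelli_ae _ _ _ P (fun N => [set w | N%:R * e <= `|S c1 N w|])
     (expR (- (e ^+ 2 / 8))) 2).
  - move=> N; rewrite -[X in measurable X]setTI.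
    have -> : [set w | N%:R * e <= `|S c1 N w|] =
        ((fun r : R => `|r|) \o S c1 N) @^-1` `[N%:R * e, +oo[%classic.
      by apply/seteqP; split => w /=; rewrite in_itv/= andbT.
    by apply: measurableT_comp.
  - rewrite expR_ge0/= -[X in _ < X]expR0 ltr_expR.
    by case/andP: e01 => e0 _; have h := exprn_gt0 2 e0; lra.
  - move=> N.
    pose B (c : forall N, 'I_N -> R) := [set w | N%:R * e <= S c N w].
    have mB c' : measurable (B c').
      rewrite -[X in measurable X]setTI.
      have -> : B c' = S c' N @^-1` `[N%:R * e, +oo[%classic.
        by apply/seteqP; split => w /=; rewrite in_itv/= andbT.
      exact: mS.
    pose c2 N (i : 'I_N) := - c1 N i.
    (* The two-sided event is covered by two one-sided ones, for the weights [c1] and [- c1]; hence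
       the constant 2 given to Borel-Cantelli. *)
    have sub : [set w | N%:R * e <= `|S c1 N w|] `<=`
        B c1 `|` B c2.
      move=> w; rewrite /B/=.
      have -> : S c2 N w = - S c1 N w.
        by rewrite /S -sumrN; apply: eq_bigr => i _; rewrite mulNr.
      by case: (ger0P (S c1 N w)) => _ h; [left|right].
    have mN : measurable [set w | N%:R * e <= `|S c1 N w|].
      rewrite -[X in measurable X]setTI.
      have -> : [set w | N%:R * e <= `|S c1 N w|] =
          ((fun r : R => `|r|) \o S c1 N) @^-1` `[N%:R * e, +oo[%classic.
        by apply/seteqP; split => w /=; rewrite in_itv/= andbT.
      by apply: measurableT_comp.
    apply: (@le_trans _ _ (P (B c1) + P (B c2))%E).
      apply: le_trans (measureU2 _ _ _) => //.
      by apply: le_measure; rewrite ?inE//; exact: measurableU.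
    have -> : 2 * expR (- (e ^+ 2 / 8)) ^+ N =
      expR (- (e ^+ 2 / 8)) ^+ N + expR (- (e ^+ 2 / 8)) ^+ N by ring.
    rewrite EFinD; apply: leeD; apply: chernoff_events => //.
    by move=> i; rewrite normrN.
have : {ae P, forall w, forall k, \forall N \near \oo,
    ~ N%:R * k.+1%:R^-1 <= `|S c1 N w|} by exact/ae_foralln.
apply: filterS => w Hw; apply/cvgrPdist_lt => eps eps0.
have [k kM] : exists k, M1 / eps < k.+1%:R.
  exists (Num.trunc (M1 / eps)).
  by rewrite truncnS_gt.
have := Hw k; apply: filter_app; near=> N => /negP; rewrite -ltNge => h.
have N0 : (0 < N)%N by near: N; exact: nbhs_infty_gt.
rewrite sub0r normrN normrM ger0_norm ?invr_ge0//.
have -> : \sum_(i < N) c N i * ((w \in E N i)%:R - fine (P (E N i))) =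
   M1 * S c1 N w.
  rewrite /S mulr_sumr; apply: eq_bigr => i _; rewrite /c1 mulrA.
  by congr (_ * _); rewrite mulrC divfK// gt_eqF.
rewrite normrM (gtr0_norm M10) ltr_pdivrMl ?ltr0n//.
apply: (@lt_le_trans _ _ (M1 * (N%:R * k.+1%:R^-1))).
  by rewrite ltr_pM2l.
rewrite mulrCA ler_wpM2l// ler_pdivrMr ?ltr0n// mulrC -ler_pdivrMr//.
exact: ltW.
Unshelve. all: by end_near.
Qed.

(** * Poisson random measures on the half-line *)

Lemma borel_open (T : ptopologicalType) (A : set T) : open A ->
  measurable (A : set (borel T)).
Proof. exact: sub_sigma_algebra. Qed.

Lemma continuous_borel (T U : ptopologicalType) (f : T -> U) : continuous f ->
  measurable_fun setT (f : borel T -> borel U).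
Proof.
move=> /continuousP cf; apply: measurability; first by [].
by move=> _ [B oB <-]; rewrite setTI; apply: borel_open; exact: cf.
Qed.

Lemma continuous_borel_real (R : realType) (T : ptopologicalType) (f : T -> R) :
  continuous f -> measurable_fun setT (f : borel T -> R).
Proof.
move=> /continuousP cf; apply: (measurability _ (RGenOpens.measurableE R)).
move=> _ [_ [a [b ->] <-]]; rewrite setTI; apply: borel_open.
by apply: cf; exact: interval_open.
Qed.

Section Rplus_topology.
Context (R : realType).

Lemma continuous_valRp : continuous (\val : Rplus R -> R).
Proof. exact: initial_continuous. Qed.

Lemma continuous_valIco : continuous (\val : Ico01 R -> R).
Proof. exact: initial_continuous. Qed.

Lemma valRp_ge0 (u : Rplus R) : 0 <= \val u.
Proof. by have := valP u; rewrite inE/= in_itv/= andbT. Qed.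

Lemma valIco_ge0 (z : Ico01 R) : 0 <= \val z.
Proof. by have := valP z; rewrite inE/= in_itv/= => /andP[]. Qed.

Lemma valIco_lt1 (z : Ico01 R) : \val z < 1.
Proof. by have := valP z; rewrite inE/= in_itv/= => /andP[]. Qed.

Let max0_Rplus (r : R) : Num.max 0 r \in (`[0, +oo[%classic : set R).
Proof. by rewrite inE/= in_itv/= andbT le_max lexx. Qed.

(** A continuous map of the line onto the half-line that fixes the latter; it transports compactness
    of real segments to the subspace type. *)
Let pos_part (r : R) : Rplus R := exist _ (Num.max 0 r) (max0_Rplus r).

Let continuous_pos_part : continuous pos_part.
Proof.
apply: continuous_comp_initial => r /=.
have -> : \val \o pos_part = (fun x : R => Num.max 0 x) by [].
by apply: (@continuous_max R R (cst 0) id) => //; exact: cst_continuous.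
Qed.

Lemma compact_Rplus_le (b : R) : compact [set u : Rplus R | \val u <= b].
Proof.
have -> : [set u : Rplus R | \val u <= b] = pos_part @` `[0, b]%classic.
  apply/seteqP; split => [u /= ub|_ [r /= + <-]]/=.
    exists (\val u); first by rewrite /= in_itv/= valRp_ge0.
    by apply/val_inj => /=; rewrite max_r// valRp_ge0.
  by rewrite in_itv/= => /andP[r0 rb]; rewrite max_r.
apply: continuous_compact; last exact: segment_compact.
by apply: continuous_subspaceT.
Qed.

Lemma measurable_Ioc (a b : R) :
  measurable ([set u : Rplus R | a < \val u <= b] : set (borel (Rplus R))).
Proof.
have -> : [set u : Rplus R | a < \val u <= b] =
    \val @^-1` `]a, b]%classic.
  by apply/seteqP; split => u /=; rewrite in_itv.
have := continuous_borel_real continuous_valRp.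
by move=> /(_ measurableT `]a, b]%classic); rewrite setTI; apply.
Qed.

Lemma measurable_Rplus_le (b : R) :
  measurable ([set u : Rplus R | \val u <= b] : set (borel (Rplus R))).
Proof.
have -> : [set u : Rplus R | \val u <= b] = \val @^-1` `]-oo, b]%classic.
  by apply/seteqP; split => u /=; rewrite in_itv.
have := continuous_borel_real continuous_valRp.
by move=> /(_ measurableT `]-oo, b]%classic); rewrite setTI; apply.
Qed.

Lemma radon_Ioc_lty (rho : radon R) (a b : R) :
  (rho [set u | a < \val u <= b]%R < +oo)%E.
Proof.
apply: le_lt_trans (radon_compact rho (@compact_Rplus_le b)).
apply: le_measure; rewrite ?inE.
- exact: measurable_Ioc.
- exact: measurable_Rplus_le.
- by move=> u /= /andP[].
Qed.

Lemma mass_ge0 (rho : radon R) (a b : R) : 0 <= mass rho a b.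
Proof. by rewrite /mass fine_ge0. Qed.

Lemma massE (rho : radon R) (a b : R) :
  ((mass rho a b)%:E = rho [set u | (a < \val u <= b)%R])%E.
Proof.
by rewrite /mass fineK// ge0_fin_numE ?measure_ge0//; exact: radon_Ioc_lty.
Qed.

Lemma mass0 (rho : radon R) (a b : R) : b <= a -> mass rho a b = 0.
Proof.
move=> ba; rewrite /mass (_ : [set u | _] = set0) ?measure0//.
apply/seteqP; split => u //= /andP[au ub].
by move: (lt_le_trans au (le_trans ub ba)); rewrite ltxx.
Qed.

Lemma massD (rho : radon R) (a b c : R) : a <= b -> b <= c ->
  mass rho a c = mass rho a b + mass rho b c.
Proof.
move=> ab bc; apply: EFin_inj; rewrite EFinD !massE -measureU.
- congr (rho _); apply/seteqP; split => u /=.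
    by move=> /andP[au uc]; case: (leP (\val u) b) => h; [left|right]; apply/andP.
  case=> /andP[h1 h2]; apply/andP; split => //; first exact: le_trans bc.
  exact: le_lt_trans h1.
- exact: measurable_Ioc.
- exact: measurable_Ioc.
- apply/seteqP; split => u //= [/andP[_ h1] /andP[h2 _]].
  by move: (lt_le_trans h2 h1); rewrite ltxx.
Qed.

Lemma massS (rho : radon R) (a b a' b' : R) : a' <= a -> b <= b' ->
  mass rho a b <= mass rho a' b'.
Proof.
move=> aa bb; rewrite -lee_fin !massE; apply: le_measure; rewrite ?inE.
- exact: measurable_Ioc.
- exact: measurable_Ioc.
move=> u /= /andP[h1 h2]; apply/andP; split; first exact: le_lt_trans h1.
exact: le_trans bb.
Qed.

End Rplus_topology.

Section poisson_void.
Context d (Om : measurableType d) (R : realType) (P : probability Om R).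
Context d' (S : measurableType d').
Implicit Types (nu : R.-ker Om ~> S) (A : set S).

Definition void_event nu A : set Om := [set w | nu w A = 0%E].

Lemma sigma_random_measure_void nu A : measurable A ->
  sigma_random_measure nu (void_event nu A).
Proof.
move=> mA; apply: sub_sigma_algebra; exists A => //.
exists [set 0%E]; first exact: emeasurable_set1.
by rewrite setTI.
Qed.

Lemma measurable_void nu A : measurable A -> measurable (void_event nu A).
Proof.
move=> mA; have := @measurable_kernel _ _ _ _ _ nu A mA measurableT [set 0%E].
by rewrite setTI; apply; exact: emeasurable_set1.
Qed.

Lemma poisson_void nu (rho : {measure set S -> \bar R}) A :
  poisson_random_measure P nu rho -> measurable A -> (rho A < +oo)%E ->
  P (void_event nu A) = (expR (- fine (rho A)))%:E.
Proof.
move=> [+ _ _] mA rA; move=> /(_ A mA rA 0%N).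
rewrite /void_event /poisson_prob => ->; case: ifPn => r0.
  rewrite esum_set1; last by rewrite lee_fin poisson_pmf_ge0.
  by rewrite /poisson_pmf r0 expr0 fact0 invr1 !mul1r.
(* At a rate that is not positive [poisson_prob] is by convention the point mass at 0, in agreement
   with [expR 0 = 1]. *)
have -> : fine (rho A) = 0.
  by apply/eqP; rewrite eq_le leNgt r0/= fine_ge0.
by rewrite oppr0 expR0 diracE mem_set.
Qed.

(** The events that [nu w A] is a given natural number are disjoint and their Poisson probabilities
    add up to 1, which leaves nothing for the value [+oo]. *)
Lemma poisson_fin nu (rho : {measure set S -> \bar R}) A :
  poisson_random_measure P nu rho -> measurable A -> (rho A < +oo)%E ->
  {ae P, forall w, (nu w A < +oo)%E}.
Proof.
move=> [+ _ _] mA rA; move=> /(_ A mA rA) Pk.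
pose B k := [set w | nu w A = k%:R%:E].
have mB k : measurable (B k).
  have := @measurable_kernel _ _ _ _ _ nu A mA measurableT [set k%:R%:E].
  by rewrite setTI; apply; exact: emeasurable_set1.
have tB : trivIset setT B.
  move=> i j _ _ [w [wi wj]]; have : i%:R%:E = j%:R%:E :> \bar R.
    by rewrite -[LHS]wi -[RHS]wj.
  by case=> /eqP; rewrite eqr_nat => /eqP.
have mU : measurable (\bigcup_k B k) by exact: bigcup_measurable.
have PU : P (\bigcup_k B k) = 1%E.
  have h := measure_bigcup P setT B (fun i _ => mB i) tB.
  rewrite h.
  have -> : (\sum_(i <oo | i \in [set: nat]) P (B i) =
     \sum_(i <oo | i \in [set: nat]) poisson_prob (fine (rho A)) 0 [set i])%E.
    by apply: eq_eseriesr => i _; exact: Pk.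
  rewrite -measure_bigcup//; last first.
    by move=> i j _ _ [w [/= -> ->]].
  have -> : \bigcup_i [set i] = [set: nat].
    by apply/seteqP; split => // i _; exists i.
  exact: probability_setT.
exists (~` \bigcup_k B k); split.
- exact: measurableC.
- by rewrite probability_setC// PU subee.
- by move=> w /= h [k _ Bk]; apply: h; rewrite Bk ltry.
Qed.

End poisson_void.

(** * The vague topology *)

Section trapezoid.
Context (R : realType).

Definition ramp (a delta r : R) : R :=
  Num.min 1 (Num.max 0 ((r - a) / delta)).

(** A continuous substitute, with compact support, for the indicator of []a, b]], whose integral is
    not vaguely continuous. *)
Definition trapezoid (a b delta : R) (u : Rplus R) : R :=
  ramp a delta (\val u) * (1 - ramp b delta (\val u)).

Lemma ramp_ge0 a delta r : 0 <= ramp a delta r.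
Proof. by rewrite /ramp le_min ler01 le_max lexx. Qed.

Lemma ramp_le1 a delta r : ramp a delta r <= 1.
Proof. by rewrite /ramp ge_min lexx. Qed.

Lemma ramp_eq0 a delta r : 0 < delta -> r <= a -> ramp a delta r = 0.
Proof.
move=> d0 ra; rewrite /ramp max_l ?min_r//.
by rewrite mulr_le0_ge0 ?subr_le0// invr_ge0 ltW.
Qed.

Lemma ramp_eq1 a delta r : 0 < delta -> a + delta <= r -> ramp a delta r = 1.
Proof.
move=> d0 ra; have h : 1 <= (r - a) / delta.
  by rewrite ler_pdivlMr// mul1r lerBrDl.
by rewrite /ramp max_r ?min_l// (le_trans _ h).
Qed.

Lemma continuous_ramp a delta : continuous (ramp a delta).
Proof.
move=> r.
have h1 : {for r, continuous (fun r : R => (r - a) / delta : R^o)}.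
  by apply: cvgM; [apply: cvgB; [exact: cvg_id|exact: cvg_cst]|exact: cvg_cst].
have c (x : R) : {for r, continuous (cst x : R -> R^o)} by exact: cvg_cst.
exact: (continuous_min (c 1) (continuous_max (c 0) h1)).
Qed.

Lemma continuous_trapezoid a b delta : continuous (trapezoid a b delta).
Proof.
have cr c : continuous (ramp c delta \o (\val : Rplus R -> R)).
  move=> u; apply: continuous_comp; first exact: continuous_valRp.
  exact: continuous_ramp.
move=> u.
have h0 : (cst 1 : Rplus R -> R) @ u --> (1 : R) by exact: cst_continuous.
exact: (cvgM (cr a u) (cvgB h0 (cr b u))).
Qed.

Lemma trapezoid_ge0 a b delta u : 0 <= trapezoid a b delta u.
Proof. by rewrite mulr_ge0 ?ramp_ge0// subr_ge0 ramp_le1. Qed.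

Lemma trapezoid_cc a b delta : 0 < delta ->
  compactly_supported_continuous (trapezoid a b delta).
Proof.
move=> d0; split; first exact: continuous_trapezoid.
exists [set u | \val u <= b + delta]; first exact: compact_Rplus_le.
move=> u /= /negP; rewrite -ltNge => ub.
by rewrite /trapezoid (@ramp_eq1 b)// ?subrr ?mulr0// ltW.
Qed.

Definition Ioc_ind (a b : R) (u : Rplus R) : R := (a < \val u <= b)%R%:R.

(* With b replaced by b - delta this approximates from inside, so that no mass
   beyond b is involved. *)
Lemma trapezoid_inner a b delta u : 0 < delta ->
  `|Ioc_ind a b u - trapezoid a (b - delta) delta u| <=
  Ioc_ind a (Num.min (a + delta) b) u + Ioc_ind (Num.max a (b - delta)) b u.
Proof.
move=> d0; rewrite /Ioc_ind /trapezoid; set r := \val u.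
have x0 := ramp_ge0 a delta r; have x1 := ramp_le1 a delta r.
have y0 := ramp_ge0 (b - delta) delta r; have y1 := ramp_le1 (b - delta) delta r.
have xy : 0 <= ramp a delta r * (1 - ramp (b - delta) delta r) <= 1.
  by apply/andP; split; nra.
have [ra|ra] /= := leP r a.
  by rewrite ramp_eq0// mul0r subr0 normr0 add0r gt_max ltNge ra.
have [rb|rb] := leP r b; last first.
  rewrite (@ramp_eq1 (b - delta)) ?subrr ?mulr0; last 2 first.
  - by [].
  - by rewrite subrK ltW.
  have rb' : (r <= b) = false by rewrite leNgt rb.
  by rewrite le_min rb' !andbF subrr normr0 addr0.
rewrite le_min rb andbT gt_max ra/=.
have [rad|rad] := leP r (a + delta).
  by rewrite ler_norml; case: (b - delta < r) => /=; lra.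
have [rbd|rbd] := ltP (b - delta) r; first by rewrite ler_norml /=; lra.
have h1 : ramp a delta r = 1 by apply: ramp_eq1 => //; exact: ltW.
have h0 : ramp (b - delta) delta r = 0 by exact: ramp_eq0.
by rewrite h1 h0 subr0 mulr1 subrr normr0 addr0.
Qed.

(** Both error intervals are open on the left and shrink to the empty set with [delta]. Hence the
    mass is, at every Radon measure, a pointwise limit of vaguely continuous integrals, which gives
    its measurability. *)
Lemma trapezoid_outer a b delta u : 0 < delta ->
  `|Ioc_ind a b u - trapezoid a b delta u| <=
  Ioc_ind a (a + delta) u + Ioc_ind b (b + delta) u.
Proof.
move=> d0; rewrite /Ioc_ind /trapezoid; set r := \val u.
have x0 := ramp_ge0 a delta r; have x1 := ramp_le1 a delta r.
have y0 := ramp_ge0 b delta r; have y1 := ramp_le1 b delta r.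
have xy : 0 <= ramp a delta r * (1 - ramp b delta r) <= 1.
  by apply/andP; split; nra.
have [ra|ra] /= := leP r a.
  by rewrite ramp_eq0// mul0r subr0 normr0 add0r.
have [rb|rb] /= := leP r b.
  rewrite (@ramp_eq0 b)// subr0 mulr1 addr0.
  have [rad|rad] /= := leP r (a + delta); first by rewrite ler_norml; lra.
  by rewrite ramp_eq1 ?subrr ?normr0// ltW.
have [rad|rad] /= := leP r (b + delta).
  by rewrite ler_norml; case: (r <= a + delta) => /=; lra.
by rewrite (@ramp_eq1 b)// ?subrr ?mulr0 ?subr0 ?normr0 ?addr0// ltW.
Qed.

Lemma Ioc_indE a b :
  Ioc_ind a b = \1_([set u : Rplus R | a < \val u <= b] : set (borel (Rplus R))).
Proof.
apply/funext => u; rewrite indicE /Ioc_ind; congr (nat_of_bool _)%:R.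
by apply/idP/idP; rewrite inE.
Qed.

Lemma measurable_Ioc_ind a b : measurable_fun setT (Ioc_ind a b : borel (Rplus R) -> R).
Proof.
rewrite Ioc_indE; by apply: measurable_indic; exact: measurable_Ioc.
Qed.

Lemma integrable_Ioc_ind (rho : radon R) a b :
  rho.-integrable setT (EFin \o (Ioc_ind a b : borel (Rplus R) -> R)).
Proof.
apply/integrableP; split; first by apply/measurable_EFinP; exact: measurable_Ioc_ind.
rewrite (eq_integral (EFin \o (Ioc_ind a b : borel (Rplus R) -> R))).
  rewrite Ioc_indE integral_indic//; last exact: measurable_Ioc.
  by rewrite setIT radon_Ioc_lty.
by move=> u _; rewrite /= ger0_norm// /Ioc_ind.
Qed.

Lemma Rintegral_Ioc_ind (rho : radon R) a b :
  \int[rho]_u Ioc_ind a b u = mass rho a b.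
Proof.
rewrite /Rintegral Ioc_indE integral_indic//; last exact: measurable_Ioc.
by rewrite setIT.
Qed.

Lemma mass_approx (rho : radon R) (t : Rplus R -> R) a b a1 b1 a2 b2 :
  continuous t ->
  (forall u, `|Ioc_ind a b u - t u| <= Ioc_ind a1 b1 u + Ioc_ind a2 b2 u) ->
  `|mass rho a b - \int[rho]_u t u| <= mass rho a1 b1 + mass rho a2 b2.
Proof.
move=> ct ht.
have mt := continuous_borel_real ct.
have i0 := integrable_Ioc_ind rho a b.
have i1 := integrable_Ioc_ind rho a1 b1.
have i2 := integrable_Ioc_ind rho a2 b2.
have i12 := integrableD measurableT i1 i2.
have id_ : rho.-integrable setT
    (EFin \o ((fun u => Ioc_ind a b u - t u) : borel (Rplus R) -> R)).
  apply: le_integrable i12 => //.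
    by apply/measurable_EFinP/measurable_funB => //; exact: measurable_Ioc_ind.
  move=> u _; rewrite /= lee_fin [leRHS]ger0_norm//.
  by rewrite addr_ge0// /Ioc_ind.
have it : rho.-integrable setT (EFin \o (t : borel (Rplus R) -> R)).
  have := integrableB measurableT i0 id_; apply: eq_integrable => // u _ /=.
  by rewrite -EFinB; congr EFin; ring.
rewrite -!Rintegral_Ioc_ind -RintegralB//.
apply: le_trans (le_normr_Rintegral _ id_) _ => //.
rewrite -RintegralD//; apply: le_Rintegral => //.
by have := integrable_norm id_.
Qed.

End trapezoid.

Section radon_topology.
Context (R : realType).

Lemma continuous_radon_integral (f : Rplus R -> R) :
  compactly_supported_continuous f ->
  continuous (fun rho : radon R => \int[rho]_u f u).
Proof.
move=> cf.
pose F : {f : Rplus R -> R | compactly_supported_continuous f} := exist _ f cf.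
have h : continuous (@vague_eval R : radon R -> {ptws _ -> _}).
  exact: initial_continuous.
have p := @proj_continuous
  {classic {f : Rplus R -> R | compactly_supported_continuous f}} (fun _ => R) F.
move=> rho.
exact: (@continuous_comp _ _ _ (@vague_eval R) _ rho (h rho) (p _)).
Qed.

Lemma mass_inner_approx (rho : radon R) a b delta : 0 < delta ->
  `|mass rho a b - \int[rho]_u trapezoid a (b - delta) delta u| <=
  mass rho a (Num.min (a + delta) b) + mass rho (Num.max a (b - delta)) b.
Proof.
move=> d0; apply: mass_approx; first exact: continuous_trapezoid.
by move=> u; exact: trapezoid_inner.
Qed.

Lemma cvg_mass_right (rho : radon R) a :
  (fun n => mass rho a (a + n.+1%:R^-1)) @ \oo --> (0 : R).
Proof.
pose F n := [set u : borel (Rplus R) | a < \val u <= a + n.+1%:R^-1].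
have mF n : measurable (F n) by exact: measurable_Ioc.
have F0 : \bigcap_n F n = set0.
  apply/seteqP; split => u //= Fu.
  have := Fu 0%N Logic.I; rewrite /F/= => /andP[au _].
  pose k := Num.trunc (\val u - a)^-1.
  have := Fu k Logic.I; rewrite /F/= => /andP[_]; rewrite leNgt => /negP; apply.
  rewrite -ltrBrDl invf_plt ?posrE ?ltr0n ?subr_gt0//.
  exact: truncnS_gt.
have : (rho \o F) @ \oo --> rho (\bigcap_n F n).
  apply: nonincreasing_cvg_mu => //.
  - exact: radon_Ioc_lty.
  - by rewrite F0.
  move=> m n mn; apply/subsetPset => u /= /andP[h1 h2]; apply/andP; split => //.
  by rewrite (le_trans h2)// lerD2l lef_pV2 ?posrE ?ltr0n// ler_nat ltnS.
rewrite F0 measure0 => h.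
have : (fun n => (mass rho a (a + n.+1%:R^-1))%:E) @ \oo --> 0%:E.
  by under eq_fun do rewrite massE.
by move/fine_cvg.
Qed.

Lemma measurable_mass (a b : R) :
  measurable_fun setT ((fun rho => mass rho a b) : borel (radon R) -> R).
Proof.
pose h n (rho : borel (radon R)) : R :=
  \int[rho : radon R]_u trapezoid a b n.+1%:R^-1 u.
apply: (@measurable_fun_cvg _ _ _ _ h).
  move=> n; apply: continuous_borel_real; apply: continuous_radon_integral.
  by apply: trapezoid_cc; rewrite invr_gt0 ltr0n.
move=> rho _; apply/cvgrPdist_le => e e0.
have : (fun n => mass rho a (a + n.+1%:R^-1) + mass rho b (b + n.+1%:R^-1))
    @ \oo --> (0 + 0 : R).
  by apply: cvgD; exact: cvg_mass_right.
rewrite addr0 => /cvgrPdist_le/(_ _ e0); apply: filterS => n /=.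
rewrite sub0r normrN => hn.
apply: le_trans (mass_approx _ _ _) _; last first.
- apply: le_trans hn; exact: ler_norm.
- by move=> u; apply: trapezoid_outer; rewrite invr_gt0 ltr0n.
- exact: continuous_trapezoid.
Qed.

End radon_topology.

(** * A countable base of the state space *)

Lemma weighted_sum_le (R : realType) (a : nat -> R) (k : nat) (eta : R) (m : nat) :
  0 <= eta -> (forall n, 0 <= a n <= 1) -> (forall n, (n < k)%N -> a n <= eta) ->
  \sum_(0 <= n < m) 2 ^- n.+1 * a n <= eta * (1 - 2 ^- m) +
    (if (m <= k)%N then 0 else 2 ^- k - 2 ^- m).
Proof.
move=> eta0 a01 ak.
(* The closed form makes the induction work: the first [m] weights sum to [1 - 2 ^- m], those among
   them of index at least [k] to [2 ^- k - 2 ^- m]. *)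
elim: m => [|m IH].
  by rewrite big_nil leq0n expr0 invr1 subrr mulr0 addr0.
rewrite big_nat_recr//=.
have e2 : 2 ^- m = 2 * 2 ^- m.+1 :> R.
  by rewrite exprS invfM mulrA divff ?mul1r// pnatr_eq0.
have p0 : 0 < 2 ^- m.+1 :> R by rewrite invr_gt0 exprn_gt0// ltr0n.
have /andP[am0 am1] := a01 m.
move: IH; rewrite e2; have [mk|mk|mk] := ltngtP m k.
- by have := ak m mk; nra.
- nra.
- rewrite -mk e2; nra.
Qed.

Lemma weighted_series_le (R : realType) (a : nat -> R) (k : nat) (eta : R) :
  0 <= eta -> (forall n, 0 <= a n <= 1) -> (forall n, (n < k)%N -> a n <= eta) ->
  (\sum_(n <oo) (2 ^- n.+1 * a n)%:E <= (eta + 2 ^- k)%:E)%E.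
Proof.
move=> eta0 a01 ak.
have p0 n : 0 < 2 ^- n :> R by rewrite invr_gt0 exprn_gt0// ltr0n.
apply: lime_le.
  apply: is_cvg_nneseries => n _ _; have /andP[? _] := a01 n.
  by rewrite lee_fin mulr_ge0// ltW.
apply: nearW => m; rewrite sumEFin lee_fin.
apply: le_trans (weighted_sum_le m eta0 a01 ak) _.
have := p0 m; have := p0 k; case: ifP => _; nra.
Qed.

Lemma half_expn_lt (R : realType) (eps : R) : 0 < eps -> exists k, 2 ^- k < eps.
Proof.
move=> e0.
have : geometric 1 (2^-1 : R) @ \oo --> (0 : R).
  by apply: cvg_geometric; rewrite ger0_norm ?invf_lt1 ?ltr1n// invr_ge0.
move=> /cvgrPdist_lt/(_ _ e0)[k _ /(_ k (leqnn k))] /=.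
rewrite sub0r normrN mul1r exprVn ger0_norm; first by exists k.
by rewrite invr_ge0 exprn_ge0.
Qed.

Section countable_base.
Context (R : realType) (e : nat -> Rplus R -> R).
Hypothesis e_cc : forall n, compactly_supported_continuous (e n).
Hypothesis e_metric : metrizes (state_dist e).

(** Rational bounds on finitely many integrals: there are countably many such sets, enumerable by
    [pickle]. *)
Definition radon_box (s : seq (rat * rat)) : set (radon R) :=
  [set q : radon R | forall j, (j < size s)%N ->
     ratr (nth (0, 0) s j).1 < \int[q]_u e j u < ratr (nth (0, 0) s j).2].

Definition box (i : seq (rat * rat) * (rat * rat)) : set (radon R * Ico01 R) :=
  [set p | radon_box i.1 p.1 /\ ratr i.2.1 < \val p.2 < ratr i.2.2].

Lemma measurable_radon_box s : measurable (radon_box s : set (borel (radon R))).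
Proof.
have -> : radon_box s = \bigcap_(j in `I_(size s))
    ((fun q : radon R => \int[q]_u e j u) @^-1`
      `]ratr (nth (0, 0) s j).1, ratr (nth (0, 0) s j).2[%classic).
  apply/seteqP; split => q /= h j /= js; have := h j js; rewrite /= in_itv//.
apply: bigcap_measurableType => j _; rewrite -[X in measurable X]setTI.
by apply: (continuous_borel_real (continuous_radon_integral (e_cc j))).
Qed.

(** Up to the tail [2 ^- k] of its weights, the metric depends on the position and [k] integrals
    only. Position, integrals and tail each get [eps / 4]. *)
Lemma box_base (U : set (radon R * Ico01 R)) p : open U -> U p ->
  exists i, box i p /\ box i `<=` U.
Proof.
move=> oU Up.
have [_ _ _ _ nb] := e_metric.
have /nb[eps eps0 epsU] : nbhs p U by exact: open_nbhs_nbhs.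
have eps4 : 0 < eps / 4 by lra.
have [k k_eps] := half_expn_lt eps4.
have ra (r : R) : exists ab : rat * rat, [/\ ratr ab.1 < r, r < ratr ab.2 &
    ratr ab.2 - ratr ab.1 < eps / 4 :> R].
  have ltB : r - eps / 8 < r by lra.
  have ltD : r < r + eps / 8 by lra.
  have [a] := rat_in_itvoo ltB; rewrite in_itv/= => /andP[a1 a2].
  have [b] := rat_in_itvoo ltD; rewrite in_itv/= => /andP[b1 b2].
  by exists (a, b); split => //=; lra.
pose ab (r : R) : rat * rat := sval (cid (ra r)).
pose s := [seq ab (\int[p.1]_u e j u) | j <- iota 0 k].
have ss : size s = k by rewrite size_map size_iota.
exists (s, ab (\val p.2)); split.
  split => /=.
    move=> j; rewrite ss => jk.
    rewrite (nth_map 0%N) ?size_iota// nth_iota// add0n.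
    by rewrite /ab; case: cid => /= x [-> ->].
  by rewrite /ab; case: cid => /= x [-> ->].
move=> q [/= q1 q2]; apply: epsU => /=; rewrite /state_dist.
pose a n := Num.min 1 `|\int[p.1]_u e n u - \int[q.1]_u e n u|.
have hs : (\sum_(n <oo) (2 ^- n.+1 * a n)%:E <= (eps / 4 + 2 ^- k)%:E)%E.
  apply: weighted_series_le.
  - exact: ltW.
  - by move=> n; rewrite /a le_min ler01 normr_ge0 ge_min lexx.
  - move=> n nk; rewrite /a ge_min; apply/orP; right.
    have := q1 n; rewrite ss (nth_map 0%N) ?size_iota// nth_iota// add0n => /(_ nk).
    rewrite /ab; case: cid => /= x [x1 x2 x3] /andP[y1 y2].
    rewrite ler_norml; lra.
have h2 : `|\val p.2 - \val q.2| <= eps / 4.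
  move: q2; rewrite /ab; case: cid => /= x [x1 x2 x3] /andP[y1 y2].
  rewrite ler_norml; lra.
apply: (@le_lt_trans _ _ ((eps / 4)%:E + (eps / 4 + 2 ^- k)%:E)%E).
  by apply: leeD; rewrite ?lee_fin.
by rewrite -EFinD lte_fin; lra.
Qed.

Lemma open_box_bigcup (U : set (radon R * Ico01 R)) : open U ->
  U = \bigcup_(i in [set i | box i `<=` U]) box i.
Proof.
move=> oU; apply/seteqP; split => [p Up|p [i iU]]; last exact: iU.
by have [i [ip iU]] := box_base oU Up; exists i.
Qed.

(** Every open set of states is a countable union of boxes, so the Borel sets of the product are
    generated by the integrals of the [e j] and the position. *)
Lemma measurable_into_states d (X : measurableType d) (g : X -> radon R * Ico01 R) :
  (forall j, measurable_fun setT (fun x => \int[(g x).1]_u e j u)) ->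
  measurable_fun setT (fun x => \val (g x).2) ->
  measurable_fun setT (g : X -> borel (radon R * Ico01 R)%type).
Proof.
move=> m1 m2; apply: measurability; first by [].
move=> _ [U oU <-]; rewrite setTI (open_box_bigcup oU) preimage_bigcup.
rewrite bigcup_mkcond; apply: countable_bigcupT_measurable => //.
move=> i; case: ifPn => // _.
have -> : g @^-1` box i = (\bigcap_(j in `I_(size i.1))
   ((fun x => \int[(g x).1]_u e j u) @^-1`
     `]ratr (nth (0, 0) i.1 j).1, ratr (nth (0, 0) i.1 j).2[%classic)) `&`
   ((fun x => \val (g x).2) @^-1` `]ratr i.2.1, ratr i.2.2[%classic).
  apply/seteqP; split => x /=.
    move=> [h1 h2]; split; last by rewrite /= in_itv.
    by move=> j /= js; rewrite /= in_itv; exact: h1.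
  move=> [h1 h2]; split; last by move: h2; rewrite /= in_itv.
  by move=> j js; have := h1 j js; rewrite /= in_itv.
apply: measurableI.
  apply: bigcap_measurableType => j _; rewrite -[X in measurable X]setTI.
  exact: m1.
by rewrite -[X in measurable X]setTI; exact: m2.
Qed.

End countable_base.

(** * Integration against slices and empirical measures *)

Lemma ge0_integral_mrestr d (T : measurableType d) (R : realType)
    (m : {measure set T -> \bar R}) (D : set T) (mD : measurable D)
    (f : T -> \bar R) :
  measurable_fun setT f -> (forall x, (0 <= f x)%E) ->
  (\int[mrestr m mD]_x f x = \int[m]_(x in D) f x)%E.
Proof.
move=> mf f0.
rewrite -(setvU D) ge0_integral_setU//=; last 3 first.
- exact: measurableC.
- exact: measurable_funTS.
- by rewrite disj_set2E setICl.
rewrite [X in (X + _)%E](_ : _ = 0%E).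
  rewrite add0e; apply: eq_measure_integral => A mA AD.
  by change (m (A `&` D) = m A); rewrite setIidl.
rewrite -(@integral_measure_zero _ _ R (~` D) f).
apply: eq_measure_integral => A mA AD.
change (m (A `&` D) = 0%E); rewrite (_ : A `&` D = set0) ?measure0//.
by apply/seteqP; split => x // [/AD].
Qed.

Section slices.
Context (R : realType) (m : {measure set (borel (radon R * Ico01 R)%type) -> \bar R}).

Lemma measurable_state_fst :
  measurable_fun setT
    (fst : borel (radon R * Ico01 R)%type -> borel (radon R)).
Proof. by apply: continuous_borel => p; exact: cvg_fst. Qed.

Lemma measurable_state_pos :
  measurable_fun setT
    ((fun p => \val p.2) : borel (radon R * Ico01 R)%type -> R).
Proof.
apply: continuous_borel_real => p.
have h : continuous (snd : radon R * Ico01 R -> Ico01 R) by move=> q; exact: cvg_snd.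
exact: (@continuous_comp _ _ _ snd (\val : Ico01 R -> R) p (h p) (@continuous_valIco R _)).
Qed.

Lemma measurable_pos_ge y :
  measurable ([set p | y <= \val p.2] : set (borel (radon R * Ico01 R)%type)).
Proof.
have := measurable_state_pos measurableT (measurable_itv `[y, +oo[).
rewrite setTI; congr measurable.
by apply/seteqP; split => p /=; rewrite in_itv/= andbT.
Qed.

Lemma slice_integral y (A : set (borel (radon R))) (g : borel (radon R) -> \bar R) :
  measurable A -> measurable_fun setT g -> (forall q, (0 <= g q)%E) ->
  (\int[slice m y]_(q in A) g q =
   \int[m]_(p in [set p | A p.1 /\ (y <= \val p.2)%R]) g p.1)%E.
Proof.
move=> mA mg g0.
(* A slice is the image, under the first projection, of the restriction of [m] to the positions at
   least [y]. *)
have -> : slice m y = pushforward (mrestr m (measurable_pos_ge y))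
    (fst : borel (radon R * Ico01 R)%type -> borel (radon R)).
  apply/funext => B; rewrite /slice /pushforward /mrestr; congr (m _).
rewrite ge0_integral_pushforward//; last 2 first.
- exact: measurable_state_fst.
- exact: measurable_funTS.
rewrite integral_mkcond ge0_integral_mrestr//; last 2 first.
- apply/(measurable_restrictT _ _).1.
    by rewrite -[X in measurable X]setTI; exact: measurable_state_fst.
  apply: measurable_funTS; apply: measurableT_comp => //.
  exact: measurable_state_fst.
- by move=> p; apply: erestrict_ge0 => q _; exact: g0.
rewrite integral_mkcond [in RHS]integral_mkcond; apply: eq_integral => p _.
rewrite /patch /=; case: ifPn => [|h1].
  rewrite inE /= => yp; case: ifPn => [|h2].
    by rewrite inE/= => Ap; rewrite mem_set.
  rewrite memNset// => -[Ap _]; by move: h2; rewrite notin_setE/=; apply.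
by rewrite memNset// => -[_ yp]; move: h1; rewrite notin_setE/=; apply.
Qed.

End slices.

Section empirical_integral.
Context (R : realType) (T : ptopologicalType) (N : nat) (z : 'I_N -> T).

(** [msum] adds up a sequence of measures, so the family over ['I_N] is continued by the zero
    measure. *)
Let m_ (k : nat) : {measure set (borel T) -> \bar R} :=
  if insub k is Some i then \d_(z i : borel T) else mzero.

Let invN_ge0 : 0 <= N%:R^-1 :> R.
Proof. by rewrite invr_ge0. Qed.

Let me : {measure set (borel T) -> \bar R} := mscale (NngNum invN_ge0) (msum m_ N).

Let empiricalE : empirical z = me.
Proof.
apply/funext => A; rewrite /empirical /me /mscale /msum/=; congr (_ * _)%E.
by apply: eq_bigr => i _; rewrite /m_ valK.
Qed.

Let ge0_empirical_integral (f : borel T -> \bar R) : measurable_fun setT f ->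
  (forall x, (0 <= f x)%E) ->
  (\int[me]_x f x = N%:R^-1%:E * \sum_(i < N) f (z i))%E.
Proof.
move=> mf f0; rewrite ge0_integral_mscale//; congr (_ * _)%E.
rewrite ge0_integral_measure_sum//; apply: eq_bigr => i _.
by rewrite /m_ valK integral_dirac// diracT mul1e.
Qed.

Lemma empirical_integral (f : T -> R) :
  measurable_fun setT (f : borel T -> R) ->
  (\int[empirical z]_x (f x)%:E = (N%:R^-1 * \sum_(i < N) f (z i))%:E)%E.
Proof.
move=> mf; rewrite empiricalE integralE !ge0_empirical_integral//; last 2 first.
- by apply: measurable_funeneg; exact/measurable_EFinP.
- by apply: measurable_funepos; exact/measurable_EFinP.
pose g1 x := Num.max (f x) 0; pose g2 x := Num.max (- f x) 0.
have -> : (fun x => (f x)%:E)^\+%E = (fun x => (g1 x)%:E).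
  by apply/funext => x; rewrite funepos.unlock/= -EFin_max.
have -> : (fun x => (f x)%:E)^\-%E = (fun x => (g2 x)%:E).
  by apply/funext => x; rewrite funeneg.unlock/= -EFin_max.
rewrite !sumEFin -!EFinM -EFinB -mulrBr -sumrB.
congr (_ * _)%:E; apply: eq_bigr => i _; rewrite /g1 /g2.
by case: (leP (f (z i)) 0); case: (leP (- f (z i)) 0) => ? ?; lra.
Qed.


End empirical_integral.

(** * Survival averages *)

Lemma count_nat_between (R : realType) (N : nat) (a b : R) : a <= b ->
  \sum_(k < N) ((a <= k%:R < b)%R%:R : R) <= b - a + 1.
Proof.
move=> ab.
(* Cutting the interval at [N] makes the bound inductive; the maximum with 0 covers the stages at
   which nothing has been counted yet. *)
suff : \sum_(k < N) ((a <= k%:R < b)%R%:R : R) <=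
    Num.max 0 (Num.min N%:R (b + 1) - a).
  move=> h; apply: le_trans h _; rewrite ge_max; apply/andP; split; first lra.
  by rewrite lerBlDr addrAC subrK ge_min lexx orbT.
elim: N => [|N IH]; first by rewrite big_ord0 le_max lexx.
rewrite big_ord_recr/=.
have [/andP[aN Nb]|_] := boolP (a <= N%:R < b)%R.
  apply: (@le_trans _ _ (N%:R - a + 1)); last first.
    rewrite le_max; apply/orP; right; rewrite -natr1 min_l; lra.
  rewrite lerD2r; apply: le_trans IH _.
  by rewrite min_l ?max_r//; lra.
rewrite addr0; apply: le_trans IH _; rewrite ge_max; apply/andP; split.
  by rewrite le_max lexx.
rewrite le_max; apply/orP; right; rewrite lerD2r.
rewrite le_min; apply/andP; split; last by rewrite ge_min lexx orbT.
by rewrite ge_min ler_nat leqnSn.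
Qed.

Lemma count_perm_between (R : realType) (N : nat) (x : {perm 'I_N}) (a b : R) :
  a <= b -> \sum_(i < N) ((a <= (x i)%:R < b)%R%:R : R) <= b - a + 1.
Proof.
move=> ab; apply: le_trans (count_nat_between N ab).
by rewrite [leRHS](reindex_inj (@perm_inj _ x)).
Qed.

Lemma val_initial_position (R : realType) (N : nat) (x : {perm 'I_N}) (i : 'I_N) :
  \val (initial_position x i : Ico01 R) = (x i)%:R / N%:R.
Proof.
rewrite /initial_position insubdK// inE/= in_itv/= divr_ge0//=.
have N0 : (0 < N)%N by exact: leq_ltn_trans (ltn_ord i).
by rewrite ltr_pdivrMr ?ltr0n// mul1r ltr_nat.
Qed.

Lemma uniformly_equicontinuousP (R : realType) (T : R) (F : set (R -> R)) :
  uniformly_equicontinuous T F -> forall eps, 0 < eps ->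
  exists2 delta, 0 < delta & forall r s t, F r -> 0 <= s <= T -> 0 <= t <= T ->
    `|s - t| <= delta -> `|r s - r t| <= eps.
Proof.
move=> /fine_cvgP[fin_mod cmod] eps eps0.
have := cmod => /cvgrPdist_le/(_ _ eps0).
move=> near_eps; near (0 : R)^'+ => delta.
exists delta; first by near: delta; exact: nbhs_right_gt.
move=> r s t Fr s01 t01 st; rewrite -lee_fin.
have h1 : modulus T F delta \is a fin_num by near: delta.
have h2 : `|0 - fine (modulus T F delta)| <= eps by near: delta.
apply: (@le_trans _ _ (modulus T F delta)).
  by apply: ereal_sup_ubound => /=; exists r, s, t.
rewrite -(fineK h1) lee_fin (le_trans _ h2)// sub0r normrN; exact: ler_norm.
Unshelve. all: by end_near.
Qed.

Lemma expR_lipschitz (R : realType) (s t : R) : 0 <= s -> 0 <= t ->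
  `|expR (- s) - expR (- t)| <= `|s - t|.
Proof.
wlog st : s t / s <= t.
  move=> h s0 t0; have [st|/ltW ts] := leP s t; first exact: h.
  by rewrite distrC (distrC s); exact: h.
move=> s0 t0; rewrite ger0_norm ?subr_ge0 ?ler_expR ?lerN2//.
rewrite ler0_norm ?subr_le0// opprB.
have e1 : expR (- s) <= 1 by rewrite -expR0 ler_expR oppr_le0.
have e0 := expR_gt0 (- s).
have -> : - t = - s + (s - t) by ring.
rewrite expRD.
have : 1 + (s - t) <= expR (s - t) by exact: expR_ge1Dx.
nra.
Qed.

Section expected_limit.
Context (R : realType) (T : R).

(** The form in which equicontinuity is used, both to smooth the indicator of an interval and to
    move its end points; all intervals stay within [[0, T]]. *)
Definition small_mass (delta eps : R) (q : radon R) : Prop :=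
  forall a b, 0 <= a -> b <= T -> b - a <= delta -> mass q a b <= eps.

Lemma equicontinuous_small_mass (Q : set (radon R)) :
  uniformly_equicontinuous T [set r | exists2 q, Q q & r = (fun t => mass q 0 t)] ->
  forall eps, 0 < eps ->
  exists2 delta, 0 < delta & forall q, Q q -> small_mass delta eps q.
Proof.
move=> /uniformly_equicontinuousP h eps eps0; have [delta d0 hd] := h _ eps0.
exists delta => // q Qq a b a0 bT ab.
have [ba|/ltW ba] := leP b a; first by rewrite mass0// ltW.
have := hd (fun t => mass q 0 t) b a (ex_intro2 _ _ q Qq erefl).
rewrite (massD q a0 ba) addrAC subrr add0r (ger0_norm (mass_ge0 q a b)); apply.
- by rewrite bT andbT (le_trans a0).
- by rewrite a0/= (le_trans ba).
- by rewrite ger0_norm ?subr_ge0.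
Qed.

(* H_(y0,a,b)(rho,y) = 1_{y >= y0} exp(-rho((a,b])): every quantity of the limit
   is an integral of such a function against mu0. *)
Definition survival (y0 a b : R) (p : radon R * Ico01 R) : R :=
  (y0 <= \val p.2)%R%:R * expR (- mass p.1 a b).

(** The continuous function to which weak convergence applies. Its ramp lies to the left of [y0], so
    that the error set [[y0 - delta, y0[] decreases to the empty set even if [mu0] charges the
    position [y0]. *)
Definition smooth_survival (delta y0 a b : R) (p : radon R * Ico01 R) : R :=
  ramp (y0 - delta) delta (\val p.2) *
  expR (- \int[p.1]_u trapezoid a (b - delta) delta u).

Lemma survival_ge0 y0 a b p : 0 <= survival y0 a b p.
Proof. by rewrite mulr_ge0// expR_ge0. Qed.

Lemma survival_le1 y0 a b p : survival y0 a b p <= 1.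
Proof.
have h : expR (- mass p.1 a b) <= 1 by rewrite -expR0 ler_expR oppr_le0 mass_ge0.
rewrite /survival; case: (y0 <= _) => /=; rewrite ?mul1r// mul0r; exact: ler01.
Qed.

Lemma measurable_survival y0 a b :
  measurable_fun setT (survival y0 a b : borel (radon R * Ico01 R)%type -> R).
Proof.
apply: measurable_funM.
  have -> : (fun p : borel (radon R * Ico01 R)%type => (y0 <= \val p.2)%R%:R : R) =
      \1_([set p | y0 <= \val p.2] : set (borel (radon R * Ico01 R)%type)).
    apply/funext => p; rewrite indicE; congr (nat_of_bool _)%:R.
    by apply/idP/idP; rewrite inE.
  by apply: measurable_indic; exact: measurable_pos_ge.
apply: measurableT_comp => //; apply: measurableT_comp => //.
apply: (@measurableT_comp _ _ _ _ _ _ ((fun q : radon R => mass q a b) : borel (radon R) -> R)).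
  exact: measurable_mass.
exact: measurable_state_fst.
Qed.

Lemma smooth_survival_ge0 delta y0 a b p : 0 <= smooth_survival delta y0 a b p.
Proof. by rewrite mulr_ge0// ?expR_ge0// ramp_ge0. Qed.

Lemma smooth_survival_le1 delta y0 a b p : smooth_survival delta y0 a b p <= 1.
Proof.
apply: mulr_ile1; rewrite ?ramp_ge0 ?ramp_le1 ?expR_ge0//.
rewrite -expR0 ler_expR oppr_le0; apply: Rintegral_ge0 => u _.
exact: trapezoid_ge0.
Qed.

Lemma continuous_smooth_survival delta y0 a b : 0 < delta ->
  continuous (smooth_survival delta y0 a b).
Proof.
move=> d0 p.
have h1 : continuous (fun p : radon R * Ico01 R => \val p.2).
  move=> q; have h : continuous (snd : radon R * Ico01 R -> Ico01 R).
    by move=> r; exact: cvg_snd.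
  exact: (@continuous_comp _ _ _ snd (\val : Ico01 R -> R) q (h q) (@continuous_valIco R _)).
have h2 : continuous (fun p : radon R * Ico01 R =>
    \int[p.1]_u trapezoid a (b - delta) delta u).
  move=> q; have h : continuous (fst : radon R * Ico01 R -> radon R).
    by move=> r; exact: cvg_fst.
  apply: (@continuous_comp _ _ _ fst
    (fun q : radon R => \int[q]_u trapezoid a (b - delta) delta u) q (h q)).
  by apply: continuous_radon_integral; exact: trapezoid_cc.
have h3 := @continuous_comp _ _ _ _ (ramp (y0 - delta) delta) p (h1 p)
  (@continuous_ramp _ _ _ _).
have h4 := @continuous_comp _ _ _ _ (@expR R \o -%R) p (h2 p).
apply: cvgM; first exact: h3.
apply: h4; apply: continuous_comp; first exact: opp_continuous.
exact: continuous_expR.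
Qed.

Lemma survival_smooth_dist delta eps y0 a b p : 0 < delta -> 0 <= eps ->
  0 <= a -> b <= T -> small_mass delta eps p.1 ->
  `|survival y0 a b p - smooth_survival delta y0 a b p| <=
  (y0 - delta <= \val p.2 < y0)%R%:R + 2 * eps.
Proof.
move=> d0 e0 a0 bT sm.
set z := \val p.2; pose I := \int[p.1]_u trapezoid a (b - delta) delta u.
have I0 : 0 <= I by apply: Rintegral_ge0 => u _; exact: trapezoid_ge0.
have hI : `|expR (- mass p.1 a b) - expR (- I)| <= 2 * eps.
  apply: le_trans (expR_lipschitz (mass_ge0 _ _ _) I0) _.
  apply: le_trans (mass_inner_approx _ _ _ d0) _.
  have h1 : mass p.1 a (Num.min (a + delta) b) <= eps.
    apply: sm => //; first by rewrite ge_min bT orbT.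
    by rewrite lerBlDl ge_min lexx.
  have h2 : mass p.1 (Num.max a (b - delta)) b <= eps.
    apply: sm => //; first by rewrite le_max a0.
    by rewrite lerBlDl -lerBlDr le_max lexx orbT.
  lra.
have x01 : 0 <= expR (- mass p.1 a b) <= 1.
  by rewrite expR_ge0 -expR0 ler_expR oppr_le0 mass_ge0.
have y01 : 0 <= expR (- I) <= 1.
  by rewrite expR_ge0 -expR0 ler_expR oppr_le0.
have r0 := ramp_ge0 (y0 - delta) delta z.
have r1 := ramp_le1 (y0 - delta) delta z.
rewrite /survival /smooth_survival -/z -/I.
move: x01 y01 hI; set x := expR _; set y := expR (- I) => /andP[x0 x1] /andP[y0' y1].
rewrite ler_norml => /andP[h1 h2].
have [yz|yz] /= := leP y0 z.
  have -> : ramp (y0 - delta) delta z = 1 by apply: ramp_eq1 => //; rewrite subrK.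
  by rewrite andbF !mul1r add0r ler_norml; lra.
rewrite andbT; have [dz|dz] /= := leP (y0 - delta) z.
  have ry0 : 0 <= ramp (y0 - delta) delta z * y by exact: mulr_ge0.
  have ry1 : ramp (y0 - delta) delta z * y <= 1 by exact: mulr_ile1.
  by rewrite mul0r sub0r normrN ger0_norm//; lra.
have h0 : ramp (y0 - delta) delta z = 0 by apply: ramp_eq0 => //; exact: ltW.
by rewrite h0 !mul0r subrr normr0 add0r mulr_ge0.
Qed.

End expected_limit.

Lemma bounded_integrable d (X : measurableType d) (R : realType)
    (P : probability X R) (f : X -> R) (M : R) :
  measurable_fun setT f -> (forall x, `|f x| <= M) ->
  P.-integrable setT (EFin \o f).
Proof.
move=> mf fM.
apply: (@le_integrable _ _ _ P _ _ _ (EFin \o cst M)) => //.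
- exact/measurable_EFinP.
- by move=> x _ /=; rewrite lee_fin (le_trans (fM x))// ler_norm.
- exact: finite_measure_integrable_cst.
Qed.

Lemma Rintegral_indicator d (X : measurableType d) (R : realType)
    (P : probability X R) (A : set X) : measurable A ->
  \int[P]_x (\1_A x : R) = fine (P A).
Proof. by move=> mA; rewrite /Rintegral integral_indic// setIT. Qed.

Lemma cvg_pos_left (R : realType)
    (mu0 : probability (borel (radon R * Ico01 R)%type) R) (y0 : R) :
  (fun n => mu0 [set p | y0 - n.+1%:R^-1 <= \val p.2 < y0]%R) @ \oo --> 0%E.
Proof.
pose B n : set (borel (radon R * Ico01 R)%type) :=
  [set p | y0 - n.+1%:R^-1 <= \val p.2 < y0].
have mB n : measurable (B n).
  have := @measurable_state_pos R measurableT _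
    (measurable_itv `[y0 - n.+1%:R^-1, y0[).
  by rewrite setTI; congr measurable; apply/seteqP; split => p /=; rewrite in_itv.
have B0 : \bigcap_n B n = set0.
  apply/seteqP; split => p //= Bp.
  have /andP[_ py] := Bp 0%N Logic.I.
  have /andP[h _] := Bp (Num.trunc (y0 - \val p.2)^-1) Logic.I.
  move: h; rewrite leNgt => /negP; apply.
  rewrite ltrBrDr addrC -ltrBrDr invf_plt ?posrE ?ltr0n ?subr_gt0//.
  exact: truncnS_gt.
rewrite -(measure0 mu0) -B0; apply: (@nonincreasing_cvg_mu _ _ _ mu0 B) => //.
- by rewrite (le_lt_trans (probability_le1 mu0 (mB 0%N)))// ltry.
- by rewrite B0.
move=> m n mn; apply/subsetPset => p /andP[h1 h2]; apply/andP; split => //.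
by rewrite (le_trans _ h1)// lerD2l lerN2 lef_pV2 ?posrE ?ltr0n// ler_nat ltnS.
Qed.

Section expected_cvg.
Context (R : realType) (T : R).
Variables (rho : forall N : nat, 'I_N -> radon R) (x : forall N : nat, {perm 'I_N}).
Arguments rho : clear implicits.
Arguments x : clear implicits.
Variable mu0 : probability (borel (radon R * Ico01 R)%type) R.
Hypothesis weak : weak_cvg
  (fun N => empirical (fun i => (rho N i, initial_position (x N) i))) mu0.
Hypothesis smallI : forall eps, 0 < eps -> exists2 delta, 0 < delta &
  forall N (i : 'I_N), small_mass T delta eps (rho N i).
Hypothesis smallJ : forall eps, 0 < eps -> exists2 delta, 0 < delta &
  {ae mu0, forall p, small_mass T delta eps p.1}.

Variables (h : radon R -> R) (M : R).
Hypothesis ch : continuous h.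
Hypothesis h0M : forall q, 0 <= h q <= M.

Definition expected_survival N y0 a b : R :=
  N%:R^-1 * \sum_(i < N) h (rho N i) *
    survival y0 a b (rho N i, initial_position (x N) i).

Definition limit_survival y0 a b : R :=
  \int[mu0]_p (h p.1 * survival y0 a b p).

Let M0 : 0 <= M.
Proof. by have /andP[] := h0M (radon0 R); exact: le_trans. Qed.

Let mh : measurable_fun setT
  ((fun p => h p.1) : borel (radon R * Ico01 R)%type -> R).
Proof.
apply: (@measurableT_comp _ _ _ _ _ _ (h : borel (radon R) -> R)).
  exact: continuous_borel_real.
exact: measurable_state_fst.
Qed.

Let small_massS delta delta' eps q : delta' <= delta ->
  small_mass T delta eps q -> small_mass T delta' eps q.
Proof. by move=> dd sm a b a0 bT ab; apply: sm => //; exact: le_trans dd. Qed.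

Lemma measurable_h_survival y0 a b : measurable_fun setT
  ((fun p => h p.1 * survival y0 a b p) : borel (radon R * Ico01 R)%type -> R).
Proof. by apply: measurable_funM => //; exact: measurable_survival. Qed.

Lemma h_survival_le y0 a b p : `|h p.1 * survival y0 a b p| <= M.
Proof.
have /andP[h0 hM] := h0M p.1; have s0 := survival_ge0 y0 a b p.
have s1 := survival_le1 y0 a b p.
by rewrite ger0_norm; [rewrite -[leRHS]mulr1; exact: ler_pM|exact: mulr_ge0].
Qed.

(** The initial ranks form a permutation, so at most [delta * N%:R + 1] of them lie under the ramp,
    whatever the permutation. *)
Let empirical_dist delta eps N y0 a b : 0 < delta -> 0 <= eps -> (0 < N)%N ->
  (forall i : 'I_N, small_mass T delta eps (rho N i)) -> 0 <= a -> b <= T ->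
  `|expected_survival N y0 a b - N%:R^-1 * \sum_(i < N) h (rho N i) *
    smooth_survival delta y0 a b (rho N i, initial_position (x N) i)| <=
  M * (delta + N%:R^-1 + 2 * eps).
Proof.
move=> d0 e0 N0 sm a0 bT.
have N0' : 0 < N%:R :> R by rewrite ltr0n.
rewrite /expected_survival -mulrBr -sumrB normrM ger0_norm ?invr_ge0//.
rewrite ler_pdivrMl//.
apply: le_trans (ler_norm_sum _ _ _) _.
apply: (@le_trans _ _ (\sum_(i < N)
   M * (((y0 - delta) * N%:R <= (x N i)%:R < y0 * N%:R)%R%:R + 2 * eps))).
  apply: ler_sum => i _; rewrite -mulrBr normrM.
  have /andP[h0 hM] := h0M (rho N i).
  rewrite (ger0_norm h0); apply: ler_pM => //.
  apply: le_trans (@survival_smooth_dist _ T _ _ y0 a b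
    (rho N i, initial_position (x N) i) d0 e0 a0 bT (sm i)) _.
  by rewrite /= val_initial_position ler_pdivlMr// ltr_pdivrMr.
rewrite -mulr_sumr big_split/= sumr_const card_ord.
have := @count_perm_between R N (x N) ((y0 - delta) * N%:R) (y0 * N%:R).
have -> : (y0 - delta) * N%:R <= y0 * N%:R by rewrite ler_pM2r//; lra.
move=> /(_ isT) hc.
rewrite [leRHS](_ : _ = M * (delta * N%:R + 1 + (2 * eps) *+ N)); last first.
  rewrite -[(2 * eps) *+ N]mulr_natl; field; lra.
rewrite ler_wpM2l// lerD2r; lra.
Qed.

Let limit_dist delta eps y0 a b : 0 < delta -> 0 <= eps ->
  {ae mu0, forall p, small_mass T delta eps p.1} -> 0 <= a -> b <= T ->
  `|limit_survival y0 a b - \int[mu0]_p (h p.1 * smooth_survival delta y0 a b p)| <=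
  M * (fine (mu0 [set p | y0 - delta <= \val p.2 < y0]) + 2 * eps).
Proof.
move=> d0 e0 [Z [mZ Z0 bad]] a0 bT.
pose B : set (borel (radon R * Ico01 R)%type) :=
  [set p | y0 - delta <= \val p.2 < y0].
have mB : measurable B.
  have := @measurable_state_pos R measurableT _
    (measurable_itv `[y0 - delta, y0[).
  by rewrite setTI; congr measurable; apply/seteqP; split => p /=; rewrite in_itv.
have ms : measurable_fun setT (smooth_survival delta y0 a b : borel (radon R * Ico01 R)%type -> R).
  by apply: continuous_borel_real; exact: continuous_smooth_survival.
have i1 := @bounded_integrable _ _ _ mu0 _ _ (measurable_h_survival y0 a b)
  (h_survival_le y0 a b).
have i2 : mu0.-integrable setT
    (EFin \o (fun p => h p.1 * smooth_survival delta y0 a b p)).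
  apply: (@bounded_integrable _ _ _ mu0 _ M); first exact: measurable_funM.
  move=> p; have /andP[h0 hM] := h0M p.1.
  have s0 := smooth_survival_ge0 delta y0 a b p.
  have s1 := smooth_survival_le1 delta y0 a b p.
  by rewrite ger0_norm; [rewrite -[leRHS]mulr1; exact: ler_pM|exact: mulr_ge0].
(* On the null set [Z] the two survival functions, with values in [[0, 1]], differ by at most 1; the
   term [\1_Z] makes the bound valid everywhere and adds nothing to the integral. *)
have i3 : mu0.-integrable setT (EFin \o (fun p => M * (\1_B p + 2 * eps + \1_Z p))).
  apply: (@bounded_integrable _ _ _ mu0 _ (M * (1 + 2 * eps + 1))).
    apply: measurable_funM => //; apply: measurable_funD => //.
    by apply: measurable_funD.
  move=> p; rewrite ger0_norm; last first.
    by rewrite mulr_ge0// !addr_ge0// ?mulr_ge0.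
  by rewrite ler_wpM2l// !lerD// indicE; case: (_ \in _).
rewrite /limit_survival -RintegralB//.
apply: le_trans (le_normr_Rintegral _ (integrableB measurableT i1 i2)) _ => //.
apply: (@le_trans _ _ (\int[mu0]_p (M * (\1_B p + 2 * eps + \1_Z p)))).
  apply: le_Rintegral => //.
    exact: (integrable_norm (integrableB measurableT i1 i2)).
  move=> p _ /=; rewrite -mulrBr normrM; have /andP[h0 hM] := h0M p.1.
  rewrite (ger0_norm h0); apply: ler_pM => //.
  have [pZ|pZ] := boolP (p \in Z).
    rewrite [in leRHS]indicE [in X in _ <= _ + X]indicE pZ/=.
    have s0 := smooth_survival_ge0 delta y0 a b p.
    have s1 := smooth_survival_le1 delta y0 a b p.
    have s0' := survival_ge0 y0 a b p.
    have s1' := survival_le1 y0 a b p.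
    have : 0 <= (p \in B)%:R :> R by [].
    by rewrite ler_norml; lra.
  rewrite [in X in _ <= _ + X]indicE (negbTE pZ)/= addr0.
  have smp : small_mass T delta eps p.1.
    by apply: contrapT => hp; move: pZ; rewrite notin_setE; apply; exact: bad.
  apply: le_trans (@survival_smooth_dist _ T _ _ y0 a b p d0 e0 a0 bT smp) _.
  rewrite lerD2r indicE; case: (boolP (_ <= _ < _)%R) => // hb.
  by rewrite mem_set.
rewrite RintegralZl//; last first.
  apply: (@bounded_integrable _ _ _ mu0 _ (1 + 2 * eps + 1)).
    by apply: measurable_funD => //; apply: measurable_funD.
  move=> p; rewrite ger0_norm; last first.
    by rewrite !addr_ge0// ?mulr_ge0.
  by rewrite !lerD// indicE; case: (_ \in _).
apply: ler_wpM2l => //.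
have iB : mu0.-integrable setT (EFin \o (\1_B : borel (radon R * Ico01 R)%type -> R)).
  by apply: (@bounded_integrable _ _ _ mu0 _ 1) => // p; rewrite indicE; case: (_ \in _); rewrite ?normr1 ?normr0.
have iZ : mu0.-integrable setT (EFin \o (\1_Z : borel (radon R * Ico01 R)%type -> R)).
  by apply: (@bounded_integrable _ _ _ mu0 _ 1) => // p; rewrite indicE; case: (_ \in _); rewrite ?normr1 ?normr0.
have ic : mu0.-integrable setT (EFin \o (cst (2 * eps) : borel (radon R * Ico01 R)%type -> R)).
  exact: finite_measure_integrable_cst.
rewrite RintegralD//; last exact: (integrableD measurableT iB ic).
rewrite RintegralD// !Rintegral_indicator//.
have -> : \int[mu0]_p (2 * eps) = 2 * eps.
  rewrite Rintegral_cst//; transitivity (2 * eps * fine (1%E : \bar R)).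
    by congr (_ * fine _); exact: probability_setT.
  by rewrite /= mulr1.
by rewrite Z0 addr0.
Qed.

Lemma expected_cvg y0 a b : 0 <= a -> b <= T ->
  (fun N => expected_survival N y0 a b) @ \oo --> limit_survival y0 a b.
Proof.
move=> a0 bT; apply/cvgrPdist_le => e e0.
(* The errors are at most [M * (4 * eps)] before the limit, [eps] for weak convergence and
   [M * (3 * eps)] in the limit; the summand 1 also keeps the divisor positive. *)
pose eps := e / (8 * M + 1).
have M0' := M0.
have eps0 : 0 < eps by rewrite divr_gt0//; lra.
have [d1 d10 sm1] := smallI eps0.
have [d2 d20 sm2] := smallJ eps0.
have : (fun n => fine (mu0 [set p | y0 - n.+1%:R^-1 <= \val p.2 < y0]%R))
    @ \oo --> (0 : R) by have /fine_cvg := cvg_pos_left mu0 y0.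
move=> /cvgrPdist_le/(_ _ eps0) hB.
pose d3 := Num.min d1 (Num.min d2 eps).
have d30 : 0 < d3 by rewrite !lt_min d10 d20.
(* The width [delta] is fixed before [N], since weak convergence holds for one smooth function at a
   time. *)
near \oo => n.
pose delta : R := n.+1%:R^-1.
have d0 : 0 < delta by rewrite invr_gt0 ltr0n.
have dd3 : delta <= d3.
  rewrite /delta invf_ple ?posrE ?ltr0n//.
  apply: (@le_trans _ _ n%:R); last by rewrite ler_nat.
  near: n; exact: nbhs_infty_ger.
move: dd3; rewrite /d3 !le_min => /and3P[dd1 dd2 de].
have hBn : fine (mu0 [set p | y0 - delta <= \val p.2 < y0]) <= eps.
  have : `|0 - fine (mu0 [set p | y0 - n.+1%:R^-1 <= \val p.2 < y0]%R)| <= eps.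
    by near: n.
  rewrite sub0r normrN; apply: le_trans; exact: ler_norm.
have H2 : `|limit_survival y0 a b -
    \int[mu0]_p (h p.1 * smooth_survival delta y0 a b p)| <= M * (eps + 2 * eps).
  apply: le_trans (limit_dist _ d0 (ltW eps0) _ a0 bT) _.
    by case: sm2 => Z [mZ Z0 bad]; exists Z; split => // p h'; apply: bad => h'';
      apply: h'; exact: small_massS h''.
  by apply: ler_wpM2l => //; rewrite lerD2r.
have cg : continuous (fun p : radon R * Ico01 R => h p.1 * smooth_survival delta y0 a b p).
  move=> p; apply: cvgM; last exact: continuous_smooth_survival.
  have hf : continuous (fst : radon R * Ico01 R -> radon R).
    by move=> r; exact: cvg_fst.
  exact: (@continuous_comp _ _ _ fst h p (hf p) (@ch p.1)).
have W : (fun N => N%:R^-1 * \sum_(i < N) h (rho N i) *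
    smooth_survival delta y0 a b (rho N i, initial_position (x N) i)) @ \oo -->
    \int[mu0]_p (h p.1 * smooth_survival delta y0 a b p).
  have mg := continuous_borel_real cg.
  have := weak cg.
  have bM p : `|h p.1 * smooth_survival delta y0 a b p| <= M.
    have /andP[h0 hM] := h0M p.1.
    have s0 := smooth_survival_ge0 delta y0 a b p.
    have s1 := smooth_survival_le1 delta y0 a b p.
    by rewrite ger0_norm; [rewrite -[leRHS]mulr1; exact: ler_pM|exact: mulr_ge0].
  move=> /(_ (ex_intro _ M bM)).
  under eq_fun do rewrite (empirical_integral _ mg).
  rewrite -[X in _ --> X]fineK; last first.
    by apply: integrable_fin_num => //; exact: (bounded_integrable mu0 mg bM).
  by move/fine_cvg.
move: W => /cvgrPdist_le/(_ _ eps0) W.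
near=> N.
have N0 : (0 < N)%N by near: N; exact: nbhs_infty_gt.
have H1 := empirical_dist y0 d0 (ltW eps0) N0 (fun i => small_massS dd1 (sm1 N i)) a0 bT.
have H3 : N%:R^-1 <= eps.
  rewrite invf_ple ?posrE ?ltr0n//; near: N; exact: nbhs_infty_ger.
have H4 : `|\int[mu0]_p (h p.1 * smooth_survival delta y0 a b p) -
   N%:R^-1 * \sum_(i < N) h (rho N i) *
    smooth_survival delta y0 a b (rho N i, initial_position (x N) i)| <= eps.
  by near: N.
have H5 : M * (delta + N%:R^-1 + 2 * eps) <= M * (4 * eps).
  by apply: ler_wpM2l => //; lra.
have H6 : e = (8 * M + 1) * eps by rewrite /eps mulrC divfK// gt_eqF//; lra.
have H7 : 0 <= M * eps by rewrite mulr_ge0// ltW.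
rewrite H6; move: H1 H2 H4; rewrite !ler_norml.
move=> /andP[? ?] /andP[? ?] /andP[? ?]; apply/andP; split; nra.
Unshelve. all: by end_near.
Qed.

End expected_cvg.

(** A measure outside the support has a null open neighbourhood, hence lies in a null [radon_box],
    and there are only countably many of these. *)
Lemma measure_support_ae (R : realType) (e : nat -> Rplus R -> R)
    (mu0 : probability (borel (radon R * Ico01 R)%type) R) :
  (forall n, compactly_supported_continuous (e n)) -> metrizes (state_dist e) ->
  {ae mu0, forall p, measure_support (slice mu0 0) p.1}.
Proof.
move=> e_cc e_metric.
pose null s := slice mu0 0 (radon_box e s) = 0%E.
have sliceE A : slice mu0 0 A = mu0 (fst @^-1` A).
  rewrite /slice; congr (mu0 _); apply/seteqP; split => p /=; first by case.
  by move=> Ap; split => //=; exact: valIco_ge0.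
pose Z (n : nat) : set (borel (radon R * Ico01 R)%type) :=
  if (unpickle n : option (seq (rat * rat))) is Some s then
    if `[< null s >] then fst @^-1` (radon_box e s) else set0
  else set0.
have negZ n : mu0.-negligible (Z n).
  rewrite /Z; case: (unpickle n) => [s|]; last exact: negligible_set0.
  case: asboolP => ns; last exact: negligible_set0.
  apply/negligibleP; last by move: ns; rewrite /null sliceE.
  rewrite -[X in measurable X]setTI.
  by apply: measurable_state_fst => //; exact: measurable_radon_box.
apply: negligibleS (negligible_bigcup negZ) => p /= /existsNP[U /not_implyP[oU /not_implyP[Up /negP]]].
rewrite -leNgt => U0.
pose V : set (radon R * Ico01 R) := fst @^-1` U.
have oV : open V.
  apply: open_comp => // q _; exact: cvg_fst.
have [[s c] [sp sV]] := box_base e_metric (p := (p.1, p.2)) oV Up.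
have sU : radon_box e s `<=` U.
  move=> q qs; apply: (sV (q, p.2)); split => //=; by case: sp.
exists (pickle s) => //; rewrite /Z pickleK asboolT; first by case: sp.
apply/eqP; rewrite eq_le measure_ge0 andbT; apply: le_trans U0.
rewrite !sliceE; apply: le_measure; rewrite ?inE.
- rewrite -[X in measurable X]setTI.
  by apply: measurable_state_fst => //; exact: measurable_radon_box.
- rewrite -[X in measurable X]setTI.
  by apply: measurable_state_fst => //; exact: borel_open.
- by move=> q; exact: sU.
Qed.

(** * Moduli of continuity, and uniform convergence from convergence on grids *)

Lemma mass_cover (R : realType) (q : radon R) (a b a' b' : R) :
  mass q a b <= mass q a' b' + mass q a a' + mass q b' b.
Proof.
rewrite -!Rintegral_Ioc_ind -RintegralD//; [|exact: integrable_Ioc_ind..].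
have i1 := integrable_Ioc_ind q a' b'.
have i2 := integrable_Ioc_ind q a a'.
have i3 := integrable_Ioc_ind q b' b.
have i12 := integrableD measurableT i1 i2.
rewrite -RintegralD//; apply: le_Rintegral => //.
- exact: integrable_Ioc_ind.
- exact: (integrableD measurableT i12 i3).
(* The four end points may come in any order, an interval with reversed end points being empty;
   comparing indicators pointwise treats all orders at once. *)
move=> u _; rewrite /Ioc_ind.
case: (ltP a (\val u)) => ua /=; last by rewrite !addr_ge0.
case: (leP (\val u) b) => ub /=; last by rewrite !addr_ge0.
case: (ltP a' (\val u)) => ua' /=; last by rewrite add0r lerDl.
case: (leP (\val u) b') => ub' /=; first by rewrite -addrA lerDl addr_ge0.
by rewrite lerDr addr_ge0.
Qed.

Section modulus.
Context (R : realType) (T : R).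
Variables (rho : forall N : nat, 'I_N -> radon R) (x : forall N : nat, {perm 'I_N}).
Arguments rho : clear implicits.
Arguments x : clear implicits.
Variables (h : radon R -> R) (M : R).
Hypothesis h0M : forall q, 0 <= h q <= M.

Lemma small_mass_dist delta eps q a b a' b' : small_mass T delta eps q ->
  0 <= a <= T -> 0 <= a' <= T -> 0 <= b <= T -> 0 <= b' <= T ->
  `|a - a'| <= delta -> `|b - b'| <= delta ->
  `|mass q a b - mass q a' b'| <= 2 * eps.
Proof.
move=> sm /andP[a0 aT] /andP[a'0 a'T] /andP[b0 bT] /andP[b'0 b'T].
rewrite !ler_norml => /andP[aa' a'a] /andP[bb' b'b].
have := mass_cover q a b a' b'; have := mass_cover q a' b' a b.
have h1 : mass q a a' <= eps by apply: sm => //; lra.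
have h2 : mass q a' a <= eps by apply: sm => //; lra.
have h3 : mass q b b' <= eps by apply: sm => //; lra.
have h4 : mass q b' b <= eps by apply: sm => //; lra.
by lra.
Qed.

Lemma expected_survival_dist delta eps N y a b y' a' b' : (0 < N)%N -> 0 <= eps ->
  (forall i : 'I_N, small_mass T delta eps (rho N i)) ->
  0 <= a <= T -> 0 <= a' <= T -> 0 <= b <= T -> 0 <= b' <= T ->
  `|a - a'| <= delta -> `|b - b'| <= delta ->
  `|expected_survival rho x h N y a b - expected_survival rho x h N y' a' b'| <=
  M * (`|y - y'| + N%:R^-1 + 2 * eps).
Proof.
move=> N0 e0 sm a0 a'0 b0 b'0 aa' bb'.
wlog yy' : y y' a b a' b' a0 a'0 b0 b'0 aa' bb' / y <= y'.
  move=> H; have [yy'|/ltW yy'] := leP y y'; first exact: H.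
  by rewrite distrC (distrC y); apply: H => //; rewrite distrC.
have N0' : 0 < N%:R :> R by rewrite ltr0n.
rewrite /expected_survival -mulrBr -sumrB normrM ger0_norm ?invr_ge0//.
rewrite ler_pdivrMl//.
apply: le_trans (ler_norm_sum _ _ _) _.
apply: (@le_trans _ _ (\sum_(i < N)
   M * ((y * N%:R <= (x N i)%:R < y' * N%:R)%R%:R + 2 * eps))).
  apply: ler_sum => i _; rewrite -mulrBr normrM.
  have /andP[h0 hM] := h0M (rho N i).
  rewrite (ger0_norm h0); apply: ler_pM => //.
  rewrite /survival /= val_initial_position.
  rewrite -ler_pdivlMr// -ltr_pdivrMr//.
  set z := _ / _.
  have hE : `|expR (- mass (rho N i) a b) - expR (- mass (rho N i) a' b')| <= 2 * eps.
    apply: le_trans (expR_lipschitz (mass_ge0 _ _ _) (mass_ge0 _ _ _)) _.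
    exact: small_mass_dist (sm i) _ _ _ _ aa' bb'.
  have eps20 : 0 <= 2 * eps by rewrite mulr_ge0.
  have u0 := expR_gt0 (- mass (rho N i) a b).
  have u1 : expR (- mass (rho N i) a b) <= 1.
    by rewrite -expR0 ler_expR oppr_le0 mass_ge0.
  have [yz|yz] /= := leP y z; last first.
    have -> : (y' <= z) = false.
      by apply/negbTE; rewrite -ltNge; exact: lt_le_trans yz yy'.
    by rewrite /= !mul0r subrr normr0 add0r.
  have [y'z|y'z] /= := leP y' z; first by rewrite !mul1r add0r.
  rewrite mul1r mul0r subr0 (ger0_norm (ltW u0)); lra.
rewrite -mulr_sumr big_split/= sumr_const card_ord.
have := @count_perm_between R N (x N) (y * N%:R) (y' * N%:R).
have -> : y * N%:R <= y' * N%:R by rewrite ler_pM2r.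
move=> /(_ isT) hc.
rewrite [leRHS](_ : _ = M * (`|y - y'| * N%:R + 1 + (2 * eps) *+ N)); last first.
  rewrite -[(2 * eps) *+ N]mulr_natl; field; lra.
have M0 : 0 <= M by have /andP[] := h0M (radon0 R); exact: le_trans.
rewrite ler_wpM2l// lerD2r ler0_norm ?subr_le0//; lra.
Qed.

(** The limit inherits the modulus of continuity of the averages, which depends on [N] only through
    a term [N%:R^-1] that vanishes. *)
Lemma limit_survival_dist delta eps y a b y' a' b' l l' : 0 <= eps ->
  (forall N (i : 'I_N), small_mass T delta eps (rho N i)) ->
  0 <= a <= T -> 0 <= a' <= T -> 0 <= b <= T -> 0 <= b' <= T ->
  `|a - a'| <= delta -> `|b - b'| <= delta ->
  (fun N => expected_survival rho x h N y a b) @ \oo --> l ->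
  (fun N => expected_survival rho x h N y' a' b') @ \oo --> l' ->
  `|l - l'| <= M * (`|y - y'| + 2 * eps).
Proof.
move=> e0 sm a0 a'0 b0 b'0 aa' bb' cl cl'.
have c1 : (fun N => `|expected_survival rho x h N y a b -
    expected_survival rho x h N y' a' b'|) @ \oo --> `|l - l'|.
  by apply: cvg_norm; apply: cvgB.
have c2 : (fun N : nat => M * (`|y - y'| + N%:R^-1 + 2 * eps)) @ \oo -->
    M * (`|y - y'| + 0 + 2 * eps).
  apply: cvgM; first exact: cvg_cst.
  apply: cvgD; last exact: cvg_cst.
  apply: cvgD; first exact: cvg_cst.
  apply/cvgrPdist_le => e ee; near=> N.
  rewrite sub0r normrN ger0_norm ?invr_ge0//.
  have N0 : (0 < N)%N by near: N; exact: nbhs_infty_gt.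
  rewrite invf_ple ?posrE ?ltr0n//; near: N; exact: nbhs_infty_ger.
rewrite addr0 in c2; apply: ler_cvg_to c1 c2 _.
near=> N; apply: expected_survival_dist => //.
by near: N; exact: nbhs_infty_gt.
Unshelve. all: by end_near.
Qed.

End modulus.

Lemma grid_cell (R : realType) (L r : R) (K : nat) : 0 < L -> 0 <= r <= L ->
  exists2 j : nat, (j <= K)%N & L * j%:R / K.+1%:R <= r <= L * j.+1%:R / K.+1%:R.
Proof.
move=> L0 /andP[r0 rL].
have K0 : 0 < K.+1%:R :> R by rewrite ltr0n.
have v0 : 0 <= r * K.+1%:R / L by rewrite divr_ge0 ?mulr_ge0// ltW.
pose n := Num.trunc (r * K.+1%:R / L).
have n1 : n%:R <= r * K.+1%:R / L by rewrite truncn_le.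
have n2 : r * K.+1%:R / L < n.+1%:R by exact: truncnS_gt.
rewrite ler_pdivlMr// in n1; rewrite ltr_pdivrMr// in n2.
have [nK|Kn] := leqP n K.
  exists n => //; rewrite ler_pdivrMr// ler_pdivlMr// mulrC n1/=.
  by rewrite (mulrC L) ltW.
(* This case arises only for [r = L], which is put into the last cell. *)
exists K => //; rewrite mulfK ?gt_eqF// rL andbT ler_pdivrMr//.
apply: le_trans n1; rewrite mulrC ler_pM2r// ler_nat; exact: ltnW.
Qed.

(** As in Polya's theorem on monotone functions with a continuous limit: in each cell [FN] lies
    between its values at two opposite corners, where it is close to [F], and [F] varies little in
    the cell. *)
Lemma grid_uniform_cvg (R : realType) (T : R) (FN : nat -> R -> R -> R -> R)
    (F : R -> R -> R -> R) : 0 < T ->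
  (forall N y a b y' a' b', y <= y' -> a' <= a -> b <= b' ->
     FN N y' a' b' <= FN N y a b) ->
  (forall eps, 0 < eps -> exists2 delta, 0 < delta & forall y a b y' a' b',
     0 <= y <= 1 -> 0 <= y' <= 1 ->
     0 <= a <= T -> 0 <= a' <= T -> 0 <= b <= T -> 0 <= b' <= T ->
     `|y - y'| <= delta -> `|a - a'| <= delta -> `|b - b'| <= delta ->
     `|F y a b - F y' a' b'| <= eps) ->
  (forall K j1 j2 j3 : nat, (j1 <= K.+1)%N -> (j2 <= K.+1)%N -> (j3 <= K.+1)%N ->
     (fun N => FN N (1 * j1%:R / K.+1%:R) (T * j2%:R / K.+1%:R)
                    (T * j3%:R / K.+1%:R)) @ \oo -->
     F (1 * j1%:R / K.+1%:R) (T * j2%:R / K.+1%:R) (T * j3%:R / K.+1%:R)) ->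
  forall eps, 0 < eps -> \forall N \near \oo, forall y a b,
    0 <= y <= 1 -> 0 <= a <= T -> 0 <= b <= T -> `|FN N y a b - F y a b| <= eps.
Proof.
move=> T0 mono modF cvgF eps eps0.
have eps2 : 0 < eps / 2 by lra.
have [delta d0 hd] := modF _ eps2.
(* [1 + T] bounds both side lengths of the grid, 1 for ranks and [T] for times. *)
have [K hK] : exists K : nat, (1 + T) / delta < K.+1%:R.
  by exists (Num.trunc ((1 + T) / delta)); exact: truncnS_gt.
have K0 : 0 < K.+1%:R :> R by rewrite ltr0n.
have step (L : R) : 0 < L <= 1 + T -> L / K.+1%:R <= delta.
  move=> /andP[L0 LT]; rewrite ler_pdivrMr// mulrC -ler_pdivrMr//.
  apply: le_trans (ltW hK); by rewrite ler_pM2r// invr_gt0.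
pose g (L : R) (j : nat) := L * j%:R / K.+1%:R.
have g_in (L : R) j : 0 < L -> (j <= K.+1)%N -> 0 <= g L j <= L.
  move=> L0 jK; rewrite /g; apply/andP; split.
    by rewrite divr_ge0 ?mulr_ge0// ltW.
  by rewrite ler_pdivrMr// ler_pM2l// ler_nat.
have near_all : \forall N \near \oo, forall j1 j2 j3 : 'I_K.+2,
    `|FN N (g 1 j1) (g T j2) (g T j3) - F (g 1 j1) (g T j2) (g T j3)| <= eps / 2.
  apply: filter_forall => j1; apply: filter_forall => j2; apply: filter_forall => j3.
  have := cvgF K j1 j2 j3 (ltn_ord j1) (ltn_ord j2) (ltn_ord j3).
  move=> /cvgrPdist_le/(_ _ eps2); apply: filterS => N.
  by rewrite distrC.
apply: filterS near_all => N hN y a b y01 aT bT.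
have L1 : 0 < (1 : R) <= 1 + T by rewrite ltr01/=; lra.
have LT : 0 < T <= 1 + T by rewrite T0/=; lra.
have gS (L r : R) j : 0 < L <= 1 + T ->
    g L j <= r <= g L j.+1 -> `|r - g L j| <= delta /\ `|r - g L j.+1| <= delta.
  move=> hL /andP[h1 h2]; have hs := step _ hL.
  have e : g L j.+1 - g L j = L / K.+1%:R by rewrite /g -mulrBl -mulrBr -natrB// subSnn mulr1.
  move: h1 h2 e hs; move: (g L j) (g L j.+1) (L / _) => u v w h1 h2 e hs.
  by rewrite !ler_norml; split; apply/andP; split; lra.
have [j1 j1K y_in] := grid_cell K ltr01 y01.
have [j2 j2K a_in] := grid_cell K T0 aT.
have [j3 j3K b_in] := grid_cell K T0 bT.
have [y1 y2] := gS _ _ _ L1 y_in.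
have [a1 a2] := gS _ _ _ LT a_in.
have [b1 b2] := gS _ _ _ LT b_in.
(* [FN] decreases in [y] and [b] but increases in [a], so the second index moves against the other
   two. *)
have up : FN N y a b <= FN N (g 1 j1) (g T j2.+1) (g T j3).
  by apply: mono; [case/andP: y_in|case/andP: a_in|case/andP: b_in].
have lo : FN N (g 1 j1.+1) (g T j2) (g T j3.+1) <= FN N y a b.
  by apply: mono; [case/andP: y_in|case/andP: a_in|case/andP: b_in].
have hup := hN (Ordinal (leqW j1K : (j1 < K.+2)%N)) (Ordinal (j2K : (j2.+1 < K.+2)%N))
  (Ordinal (leqW j3K : (j3 < K.+2)%N)).
have hlo := hN (Ordinal (j1K : (j1.+1 < K.+2)%N)) (Ordinal (leqW j2K : (j2 < K.+2)%N))
  (Ordinal (j3K : (j3.+1 < K.+2)%N)).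
have mup := hd y a b _ _ _ y01 (g_in 1 j1 ltr01 (leqW j1K)) aT
  (g_in T j2.+1 T0 j2K) bT (g_in T j3 T0 (leqW j3K)) y1 a2 b1.
have mlo := hd y a b _ _ _ y01 (g_in 1 j1.+1 ltr01 j1K) aT
  (g_in T j2 T0 (leqW j2K)) bT (g_in T j3.+1 T0 j3K) y2 a1 b2.
move: hup hlo mup mlo => /=; rewrite !ler_norml.
by move=> /andP[? ?] /andP[? ?] /andP[? ?] /andP[? ?]; apply/andP; split; lra.
Qed.

Section empirical_survival.
Context (R : realType) (d : measure_display) (Om : measurableType d)
  (P : probability Om R).
Variables (rho : forall N : nat, 'I_N -> radon R)
  (nu : forall N : nat, 'I_N -> R.-ker Om ~> borel (Rplus R))
  (x : forall N : nat, {perm 'I_N}).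
Arguments rho : clear implicits.
Arguments nu : clear implicits.
Arguments x : clear implicits.
Hypothesis nu_poisson : forall N (i : 'I_N),
  poisson_random_measure P (nu N i) (rho N i).
Hypothesis nu_independent : forall N : nat,
  independent_systems P (fun i => sigma_random_measure (nu N i)).
Variables (T : R) (T_gt0 : 0 < T).
Hypothesis smallI : forall eps, 0 < eps -> exists2 delta, 0 < delta &
  forall N (i : 'I_N), small_mass T delta eps (rho N i).
Variables (h : radon R -> R) (M : R).
Hypothesis h0M : forall q, 0 <= h q <= M.

(** Expressed through [nu] rather than [tau], so that probability and independence come from the
    Poisson hypotheses; [jump_in] translates back to the points. *)
Definition no_jump N (i : 'I_N) a b : set Om :=
  void_event (nu N i) ([set u : Rplus R | a < \val u <= b] : set (borel (Rplus R))).

Definition empirical_survival N y0 a b (w : Om) : R :=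
  N%:R^-1 * \sum_(i < N) h (rho N i) *
    ((y0 <= \val (initial_position (x N) i : Ico01 R))%R%:R *
     (w \in no_jump i a b)%:R).

Lemma empirical_survival_le N y a b y' a' b' w :
  y <= y' -> a' <= a -> b <= b' ->
  empirical_survival N y' a' b' w <= empirical_survival N y a b w.
Proof.
move=> yy aa bb; rewrite ler_wpM2l ?invr_ge0//; apply: ler_sum => i _.
have /andP[h0 _] := h0M (rho N i).
apply: ler_wpM2l => //; apply: ler_pM => //.
  rewrite ler_nat; case: leP => // h1; by rewrite (le_trans yy h1).
rewrite ler_nat; case: (boolP (w \in no_jump i a' b')) => //.
rewrite inE /no_jump/= => v; rewrite mem_set//=.
apply/eqP; rewrite eq_le measure_ge0 andbT -v.
apply: le_measure; rewrite ?inE; try exact: measurable_Ioc.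
move=> u /= /andP[h1 h2]; apply/andP; split; first exact: le_lt_trans h1.
exact: le_trans bb.
Qed.

Lemma empirical_survival_lln y0 a b : {ae P, forall w,
  (fun N => empirical_survival N y0 a b w - expected_survival rho x h N y0 a b)
    @ \oo --> (0 : R)}.
Proof.
pose c N (i : 'I_N) : R := h (rho N i) *
  (y0 <= \val (initial_position (x N) i : Ico01 R))%R%:R.
have cM N (i : 'I_N) : `|c N i| <= M.
  have /andP[h0 hM] := h0M (rho N i).
  rewrite /c; case: (y0 <= _) => /=; first by rewrite mulr1 ger0_norm.
  by rewrite mulr0 normr0 (le_trans h0).
have mE N (i : 'I_N) : measurable (no_jump i a b).
  by apply: measurable_void; exact: measurable_Ioc.
have indE N : independent_systems P
    (fun i : 'I_N => [set A | A = no_jump i a b \/ A = ~` no_jump i a b]).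
  move=> A hA; apply: nu_independent => i.
  have hv : sigma_random_measure (nu N i) (no_jump i a b).
    by apply: sigma_random_measure_void; exact: measurable_Ioc.
  case: (hA i) => -> //.
  have [_ hC _] := @smallest_sigma_algebra Om setT (\bigcup_(A in measurable)
    g_sigma_algebra_preimage (fun w => nu N i w A)).
  by have := hC _ hv; rewrite setTD.
have := lln_events mE indE cM.
apply: filterS => w.
suff -> : (fun N => N%:R^-1 * \sum_(i < N) c N i *
      ((w \in no_jump i a b)%:R - fine (P (no_jump i a b)))) =
    (fun N => empirical_survival N y0 a b w - expected_survival rho x h N y0 a b).
  by [].
apply/funext => N.
rewrite /empirical_survival /expected_survival -mulrBr -sumrB; congr (_ * _).
apply: eq_bigr => i _; rewrite /survival /= /c.
rewrite (poisson_void (nu_poisson i)); last 2 first.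
- exact: measurable_Ioc.
- exact: radon_Ioc_lty.
by rewrite /mass /=; ring.
Qed.

(* With c = false only the no-jump intervals (0, b] and no rank threshold are
   used, as in part (1), where the limit is known for these only. *)
Lemma empirical_survival_uniform (c : bool) (L : R -> R -> R -> R) :
  continuous h ->
  let u y := if c then y else 0 in
  (forall y a b, 0 <= y <= 1 -> 0 <= a <= T -> 0 <= b <= T ->
    (fun N => expected_survival rho x h N (u y) (u a) b) @ \oo --> L (u y) (u a) b) ->
  {ae P, forall w, forall eps, 0 < eps -> \forall N \near \oo, forall y a b,
    0 <= y <= 1 -> 0 <= a <= T -> 0 <= b <= T ->
    `|empirical_survival N (u y) (u a) b w - L (u y) (u a) b| <= eps}.
Proof.
move=> ch u cL.
have u_in (l r : R) : 0 <= r <= l -> 0 <= u r <= l.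
  by rewrite /u; case: (c) => // /andP[r0 rl]; rewrite lexx (le_trans r0).
have u_le (r s : R) : r <= s -> u r <= u s by rewrite /u; case: (c).
have u_dist (r s : R) : `|u r - u s| <= `|r - s|.
  by rewrite /u; case: (c) => //; rewrite subrr normr0.
have M0 : 0 <= M by have /andP[] := h0M (radon0 R); exact: le_trans.
pose g (l : R) (K j : nat) := l * j%:R / K.+1%:R.
have g_in (l : R) K j : 0 < l -> (j <= K.+1)%N -> 0 <= g l K j <= l.
  move=> l0 jK; rewrite /g; apply/andP; split.
    by rewrite divr_ge0 ?mulr_ge0// ltW.
  by rewrite ler_pdivrMr ?ltr0n// ler_pM2l// ler_nat.
(* The nodes of all grids are countably many, so one null set serves all of them. *)
have : {ae P, forall w, forall K j1 j2 j3 : nat,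
  (fun N => empirical_survival N (u (g 1 K j1)) (u (g T K j2)) (g T K j3) w -
   expected_survival rho x h N (u (g 1 K j1)) (u (g T K j2)) (g T K j3))
    @ \oo --> (0 : R)}.
  do 4 (apply/ae_foralln => ?).
  exact: empirical_survival_lln.
apply: filterS => w hw eps eps0.
have := @grid_uniform_cvg R T
  (fun N y a b => empirical_survival N (u y) (u a) b w)
  (fun y a b => L (u y) (u a) b) T_gt0.
apply => //.
- by move=> N y a b y' a' b' *; apply: empirical_survival_le => //; exact: u_le.
(* The shift of the rank costs at most [e'] and that of the two end points [2 * e'], each times
   [M]. *)
- move=> e e0; pose e' := e / (3 * M + 1).
  have e'0 : 0 < e' by rewrite divr_gt0//; lra.
  have [delta d0 sm] := smallI e'0.
  exists (Num.min delta e'); first by rewrite lt_min d0.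
  move=> y a b y' a' b' y1 y'1 a1 a'1 b1 b'1.
  rewrite !le_min => /andP[_ ye] /andP[ad _] /andP[bd _].
  have := limit_survival_dist h0M (ltW e'0) sm (u_in _ _ a1) (u_in _ _ a'1) b1 b'1
    (le_trans (u_dist _ _) ad) bd (cL _ _ _ y1 a1 b1) (cL _ _ _ y'1 a'1 b'1).
  move=> /le_trans; apply.
  have := u_dist y y' => uy.
  have : e = (3 * M + 1) * e' by rewrite /e' mulrC divfK// gt_eqF//; lra.
  have : M * (`|u y - u y'| + 2 * e') <= M * (3 * e').
    by apply: ler_wpM2l => //; lra.
  lra.
- move=> K j1 j2 j3 jK1 jK2 jK3.
  have h1 := cL _ _ _ (g_in _ _ _ ltr01 jK1) (g_in _ _ _ T_gt0 jK2) (g_in _ _ _ T_gt0 jK3).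
  rewrite -/(g 1 K j1) -/(g T K j2) -/(g T K j3).
  rewrite -[L _ _ _]add0r (_ : (fun N => empirical_survival N _ _ _ w) = (fun N =>
    (empirical_survival N (u (g 1 K j1)) (u (g T K j2)) (g T K j3) w -
     expected_survival rho x h N (u (g 1 K j1)) (u (g T K j2)) (g T K j3)) +
     expected_survival rho x h N (u (g 1 K j1)) (u (g T K j2)) (g T K j3))).
    exact: cvgD (hw K j1 j2 j3) h1.
  by apply/funext => N; rewrite subrK.
Qed.

End empirical_survival.

(** * Position thresholds *)

Section ranking_order.
Context (R : realType) (N : nat) (x : {perm 'I_N}) (tau : 'I_N -> nat -> Rplus R).
Variable m : 'I_N -> {measure set (borel (Rplus R)) -> \bar R}.
Hypothesis simple : simple_points tau m.
Variable t : R.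
Hypothesis fin : forall i, (m i [set u | \val u <= t]%R < +oo)%E.

Lemma jump_in (i : 'I_N) (a b : R) :
  m i [set u | (a < \val u <= b)%R] = 0%E <->
  forall j, ~ (a < \val (tau i j) <= b).
Proof.
have [tauE _ _ _] := simple.
rewrite tauE; last exact: measurable_Ioc.
split.
  move=> h j hj.
  have : ((\d_(tau i j : borel (Rplus R)) [set u : Rplus R | a < \val u <= b]%R : \bar R) <=
     \sum_(j <oo) (\d_(tau i j : borel (Rplus R)) [set u : Rplus R | a < \val u <= b]%R : \bar R))%E.
    apply: (@le_trans _ _ (\sum_(0 <= k < j.+1)
      (\d_(tau i k : borel (Rplus R)) [set u : Rplus R | a < \val u <= b]%R : \bar R))%E).
      by rewrite big_nat_recr//= leeDr// sume_ge0.
    by apply: nneseries_lim_ge.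
  by rewrite h diracE mem_set//= lee_fin ler10.
move=> h; apply: eseries0 => j _ _.
by rewrite diracE memNset// => /h.
Qed.

(** Otherwise the finite mass of [[0, t]] would be a divergent series of ones. This makes
    [last_jump] a genuine index rather than its default. *)
Lemma exists_late_jump i : exists j, t < \val (tau i j).
Proof.
have [tauE _ _ _] := simple.
apply: contrapT => /forallNP h.
have := fin i; rewrite tauE; last exact: measurable_Rplus_le.
have -> : (\sum_(j <oo) (\d_(tau i j : borel (Rplus R)) [set u : Rplus R | \val u <= t]%R : \bar R) =
  \sum_(j <oo) (1%R)%:E)%E.
  apply: eq_eseriesr => j _; rewrite diracE mem_set//=.
  by rewrite leNgt; apply/negP; exact: h.
move=> h1.
have h0 : (0 <= \sum_(j <oo) 1%:E :> \bar R)%E by apply: nneseries_ge0 => n _ _; rewrite lee_fin.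
pose r := fine (\sum_(j <oo) 1%:E : \bar R)%E.
have hr : (\sum_(j <oo) 1%:E = r%:E :> \bar R)%E by rewrite /r fineK// ge0_fin_numE.
have : (\sum_(0 <= j < (Num.trunc r).+1) 1%:E <= \sum_(j <oo) 1%:E :> \bar R)%E.
  by apply: nneseries_lim_ge => n _ _; rewrite lee_fin.
rewrite hr sumEFin lee_fin big_mkord sumr_const card_ord.
by rewrite leNgt truncnS_gt.
Qed.

Lemma tau_homo i j k : (j <= k)%N -> \val (tau i j) <= \val (tau i k).
Proof.
have [_ _ ts _] := simple.
elim: k => [|k IH]; first by rewrite leqn0 => /eqP ->.
rewrite leq_eqVlt => /predU1P[-> //|]; rewrite ltnS => /IH h.
by rewrite (le_trans h)// ltW.
Qed.

Let jumped i : bool := \val (tau i 0%N) <= t.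

Lemma last_jumpP i : jumped i ->
  \val (tau i (last_jump tau i t)) <= t < \val (tau i (last_jump tau i t).+1).
Proof.
move=> ji; rewrite /last_jump; case: xgetP => [j -> //|] noj.
exfalso.
have [j tj] := exists_late_jump i.
elim: j tj => [|j IH]; first by rewrite ltNge; move: ji; rewrite /jumped => ->.
move=> tj; apply: IH; rewrite ltNge; apply/negP => hj.
by apply: (noj j); rewrite /= hj tj.
Qed.

Let last i : R := \val (tau i (last_jump tau i t)).

Lemma last_maximal i j : jumped i -> \val (tau i j) <= t -> \val (tau i j) <= last i.
Proof.
move=> /last_jumpP/andP[h1 h2] tj; have [jl|lj] := leqP j (last_jump tau i t).
  exact: tau_homo.
have := lt_le_trans h2 (tau_homo i lj).
by rewrite ltNge tj.
Qed.

Lemma jump_le_jumped i j : \val (tau i j) <= t -> jumped i.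
Proof. by rewrite /jumped; apply: le_trans; exact: tau_homo. Qed.

(** The strict total order behind the ranking: particles that have jumped precede the others, sorted
    by decreasing time of the last jump, and the others keep their initial order. A rank then counts
    predecessors. *)
Let ahead (k i : 'I_N) : bool :=
  if jumped i then `[< exists j, last i < \val (tau k j) <= t >]
  else (x k < x i)%N || jumped k.

Lemma ahead_irr i : ~~ ahead i i.
Proof.
rewrite /ahead; case: ifPn => ji; last by rewrite ltnn negb_or.
apply/asboolPn => -[j /andP[h1 h2]].
by have := lt_le_trans h1 (last_maximal ji h2); rewrite ltxx.
Qed.

Lemma ahead_trans k i l : ahead l k -> ahead k i -> ahead l i.
Proof.
rewrite /ahead; case: (boolP (jumped i)) => ji.
  move=> + /asboolP[j /andP[h1 h2]].
  rewrite (jump_le_jumped h2) => /asboolP[j' /andP[h3 h4]].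
  apply/asboolP; exists j'; rewrite h4 andbT.
  apply: lt_trans h3; apply: lt_le_trans h1 _.
  exact: last_maximal (jump_le_jumped h2) h2.
case: (boolP (jumped k)) => jk.
  by move=> /asboolP[j /andP[_ h]] _; rewrite (jump_le_jumped h) orbT.
rewrite orbF => /orP[h1 h2|->]; last by rewrite orbT.
by rewrite (ltn_trans h1 h2).
Qed.

Lemma ahead_total i k : i != k -> ahead i k || ahead k i.
Proof.
move=> ik; rewrite /ahead.
case: (boolP (jumped i)) => ji; case: (boolP (jumped k)) => jk.
- have [_ _ _ td] := simple.
  have /andP[li _] := last_jumpP ji; have /andP[lk _] := last_jumpP jk.
  have [h|h|h] := ltgtP (last i) (last k).
  + by apply/orP; right; apply/asboolP; exists (last_jump tau k t); rewrite lk andbT.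
  + by apply/orP; left; apply/asboolP; exists (last_jump tau i t); rewrite li andbT.
  + exfalso; apply: (td i (last_jump tau i t) k (last_jump tau k t)).
      by case=> /eqP; rewrite (negbTE ik).
    exact/val_inj.
- by rewrite orbT.
- by rewrite !orbT.
- rewrite !orbF -neq_ltn; apply: contraNneq ik => h.
  by apply/eqP; apply: (@perm_inj _ x); exact/val_inj.
Qed.

Lemma rankingE i : (ranking x tau i t).-1 = (\sum_(k < N) ahead k i)%N.
Proof.
rewrite /ranking /ahead ltNge -/(jumped i); case: (boolP (jumped i)) => ji /=; first by [].
(* For a particle that has not jumped, the initial rank counts those initially ahead of it; those
   initially behind contribute once they have jumped. *)
have xiE : nat_of_ord (x i) = (\sum_(k < N) (x k < x i))%N.
  transitivity (\sum_(k < N) (k < x i))%N; last by rewrite (reindex_inj (@perm_inj _ x)).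
  rewrite -[LHS]card_ord -sum1_card (big_ord_widen N (fun=> 1%N)); last exact: ltnW.
  by rewrite big_mkcond/=; apply: eq_bigr => k _; case: ifP.
rewrite [X in (X + _)%N]xiE [X in (_ + X)%N]big_mkcond -big_split/=.
apply: eq_bigr => k _.
have [xk|xk|xk] /= := ltngtP (x k) (x i).
- by rewrite addn0.
- by rewrite add0n.
- have -> : k = i by apply: (@perm_inj _ x); exact/val_inj.
  by rewrite (negbTE ji).
Qed.

Definition rank0 i : nat := (ranking x tau i t).-1.

Lemma rank0_lt i : (rank0 i < N)%N.
Proof.
rewrite /rank0 rankingE -[X in (_ < X)%N]card_ord -sum1_card.
rewrite (bigD1 i)//= [X in (_ < X)%N](bigD1 i)//= (negbTE (ahead_irr i)) add0n.
by rewrite add1n ltnS; apply: leq_sum => k _; case: (ahead k i).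
Qed.

Lemma ahead_rank k i : ahead k i -> (rank0 k < rank0 i)%N.
Proof.
move=> aki; rewrite /rank0 !rankingE.
rewrite (bigD1 k)//= [X in (_ < X)%N](bigD1 k)//= (negbTE (ahead_irr k)) add0n aki.
rewrite add1n ltnS; apply: leq_sum => l _.
by case: (boolP (ahead l k)) => // alk; rewrite (ahead_trans alk aki).
Qed.

Let rank_ord i : 'I_N := Ordinal (rank0_lt i).

(** By totality of [ahead]. The ranks at time [t] thus form a permutation, and [count_perm_between]
    applies to them as to the initial ranks. *)
Let rank_ord_inj : injective rank_ord.
Proof.
move=> i k /(congr1 val)/= ik; apply/eqP; apply: contraT => nik.
by have /orP[/ahead_rank|/ahead_rank] := ahead_total nik; rewrite ik ltnn.
Qed.

Lemma val_position i : \val (position x tau i t) = (rank0 i)%:R / N%:R.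
Proof.
rewrite /position insubdK// inE/= in_itv/= divr_ge0//=.
have N0 : (0 < N)%N by exact: leq_ltn_trans (ltn_ord i).
by rewrite ltr_pdivrMr ?ltr0n// mul1r ltr_nat; exact: rank0_lt.
Qed.

Let survivor y0 a i : bool :=
  (y0 <= \val (initial_position x i : Ico01 R)) &&
  `[< m i [set u | (a < \val u <= t)%R] = 0%E >].

(** A non-survivor that jumped after [a] overtakes every survivor. One removed for its low initial
    rank exists only if [y0] is not 0; then [a = 0], survivors have never jumped, and the initial
    order decides. *)
Lemma survivor_behind y0 a i k : y0 = 0 \/ a = 0 ->
  survivor y0 a i -> ~~ survivor y0 a k -> ahead k i.
Proof.
move=> ya /andP[yi /asboolP/jump_in ni]; rewrite negb_and => sk.
have ak : ((\val (initial_position x k : Ico01 R) < y0) /\ a = 0) \/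
    exists j, a < \val (tau k j) <= t.
  case/orP: sk => [yk|/asboolPn nk].
    left; rewrite -ltNge in yk; split => //; case: ya => // y00.
    by move: yk; rewrite y00 ltNge valIco_ge0.
  right; apply: contrapT => /forallNP h; apply: nk; exact/jump_in.
rewrite /ahead; case: (boolP (jumped i)) => ji.
  have /andP[li _] := last_jumpP ji.
  have la : last i <= a.
    by rewrite leNgt; apply/negP => h; apply: (ni (last_jump tau i t)); rewrite h.
  case: ak => [[_ a0]|[j /andP[h1 h2]]].
    have [_ tpos _ _] := simple.
    have := tau_homo i (leq0n (last_jump tau i t)); rewrite -/(last i).
    move=> /(lt_le_trans (tpos i)) h3.
    by have := lt_le_trans h3 la; rewrite a0 ltxx.
  by apply/asboolP; exists j; rewrite h2 andbT; exact: le_lt_trans h1.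
case: ak => [[yk _]|[j /andP[h1 h2]]]; last by rewrite (jump_le_jumped h2) orbT.
have := lt_le_trans yk yi; rewrite !val_initial_position.
have N0 : (0 < N)%N by exact: leq_ltn_trans (ltn_ord i).
by rewrite ltr_pM2r ?invr_gt0 ?ltr0n// ltr_nat => ->.
Qed.

Let removed y0 a : nat := (\sum_(k < N) ~~ survivor y0 a k)%N.

(** A final segment of a finite total order consists of the ranks at least equal to the cardinal of
    its complement. *)
Lemma survivor_rank y0 a i : y0 = 0 \/ a = 0 ->
  survivor y0 a i = (removed y0 a <= rank0 i)%N.
Proof.
move=> ya; rewrite /rank0 rankingE /removed; apply/idP/idP.
  move=> si; apply: leq_sum => k _; case: (boolP (survivor y0 a k)) => // sk.
  by rewrite (survivor_behind ya si sk).
apply: contraTT => si; rewrite -ltnNge.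
rewrite (bigD1 i)//= [X in (_ < X)%N](bigD1 i)//= (negbTE (ahead_irr i)) add0n si.
rewrite add1n ltnS; apply: leq_sum => l _.
case: (boolP (ahead l i)) => // ali; case: (boolP (survivor y0 a l)) => // sl.
have := ahead_trans ali (survivor_behind ya sl si).
by rewrite (negbTE (ahead_irr l)).
Qed.

Lemma position_threshold y0 a (c : 'I_N -> R) (M y : R) : y0 = 0 \/ a = 0 ->
  (forall i, 0 <= c i <= M) -> (0 < N)%N ->
  `|N%:R^-1 * \sum_(i < N) c i * (y <= \val (position x tau i t))%R%:R -
    N%:R^-1 * \sum_(i < N) c i * (survivor y0 a i)%:R| <=
  M * (`|1 - y - N%:R^-1 * \sum_(i < N) (survivor y0 a i)%:R| + N%:R^-1).
Proof.
move=> ya cM N0.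
have N0' : 0 < N%:R :> R by rewrite ltr0n.
pose C : R := (removed y0 a)%:R.
have CE : 1 - N%:R^-1 * \sum_(i < N) (survivor y0 a i)%:R = C / N%:R.
  have -> : \sum_(i < N) (survivor y0 a i)%:R = N%:R - C :> R.
    rewrite /C /removed natr_sum -[in N%:R](card_ord N) -sum1_card natr_sum -sumrB.
    by apply: eq_bigr => i _; case: (survivor y0 a i); rewrite ?subr0 ?subrr.
  by rewrite mulrBr mulVf ?gt_eqF// opprB addrC subrK mulrC.
have -> : 1 - y - N%:R^-1 * \sum_(i < N) (survivor y0 a i)%:R = C / N%:R - y.
  by rewrite -CE; ring.
rewrite -mulrBr -sumrB normrM (@ger0_norm _ N%:R^-1) ?invr_ge0//.
rewrite ler_pdivrMl//.
apply: le_trans (ler_norm_sum _ _ _) _.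
have M0 : 0 <= M by have /andP[h1 h2] := cM (Ordinal N0); exact: le_trans h2.
(* Both indicators are thresholds on the rank, at [C] and at [y * N%:R]; they disagree only for
   ranks in between, of which there are at most the distance plus 1. *)
pose lo := Num.min C (y * N%:R); pose hi := Num.max C (y * N%:R).
apply: (@le_trans _ _ (\sum_(i < N) M * (lo <= (rank_ord i)%:R < hi)%R%:R)).
  apply: ler_sum => i _; rewrite -mulrBr normrM.
  have /andP[h0 hM] := cM i; rewrite (ger0_norm h0); apply: ler_pM => //.
  rewrite (survivor_rank i ya) val_position ler_pdivlMr// -(ler_nat R) -/C /=.
  rewrite /lo /hi ge_min lt_max.
  case: (leP C (rank0 i)%:R) => h1; case: (leP (y * N%:R) (rank0 i)%:R) => h2 //=;
    by rewrite ?subrr ?normr0 ?subr0 ?sub0r ?normrN ?normr1.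
rewrite -mulr_sumr mulrCA ler_wpM2l//.
have pE i : rank_ord i = perm rank_ord_inj i by rewrite permE.
under eq_bigr do rewrite pE.
have lohi : lo <= hi by rewrite /lo /hi ge_min le_max lexx.
apply: le_trans (count_perm_between _ lohi) _.
rewrite mulrDr mulfV ?gt_eqF// lerD2r.
have -> : C / N%:R - y = (C - y * N%:R) / N%:R by field; rewrite gt_eqF.
rewrite normrM (@ger0_norm _ N%:R^-1) ?invr_ge0// mulrCA mulfV ?gt_eqF// mulr1.
rewrite /lo /hi; case: (leP C (y * N%:R)) => h.
  by rewrite ler0_norm ?subr_le0// opprB.
by rewrite ger0_norm// subr_ge0 ltW.
Qed.

End ranking_order.

(** * The limit measures *)

(** Stated for a domain closed downwards in order to serve [t0_of] on [[0, t]] and [yhat] on [[0,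
    1[] alike; continuity puts the infimum on the level [y]. *)
Lemma first_crossing (R : realType) (D : set R) (f : R -> R) (y s1 : R) :
  (forall s, D s -> 0 <= s) -> (forall s s', D s -> 0 <= s' <= s -> D s') ->
  (forall s eps, D s -> 0 < eps -> exists2 delta, 0 < delta &
     forall s', D s' -> `|s - s'| < delta -> `|f s - f s'| < eps) ->
  D s1 -> y <= f s1 -> f 0 <= y ->
  let s0 := inf [set s | D s /\ y <= f s] in
  [/\ D s0, f s0 = y & forall s, D s -> y <= f s -> s0 <= s].
Proof.
move=> D0 Ddown fc Ds1 ys1 f0y s0.
pose E := [set s | D s /\ y <= f s].
have lbE : lbound E 0 by move=> s [/D0].
have infE : has_inf E by split; [exists s1 | exists 0].
have minE s : D s -> y <= f s -> s0 <= s.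
  by move=> Ds ys; apply: ge_inf; [exists 0|split].
have s00 : 0 <= s0 by apply: lb_le_inf => //; exists s1.
have Ds0 : D s0 by apply: (Ddown s1) => //; rewrite s00 minE.
split => //; apply/eqP; rewrite eq_le; apply/andP; split; last first.
  apply/ler_addgt0Pr => eps eps0.
  have [delta d0 hd] := fc _ _ Ds0 eps0.
  have [s [Ds ys] ss0] := inf_adherent d0 infE.
  have s0s : s0 <= s by exact: minE.
  have := hd s Ds; rewrite ler0_norm ?subr_le0// opprB ltrBlDl => /(_ ss0).
  rewrite ltr_norml; lra.
have [s0E|s0N] := eqVneq s0 0; first by rewrite s0E.
have s0gt : 0 < s0 by rewrite lt_neqAle eq_sym s0N.
apply/ler_addgt0Pr => eps eps0.
have [delta d0 hd] := fc _ _ Ds0 eps0.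
(* A point just before [s0], but not below 0: there [f] is less than [y] by minimality, and
   continuity carries the bound to [s0]. *)
pose s := Num.max 0 (s0 - delta / 2).
have ss0 : s < s0 by rewrite gt_max s0gt/=; lra.
have s_ge0 : 0 <= s by rewrite le_max lexx.
have Ds : D s by apply: (Ddown s0) => //; rewrite s_ge0 ltW.
have sd : s0 - delta / 2 <= s by rewrite le_max lexx orbT.
have fs : f s < y by rewrite ltNge; apply/negP => /(minE _ Ds); rewrite leNgt ss0.
have sd' : `|s0 - s| < delta by rewrite ger0_norm ?subr_ge0 ?ltW//; lra.
by have := hd s Ds sd'; rewrite ltr_norml; lra.
Qed.

Section thresholds.
Context (R : realType) (mu0 : probability (borel (radon R * Ico01 R)%type) R).
Variable t : R.
Hypothesis t0 : 0 <= t.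

Definition total_survival y0 a b : R := \int[mu0]_p survival y0 a b p.

Lemma integrable_survival y0 a b : mu0.-integrable setT
  (EFin \o (survival y0 a b : borel (radon R * Ico01 R)%type -> R)).
Proof.
apply: (@bounded_integrable _ _ _ mu0 _ 1); first exact: measurable_survival.
by move=> p; rewrite ger0_norm ?survival_ge0// survival_le1.
Qed.

Lemma survival_le y0 a y0' a' b (p : radon R * Ico01 R) :
  y0 <= y0' -> a' <= a -> survival y0' a' b p <= survival y0 a b p.
Proof.
move=> yy aa; apply: ler_pM => //.
  by rewrite ler_nat; case: (leP y0' _) => // h; rewrite (le_trans yy h).
by rewrite ler_expR lerN2 massS.
Qed.

Lemma slice_survival y a b (A : set (borel (radon R))) : measurable A ->
  (\int[slice mu0 y]_(q in A) (expR (- mass q a b))%:E =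
   \int[mu0]_p (\1_A p.1 * survival y a b p)%:E)%E.
Proof.
move=> mA; rewrite slice_integral//; last first.
  apply/measurable_EFinP; apply: measurableT_comp => //.
  by apply: measurableT_comp => //; exact: measurable_mass.
rewrite integral_mkcond; apply: eq_integral => p _; rewrite /patch /survival indicE.
case: ifPn => [|h].
  by rewrite inE/= => -[Ap yp]; rewrite mem_set// yp !mul1r.
case: (boolP (p.1 \in A)) => pA; last by rewrite mul0r.
case: (boolP (y <= \val p.2)) => yp; last by rewrite mul0r mulr0.
move: h; rewrite notin_setE/= => h; exfalso; apply: h; split => //.
by rewrite inE in pA.
Qed.

Lemma total_survivalE y a b :
  fine (\int[slice mu0 y]_q (expR (- mass q a b))%:E)%E = total_survival y a b.
Proof.
rewrite slice_survival// /total_survival /Rintegral; congr fine.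
by apply: eq_integral => p _; rewrite indicT mul1r.
Qed.

Lemma yAE s : yA mu0 s t = 1 - total_survival 0 (t - s) t.
Proof. by rewrite /yA total_survivalE. Qed.

Lemma yBE y : yB mu0 y t = 1 - total_survival y 0 t.
Proof. by rewrite /yB total_survivalE. Qed.

Lemma yCE : yC mu0 t = 1 - total_survival 0 0 t.
Proof. by rewrite /yC yAE subrr. Qed.

Lemma total_survival_le y0 a y0' a' b : y0 <= y0' -> a' <= a ->
  total_survival y0' a' b <= total_survival y0 a b.
Proof.
move=> yy aa; apply: le_Rintegral => //; try exact: integrable_survival.
by move=> p _; exact: survival_le.
Qed.

Lemma total_survival_ge0 y0 a b : 0 <= total_survival y0 a b.
Proof. by apply: Rintegral_ge0 => p _; exact: survival_ge0. Qed.

Lemma total_survival1 : total_survival 0 t t = 1.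
Proof.
rewrite /total_survival (@eq_Rintegral _ _ _ mu0 _ (cst 1)).
  rewrite Rintegral_cst//; transitivity (1 * fine (1%E : \bar R)).
    by congr (_ * fine _); exact: probability_setT.
  by rewrite mul1r.
by move=> p _; rewrite /survival mass0// valIco_ge0 oppr0 expR0 mulr1.
Qed.

(** Positions are less than 1, so the mass of positions near 1 vanishes. Hence [yB] exceeds every
    [y < 1], and [yhat] is the infimum of a nonempty set. *)
Lemma total_survival_small (eps : R) : 0 < eps -> exists u,
  0 <= u < 1 /\ total_survival u 0 t <= eps.
Proof.
move=> eps0.
have : (fun n => fine (mu0 [set p | 1 - n.+1%:R^-1 <= \val p.2 < 1]%R))
    @ \oo --> (0 : R) by have /fine_cvg := cvg_pos_left mu0 1.
move=> /cvgrPdist_le/(_ _ eps0)[n _ /(_ n (leqnn n))] /=.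
rewrite sub0r normrN => h.
have n1 : n.+1%:R^-1 <= 1 :> R by rewrite invf_le1 ?ltr0n// ler1n.
have n0 : 0 < n.+1%:R^-1 :> R by rewrite invr_gt0 ltr0n.
exists (1 - n.+1%:R^-1); split; first by rewrite subr_ge0 n1 gtrBl n0.
apply: le_trans h; apply: le_trans (ler_norm _).
pose B : set (borel (radon R * Ico01 R)%type) :=
  [set p | 1 - n.+1%:R^-1 <= \val p.2 < 1].
have mB : measurable B.
  have := @measurable_state_pos R measurableT _
    (measurable_itv `[1 - n.+1%:R^-1, 1[).
  by rewrite setTI; congr measurable; apply/seteqP; split => p /=; rewrite in_itv.
rewrite -/B -(Rintegral_indicator mu0 mB).
apply: le_Rintegral => //; first exact: integrable_survival.
  by apply: (@bounded_integrable _ _ _ mu0 _ 1) => // p; rewrite indicE; case: (_ \in _); rewrite ?normr1 ?normr0.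
move=> p _; rewrite indicE; case: (boolP (p \in B)) => pB.
  exact: survival_le1.
rewrite /survival; case: (leP (1 - n.+1%:R^-1) (\val p.2)) => hp; last by rewrite mul0r.
move: pB; rewrite notin_setE => pB; exfalso; apply: pB.
by rewrite /B/= hp valIco_lt1.
Qed.

Hypothesis contA : forall s eps, 0 <= s <= t -> 0 < eps ->
  exists2 delta, 0 < delta & forall s', 0 <= s' <= t -> `|s - s'| < delta ->
    `|yA mu0 s t - yA mu0 s' t| < eps.
Hypothesis contB : forall s eps, 0 <= s < 1 -> 0 < eps ->
  exists2 delta, 0 < delta & forall s', 0 <= s' < 1 -> `|s - s'| < delta ->
    `|yB mu0 s t - yB mu0 s' t| < eps.

Lemma t0_ofP y : 0 <= y <= yC mu0 t ->
  [/\ 0 <= t0_of mu0 y t <= t, yA mu0 (t0_of mu0 y t) t = y &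
      forall s, 0 <= s <= t -> y <= yA mu0 s t -> t0_of mu0 y t <= s].
Proof.
move=> /andP[y0 yC].
apply: (@first_crossing _ [set s | 0 <= s <= t] (fun s => yA mu0 s t) y t) => //=.
- by move=> s /andP[].
- by move=> s s' /andP[_ st] /andP[-> h] /=; exact: le_trans st.
- by rewrite t0 lexx.
- by rewrite yAE subr0 total_survival1 subrr.
Qed.

Lemma yhatP y : yC mu0 t <= y < 1 ->
  [/\ 0 <= yhat mu0 y t < 1, yB mu0 (yhat mu0 y t) t = y &
      forall s, 0 <= s < 1 -> y <= yB mu0 s t -> yhat mu0 y t <= s].
Proof.
move=> /andP[yC y1].
have [u [u01 hu]] : exists u, 0 <= u < 1 /\ total_survival u 0 t <= 1 - y.
  by apply: total_survival_small; rewrite subr_gt0.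
have H : [/\ [set s : R | 0 <= s < 1] (yhat mu0 y t), yB mu0 (yhat mu0 y t) t = y &
    forall s, [set s : R | 0 <= s < 1] s -> y <= yB mu0 s t -> yhat mu0 y t <= s].
  apply: (@first_crossing _ [set s | 0 <= s < 1] (fun s => yB mu0 s t) y u).
  - by move=> s /andP[].
  - by move=> s s' /andP[_ st] /andP[s'0 h] /=; rewrite s'0 (le_lt_trans h st).
  - exact: contB.
  - exact: u01.
  - by rewrite yBE; lra.
  - by rewrite yBE -yCE.
exact: H.
Qed.

(** Together with [time_thr], one pair of thresholds for both regimes, so that a single function
    [survival] describes the limit; one of the two is always 0, as the ordering argument demands. *)
Definition rank_thr y : R := if y <= yC mu0 t then 0 else yhat mu0 y t.
Definition time_thr y : R := if y <= yC mu0 t then t - t0_of mu0 y t else 0.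

Lemma thr_total y : 0 <= y < 1 ->
  [/\ 0 <= rank_thr y <= 1, 0 <= time_thr y <= t,
      rank_thr y = 0 \/ time_thr y = 0 &
      total_survival (rank_thr y) (time_thr y) t = 1 - y].
Proof.
move=> /andP[y0 y1]; rewrite /rank_thr /time_thr; case: (leP y (yC mu0 t)) => h.
  have [/andP[h1 h2] h3 _] := @t0_ofP y (introT andP (conj y0 h)).
  split; [by rewrite lexx ler01| |by left|]; first by apply/andP; split; lra.
  by move: h3; rewrite yAE; lra.
have [/andP[h1 h2] h3 _] := @yhatP y (introT andP (conj (ltW h) y1)).
split; [by rewrite h1 ltW|by rewrite lexx t0|by right|].
by move: h3; rewrite yBE; lra.
Qed.

Definition tail y p : R := survival (rank_thr y) (time_thr y) t p.

Lemma tail_le y y' p : 0 <= y -> y <= y' -> y' < 1 -> tail y' p <= tail y p.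
Proof.
move=> y0 yy y1; apply: survival_le; rewrite /rank_thr /time_thr.
  case: (leP y (yC mu0 t)) => h; case: (leP y' (yC mu0 t)) => h' //.
  - by have [/andP[]] := @yhatP y' (introT andP (conj (ltW h') y1)).
  - by have := lt_le_trans h (le_trans yy h'); rewrite ltxx.
  have [h1 h2 _] := @yhatP y' (introT andP (conj (ltW h') y1)).
  have [_ _ hm] := @yhatP y (introT andP (conj (ltW h) (le_lt_trans yy y1))).
  by apply: (hm _ h1); rewrite h2.
case: (leP y (yC mu0 t)) => h; case: (leP y' (yC mu0 t)) => h' //.
- have [h1 h2 _] := @t0_ofP y' (introT andP (conj (le_trans y0 yy) h')).
  have [_ _ hm] := @t0_ofP y (introT andP (conj y0 h)).
  by rewrite lerD2l lerN2; apply: (hm _ h1); rewrite h2.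
- have [/andP[h1 h2] _ _] := @t0_ofP y (introT andP (conj y0 h)).
  by rewrite subr_ge0.
- by have := lt_le_trans h (le_trans yy h'); rewrite ltxx.
Qed.

(** A tail probability must be continuous from the left in [y]. Here this comes from the infima
    [t0_of] and [yhat], which are approached from below as [y'] increases to [y], and from
    continuity of the mass as its left end point decreases. *)
Lemma tail_left_closed y p r : 0 < y < 1 ->
  (forall y', 0 <= y' < y -> r <= tail y' p) -> r <= tail y p.
Proof.
move=> /andP[y0 y1] hr; rewrite /tail /rank_thr /time_thr.
case: (leP y (yC mu0 t)) => hC.
  have [/andP[s0 st] As hm] := @t0_ofP y (introT andP (conj (ltW y0) hC)).
  set s := t0_of mu0 y t in s0 st As hm *.
  (* By minimality of [s], the value of [yA] at [s'] is below [y]; a level [y'] halfway between them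
     has its crossing time at or after [s']. *)
  have early s' : 0 <= s' < s -> r <= survival 0 (t - s') t p.
    move=> /andP[s'0 s's].
    have s't : 0 <= s' <= t by rewrite s'0 (le_trans (ltW s's)).
    have As' : yA mu0 s' t < y.
      by rewrite ltNge; apply/negP => /(hm _ s't); rewrite leNgt s's.
    have As'0 : 0 <= yA mu0 s' t.
      rewrite yAE -total_survival1 subr_ge0; apply: total_survival_le => //.
      by rewrite gerBl.
    pose y' := (yA mu0 s' t + y) / 2.
    have [m1 m2] := midf_lt As'; rewrite -/y' in m1 m2.
    have y'01 : 0 <= y' < y by rewrite m2 (le_trans As'0 (ltW m1)).
    have y'C : 0 <= y' <= yC mu0 t.
      by move/andP: y'01 => [-> /ltW h] /=; exact: le_trans hC.
    apply: le_trans (hr _ y'01) _; apply: survival_le.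
      by rewrite /rank_thr; case/andP: y'C => _ ->.
    have [/andP[h1 h2] h3 _] := t0_ofP y'C.
    rewrite /time_thr; case/andP: (y'C) => _ ->; rewrite lerD2l lerN2.
    rewrite leNgt; apply/negP => h4.
    have : yA mu0 (t0_of mu0 y' t) t <= yA mu0 s' t.
      rewrite !yAE lerD2l lerN2; apply: total_survival_le => //.
      by rewrite lerD2l lerN2 ltW.
    by rewrite h3 leNgt m1.
  rewrite /survival valIco_ge0 mul1r.
  have [s00|sN0] := eqVneq s 0.
    rewrite s00 subr0 mass0// oppr0 expR0.
    by apply: le_trans (hr 0 _) (survival_le1 _ _ _ _); rewrite lexx.
  have s_gt0 : 0 < s by rewrite lt_neqAle eq_sym sN0.
  set a := t - s.
  (* Letting [s'] increase to [s] moves the left end point down to [a]; the mass gained is that of a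
     shrinking interval to the right of [a]. *)
  have cm : (fun n => expR (- mass p.1 a t + mass p.1 a (a + n.+1%:R^-1))) @ \oo -->
      expR (- mass p.1 a t + 0).
    apply: continuous_cvg; first exact: continuous_expR.
    by apply: cvgD; [exact: cvg_cst|exact: cvg_mass_right].
  rewrite addr0 in cm; apply: ler_cvg_to (cvg_cst r) cm _.
  near=> n.
  have ns : n.+1%:R^-1 <= s.
    rewrite invf_ple ?posrE ?ltr0n//; apply: (@le_trans _ _ n%:R).
      by near: n; exact: nbhs_infty_ger.
    by rewrite ler_nat.
  have n0 : 0 < n.+1%:R^-1 :> R by rewrite invr_gt0 ltr0n.
  have := early (s - n.+1%:R^-1).
  have -> : 0 <= s - n.+1%:R^-1 < s by rewrite subr_ge0 ns gtrBl n0.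
  move=> /(_ isT); rewrite /survival valIco_ge0 mul1r.
  have -> : t - (s - n.+1%:R^-1) = a + n.+1%:R^-1 by rewrite /a; ring.
  move=> /le_trans; apply; rewrite ler_expR.
  rewrite (@massD _ _ a (a + n.+1%:R^-1) t); first by lra.
    by rewrite lerDl ltW.
  by rewrite /a -lerBrDl opprB addrCA subrr addr0.
have [h1 h2 hm] := @yhatP y (introT andP (conj (ltW hC) y1)).
have C0 : 0 <= yC mu0 t.
  by rewrite yCE -total_survival1 subr_ge0; exact: total_survival_le.
rewrite /survival; case: (leP (yhat mu0 y t) (\val p.2)) => hp /=.
  rewrite mul1r; pose y' := (yC mu0 t + y) / 2.
  have [m1 m2] := midf_lt hC; rewrite -/y' in m1 m2.
  have y'01 : 0 <= y' < y by rewrite m2 (le_trans C0 (ltW m1)).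
  have y'C : (y' <= yC mu0 t) = false by rewrite leNgt m1.
  apply: le_trans (hr _ y'01) _; rewrite /tail /rank_thr /time_thr y'C/=.
  by rewrite /survival; case: (yhat mu0 y' t <= \val p.2)%R => /=;
    [rewrite mul1r|rewrite mul0r expR_ge0].
rewrite mul0r; have Bp : yB mu0 (\val p.2) t < y.
  rewrite ltNge; apply/negP => /hm; rewrite valIco_ge0 valIco_lt1 => /(_ isT).
  by rewrite leNgt hp.
(* Above [yC] this level is in the rank regime, and above the value of [yB] at the position of [p]
   its threshold exceeds that position; the tail thus vanishes already at [y' < y]. *)
pose y' := (Num.max (yC mu0 t) (yB mu0 (\val p.2) t) + y) / 2.
have mx : Num.max (yC mu0 t) (yB mu0 (\val p.2) t) < y by rewrite gt_max hC.
have mx1 : yC mu0 t <= Num.max (yC mu0 t) (yB mu0 (\val p.2) t) by rewrite le_max lexx.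
have mx2 : yB mu0 (\val p.2) t <= Num.max (yC mu0 t) (yB mu0 (\val p.2) t).
  by rewrite le_max lexx orbT.
have [m1 m2] := midf_lt mx; rewrite -/y' in m1 m2.
have y'01 : 0 <= y' < y by rewrite m2 (le_trans C0 (le_trans mx1 (ltW m1))).
have y'C' : yC mu0 t < y' by exact: le_lt_trans m1.
have y'C : (y' <= yC mu0 t) = false by rewrite leNgt y'C'.
have [h1' h2' _] : [/\ 0 <= yhat mu0 y' t < 1, yB mu0 (yhat mu0 y' t) t = y' &
      forall s, 0 <= s < 1 -> y' <= yB mu0 s t -> yhat mu0 y' t <= s].
  by apply: yhatP; rewrite ltW//=; case/andP: y'01 => _ /lt_trans; apply.
have := hr _ y'01; rewrite /tail /rank_thr /time_thr y'C/= /survival.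
have -> : (yhat mu0 y' t <= \val p.2) = false; last by rewrite mul0r.
apply/negP => h3.
have : yB mu0 (yhat mu0 y' t) t <= yB mu0 (\val p.2) t.
  by rewrite !yBE lerD2l lerN2; apply: total_survival_le.
by rewrite h2' leNgt (le_lt_trans mx2 m1).
Unshelve. all: by end_near.
Qed.

End thresholds.

(** * Construction of the limit law by sampling from the tail *)

Lemma measurable_fun_of_ge d (X : measurableType d) (R : realType) (f : X -> R) :
  (forall y, measurable [set x | y <= f x]) -> measurable_fun setT f.
Proof.
move=> H; apply: (measurability _ (RGenInftyO.measurableE R)).
move=> _ [_ [y ->] <-]; rewrite setTI.
have -> : f @^-1` `]-oo, y[%classic = ~` [set x | y <= f x].
  by apply/seteqP; split => x /=; rewrite in_itv/= ltNge => /negP.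
exact: measurableC.
Qed.

Definition unit_prob (R : realType) : probability (measurableTypeR R) R := uniform_prob (@ltr01 R).

(** The null level [r = 0] is excluded: there the supremum used for sampling is 1 and the position
    falls back to its default. *)
Lemma unit_prob_below (R : realType) (A : set R) (g : R) : 0 <= g <= 1 ->
  measurable A -> (forall r, 0 < r <= 1 -> A r <-> r <= g) -> unit_prob R A = g%:E.
Proof.
move=> /andP[g0 g1] mA Ag.
change ((\int[lebesgue_measure]_(x in A) (uniform_pdf 0 1 x)%:E)%E = g%:E).
rewrite integral_uniform_pdf.
have mAI : measurable (A `&` `[0, 1]) by apply: measurableI.
rewrite (eq_integral (cst 1%E)); last first.
  move=> r; rewrite inE/= in_itv/= => -[_ r01].
  by rewrite /uniform_pdf r01 subr0 invr1.
rewrite integral_cst// mul1e; apply/eqP; rewrite eq_le; apply/andP; split.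
  apply: (@le_trans _ _ (lebesgue_measure `[0, g]%classic)).
    apply: le_measure; rewrite ?inE//.
    move=> r /=; rewrite !in_itv/= => -[Ar /andP[r0 r1]]; rewrite r0/=.
    by case: (ltgtP 0 r) r0 => // [r0 _|<- _//]; apply/Ag => //; rewrite r0.
  rewrite lebesgue_measure_itv/= lte_fin; case: ltP => h.
    by rewrite oppr0 adde0.
  by rewrite lee_fin.
apply: (@le_trans _ _ (lebesgue_measure `]0, g]%classic)).
  rewrite lebesgue_measure_itv/= lte_fin; case: ltP => h.
    by rewrite oppr0 adde0.
  by rewrite lee_fin.
apply: le_measure; rewrite ?inE//.
move=> r /=; rewrite !in_itv/= => /andP[r0 rg]; split.
  by apply/Ag => //; rewrite r0 (le_trans rg).
by rewrite ltW//= (le_trans rg).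
Qed.

Section limit_measure_construction.
Context (R : realType) (e : nat -> Rplus R -> R).
Hypothesis e_cc : forall n, compactly_supported_continuous (e n).
Hypothesis e_metric : metrizes (state_dist e).
Variables (mu0 : probability (borel (radon R * Ico01 R)%type) R) (t : R).
Hypothesis t0 : 0 <= t.
Hypothesis contA : forall s eps, 0 <= s <= t -> 0 < eps ->
  exists2 delta, 0 < delta & forall s', 0 <= s' <= t -> `|s - s'| < delta ->
    `|yA mu0 s t - yA mu0 s' t| < eps.
Hypothesis contB : forall s eps, 0 <= s < 1 -> 0 < eps ->
  exists2 delta, 0 < delta & forall s', 0 <= s' < 1 -> `|s - s'| < delta ->
    `|yB mu0 s t - yB mu0 s' t| < eps.

Let X := borel (radon R * Ico01 R)%type.
Let Y := measurableTypeR R.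
Let G := tail mu0 t.

Let G_le y y' (p : X) : 0 <= y -> y <= y' -> y' < 1 -> G y' p <= G y p.
Proof. exact: tail_le. Qed.

Let G01 y (p : X) : 0 <= G y p <= 1.
Proof. by rewrite survival_ge0 survival_le1. Qed.

Let mG y : measurable_fun setT (G y : X -> R).
Proof. exact: measurable_survival. Qed.

Let iG y : mu0.-integrable setT (EFin \o (G y : X -> R)).
Proof. exact: integrable_survival. Qed.

Lemma tail0 (p : X) : G 0 p = 1.
Proof.
have yC0 : 0 <= yC mu0 t.
  by rewrite yCE -(total_survival1 mu0 t) subr_ge0; exact: total_survival_le.
have [/andP[h1 _] _ hm] := t0_ofP t0 contA (introT andP (conj (lexx 0) yC0)).
have z0 : t0_of mu0 0 t = 0.
  apply/eqP; rewrite eq_le h1 andbT; apply: hm; first by rewrite lexx t0.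
  by rewrite yAE subr0 total_survival1 subrr.
rewrite /G /tail /rank_thr /time_thr yC0 z0 subr0 /survival valIco_ge0 mul1r.
by rewrite mass0// oppr0 expR0.
Qed.

(** Its supremum is the generalized inverse, at level [r], of the decreasing function
    [y |-> G y p]. *)
Let zset (p : X) (r : R) : set R := [set y | 0 <= y < 1 /\ r <= G y p].
Let zsup p r : R := sup (zset p r).

Let zset_ub p r : ubound (zset p r) 1.
Proof. by move=> y [/andP[_ /ltW]]. Qed.

Let zsup_ge0 p r : 0 <= zsup p r.
Proof.
have [[y zy]|] := pselect (zset p r !=set0).
  apply: le_trans (ub_le_sup _ zy); last by exists 1.
  by case: zy => /andP[].
move=> /set0P/negP/negPn/eqP z0.
by rewrite /zsup z0 sup0.
Qed.

(** The usual equivalence for quantiles; from left to right it rests on [tail_left_closed], since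
    [y] may be the supremum itself. *)
Let zsup_geE p r y : 0 < y < 1 -> (y <= zsup p r) = (r <= G y p).
Proof.
move=> /andP[y0 y1]; apply/idP/idP => h; last first.
  by apply: ub_le_sup; [exists 1|split; [rewrite ltW|]].
apply: (tail_left_closed t0 contA contB); first by rewrite y0.
move=> y' /andP[y'0 y'y].
have ne : zset p r !=set0.
  apply: contrapT => /set0P/negP/negPn/eqP z0.
  by move: h; rewrite /zsup z0 sup0 leNgt y0.
have hs : has_sup (zset p r) by split => //; exists 1.
have [y'' [/andP[y''0 y''1] ry''] y'y''] := sup_gt ne (lt_le_trans y'y h).
apply: le_trans ry'' _; apply: G_le => //; exact: ltW.
Qed.

(** Positions live in [[0, 1[], so a supremum equal to 1 is replaced by 0; [pos_ae] shows that this
    does not affect the law. *)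
Let pos p r : R := if zsup p r < 1 then zsup p r else 0.

Let pos01 p r : 0 <= pos p r < 1.
Proof. by rewrite /pos; case: ifP => [->|_]; rewrite ?zsup_ge0// lexx ltr01. Qed.

Let Z p r : Ico01 R := insubd (point : Ico01 R) (pos p r).

Let valZ p r : \val (Z p r) = pos p r.
Proof. by rewrite /Z insubdK// inE/= in_itv/= pos01. Qed.

Let below y : set (X * Y)%type := [set z | z.2 <= G y z.1].

Let m_below y : measurable (below y).
Proof.
have mf : measurable_fun setT (fun z : (X * Y)%type => G y z.1 - z.2).
  apply: measurable_funB => //.
  by apply: measurableT_comp => //; exact: mG.
have := mf measurableT _ (measurable_itv `[0, +oo[).
rewrite setTI; congr measurable; apply/seteqP; split => z /=.
  by rewrite in_itv/= andbT subr_ge0.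
by rewrite in_itv/= andbT subr_ge0.
Qed.

(** The shift by 2 keeps all levels positive, as [zsup_geE] requires. *)
Let lvl n : R := 1 - n.+2%:R^-1.
Let lvl01 n : 0 < lvl n < 1.
Proof.
rewrite /lvl; have h0 : 0 < n.+2%:R^-1 :> R by rewrite invr_gt0 ltr0n.
have h1 : n.+2%:R^-1 < 1 :> R by rewrite invf_lt1 ?ltr0n// ltr1n.
by rewrite subr_gt0 h1 gtrBl h0.
Qed.

Let zsup_lt1 p r n : G (lvl n) p < r -> zsup p r < 1.
Proof.
move=> h; apply: (@lt_trans _ _ (lvl n)); last by have /andP[] := lvl01 n.
by rewrite ltNge zsup_geE// -ltNge.
Qed.

Let bad : set (X * Y)%type := [set z | ~~ (zsup z.1 z.2 < 1)].

Let m_bad : measurable bad.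
Proof.
have -> : bad = \bigcap_n below (lvl n).
  apply/seteqP; split => [[p r] /= h n _|[p r] /= h].
    by rewrite /below/= leNgt; apply/negP => /zsup_lt1; apply/negP.
  apply/negP => h1; pose n := Num.trunc (1 - zsup p r)^-1.
  have := h n Logic.I; rewrite /below/= -(zsup_geE p r (lvl01 n)) leNgt => /negP; apply.
  rewrite /lvl ltrBrDr addrC -ltrBrDr invf_plt ?posrE ?ltr0n ?subr_gt0//.
  by rewrite (lt_le_trans (truncnS_gt _))// ler_nat.
exact: bigcapT_measurable.
Qed.

Let m_pos : measurable_fun setT (fun z : (X * Y)%type => pos z.1 z.2).
Proof.
apply: measurable_fun_of_ge => y.
have [y0|y0] := leP y 0.
  rewrite (_ : [set _ | _] = setT)//; apply/seteqP; split => // z _ /=.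
  by apply: le_trans y0 _; have /andP[] := pos01 z.1 z.2.
have [y1|y1] := leP 1 y.
  rewrite (_ : [set _ | _] = set0)//; apply/seteqP; split => // z /= h.
  have /andP[_ h2] := pos01 z.1 z.2.
  by have := lt_le_trans h2 (le_trans y1 h); rewrite ltxx.
rewrite (_ : [set _ | _] = below y `\` bad); first exact: measurableD.
have y01 : 0 < y < 1 by rewrite y0.
apply/seteqP; split => [[p r]|[p r]] /=; rewrite /pos /below /bad/= -zsup_geE//.
  case: ifPn => // h1 h2.
  by move: h2; rewrite leNgt y0.
by move=> [h1 /negP/negPn ->].
Qed.

(* P(tail at lvl n > 0) decreases to 0 since the total tail at y is 1 - y. *)
Let pos_ae : exists N : set X, [/\ measurable N, mu0 N = 0%E &
  forall p r, ~ N p -> 0 < r -> zsup p r < 1].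
Proof.
pose N k : set X := \bigcap_n [set p | k.+1%:R^-1 <= G (lvl n) p].
have mNn k n : measurable ([set p | k.+1%:R^-1 <= G (lvl n) p] : set X).
  have := mG (lvl n) measurableT (measurable_itv `[k.+1%:R^-1, +oo[).
  rewrite setTI; congr measurable; apply/seteqP; split => z /=.
    by rewrite in_itv/= andbT.
  by rewrite in_itv/= andbT.
have mN k : measurable (N k) by exact: bigcapT_measurable.
have mU : measurable (\bigcup_k N k) by exact: bigcupT_measurable.
exists (\bigcup_k N k); split => //.
- apply/(negligibleP _ mU); apply: negligible_bigcup => k.
  apply/(negligibleP _ (mN k)).
  (* Markov's inequality at [k.+1%:R^-1] for the tail at [lvl n]. *)
  have h n : fine (mu0 (N k)) <= k.+1%:R * n.+2%:R^-1.
    rewrite -(Rintegral_indicator mu0 (mN k)).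
    have -> : n.+2%:R^-1 = \int[mu0]_p (G (lvl n) p) :> R.
      have /andP[l0 l1] := lvl01 n.
      have [_ _ _] := @thr_total _ mu0 _ t0 contA contB (lvl n) (introT andP (conj (ltW l0) l1)).
      by rewrite /total_survival -/(tail _ _) => ->; rewrite /lvl opprB addrC subrK.
    rewrite -RintegralZl//; apply: le_Rintegral => //.
    - by apply: (@bounded_integrable _ _ _ mu0 _ 1) => // p; rewrite indicE; case: (_ \in _); rewrite ?normr1 ?normr0.
    - apply: (@bounded_integrable _ _ _ mu0 _ k.+1%:R).
        exact: measurable_funM.
      move=> p; have /andP[g0 g1] := G01 (lvl n) p.
      by rewrite ger0_norm ?mulr_ge0// -[leRHS]mulr1 ler_wpM2l.
    move=> p _; rewrite indicE; have /andP[g0 g1] := G01 (lvl n) p.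
    case: (boolP (p \in N k)) => [|_] /=; last by rewrite mulr_ge0.
    rewrite inE => /(_ n Logic.I) /= hk.
    by rewrite -ler_pdivrMl ?ltr0n// mulr1.
  suff f0 : fine (mu0 (N k)) = 0.
    have : (fine (mu0 (N k)))%:E = mu0 (N k) by rewrite fineK// fin_num_measure.
    by rewrite f0.
  apply/eqP; rewrite eq_le fine_ge0// andbT.
  apply/ler_addgt0Pr => eps eps0; rewrite add0r.
  pose n := Num.trunc (k.+1%:R / eps).
  apply: le_trans (h n) _; rewrite ler_pdivrMr ?ltr0n// mulrC -ler_pdivrMr//.
  by rewrite (le_trans (ltW (truncnS_gt _)))// ler_nat.
- move=> p r Np r0; have [k hk] : exists k : nat, k.+1%:R^-1 < r.
    exists (Num.trunc r^-1).
    by rewrite invf_plt ?posrE ?ltr0n//; exact: truncnS_gt.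
  have : ~ N k p by move=> h; apply: Np; exists k.
  move=> /existsNP[n /not_implyP[_ /negP]]; rewrite -ltNge => h.
  exact: zsup_lt1 (lt_trans h hk).
Qed.

Let state z : radon R * Ico01 R := (z.1.1, Z z.1 z.2).

Let m_state : measurable_fun setT (state : (X * Y)%type -> X).
Proof.
apply: (measurable_into_states e_metric) => [j|].
  have mj : measurable_fun setT ((fun p => \int[p.1]_u e j u) : X -> R).
    apply: (@measurableT_comp _ _ _ _ _ _ ((fun q : radon R => \int[q]_u e j u) : borel (radon R) -> R)).
      by apply: continuous_borel_real; exact: continuous_radon_integral.
    exact: measurable_state_fst.
  exact: (measurableT_comp mj measurable_fst).
suff -> : (fun z : (X * Y)%type => \val (state z).2) =
    (fun z : (X * Y)%type => pos z.1 z.2) by [].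
by apply/funext => z; rewrite /state /= -valZ.
Qed.

Let state_mixin := isMeasurableFun.Build _ _ _ _ _ m_state.
Let state_pack : {mfun (X * Y)%type >-> X} := HB.pack state state_mixin.

Definition limit_measure : probability X R :=
  distribution (mu0 \x unit_prob R)%E state_pack.

Lemma limit_measure_integral (k : radon R -> R) (y : R) :
  measurable_fun setT (k : borel (radon R) -> R) -> (forall q, 0 <= k q) ->
  0 <= y < 1 ->
  (\int[limit_measure]_q (k q.1 * (y <= \val q.2)%R%:R)%:E =
   \int[mu0]_p (k p.1 * G y p)%:E)%E.
Proof.
move=> mk k0 /andP[y0 y1].
have mk1 : measurable_fun setT ((fun p => k p.1) : X -> R).
  apply: (@measurableT_comp _ _ _ _ _ _ (k : borel (radon R) -> R)) => //.
  exact: measurable_state_fst.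
have my : measurable_fun setT ((fun q => (y <= \val q.2)%R%:R) : X -> R).
  have -> : (fun q : X => (y <= \val q.2)%R%:R : R) = \1_([set q | y <= \val q.2] : set X).
    apply/funext => p; rewrite indicE; congr (nat_of_bool _)%:R.
    by apply/idP/idP; rewrite inE.
  by apply: measurable_indic; exact: measurable_pos_ge.
have mf : measurable_fun setT ((fun q => (k q.1 * (y <= \val q.2)%R%:R)%:E) : X -> \bar R).
  by apply/measurable_EFinP; exact: measurable_funM.
rewrite /limit_measure /distribution ge0_integral_pushforward//=; last first.
  by move=> q _; rewrite lee_fin mulr_ge0.
rewrite preimage_setT.
rewrite fubini_tonelli1//=; last 2 first.
- exact: (measurableT_comp mf m_state).
- by move=> q; rewrite lee_fin mulr_ge0.
have [N [mN N0 hN]] := pos_ae.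
apply: ge0_ae_eq_integral => //.
- apply: measurable_fun_fubini_tonelli_F => //.
    exact: (measurableT_comp mf m_state).
  by move=> q; rewrite lee_fin mulr_ge0.
- by apply/measurable_EFinP; exact: measurable_funM.
- by move=> p _; apply: integral_ge0 => r _; rewrite lee_fin mulr_ge0.
- by move=> p _; rewrite lee_fin mulr_ge0//; have /andP[] := G01 y p.
exists N; split => // p /= h; apply: contrapT => Np; apply: h => _.
rewrite /fubini_F /=.
pose A : set R := [set r | y <= pos p r].
have mA : measurable A.
  have mpos : measurable_fun setT (pos p) by exact: (measurableT_comp m_pos (@pair1_measurable _ _ X Y p)).
  have := mpos measurableT _ (measurable_itv `[y, +oo[).
  by rewrite setTI; congr measurable; apply/seteqP; split => r /=; rewrite in_itv/= andbT.
have PA : unit_prob R A = (G y p)%:E.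
  apply: unit_prob_below => // r /andP[r0 r1]; rewrite /A/= /pos (hN _ _ Np r0).
  (* [zsup_geE] covers positive [y]; at 0 both sides hold, as the tail is 1 and [r <= 1]. *)
  have [y00|y_neq0] := eqVneq y 0; first by rewrite y00 zsup_ge0 tail0.
  by rewrite zsup_geE// lt_neqAle eq_sym y_neq0 y0.
transitivity (\int[unit_prob R]_r ((k p.1)%:E * (\1_A r)%:E))%E.
  apply: eq_integral => r _; rewrite -EFinM; congr (_ * _)%:E.
  rewrite indicE valZ; congr (nat_of_bool _)%:R.
  by apply/idP/idP; rewrite inE.
rewrite ge0_integralZl//=; last 2 first.
- exact/measurable_EFinP.
- by rewrite lee_fin.
rewrite integral_indic// setIT.
by transitivity ((k p.1)%:E * unit_prob R A)%E; [by []|rewrite PA].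
Qed.

End limit_measure_construction.

Section limit_measure_slices.
Context (R : realType) (e : nat -> Rplus R -> R).
Hypothesis e_cc : forall n, compactly_supported_continuous (e n).
Hypothesis e_metric : metrizes (state_dist e).
Variables (mu0 : probability (borel (radon R * Ico01 R)%type) R) (t : R).
Hypothesis t0 : 0 <= t.
Hypothesis contA : forall s eps, 0 <= s <= t -> 0 < eps ->
  exists2 delta, 0 < delta & forall s', 0 <= s' <= t -> `|s - s'| < delta ->
    `|yA mu0 s t - yA mu0 s' t| < eps.
Hypothesis contB : forall s eps, 0 <= s < 1 -> 0 < eps ->
  exists2 delta, 0 < delta & forall s', 0 <= s' < 1 -> `|s - s'| < delta ->
    `|yB mu0 s t - yB mu0 s' t| < eps.

Let X := borel (radon R * Ico01 R)%type.
Let mut := limit_measure e_cc e_metric t0 contA contB.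

(** A positive function with integral 0 would make [mu0] null. Consequently [yC mu0 t < 1], and the
    first branch of [is_limit_measure] involves only levels below 1. *)
Lemma total_survival_gt0 : 0 < total_survival mu0 0 0 t.
Proof.
rewrite lt_neqAle total_survival_ge0 andbT eq_sym; apply/eqP => S0.
have ms := measurable_survival (R := R) 0 0 t.
have i0 := integrable_survival mu0 0 0 t.
have : (\int[mu0]_p `|(EFin \o survival 0 0 t) p|)%E = 0%E.
  transitivity (\int[mu0]_p (survival 0 0 t p)%:E)%E.
    by apply: eq_integral => p _ /=; rewrite ger0_norm// survival_ge0.
  have h := integrable_fin_num measurableT i0.
  by rewrite -(fineK h); congr EFin.
have mE : measurable_fun setT (EFin \o (survival 0 0 t : X -> R)).
  exact/measurable_EFinP.
move=> /(ae_eq_integral_abs mu0 measurableT mE)[N [mN N0 hN]].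
have NT : N = setT.
  apply/seteqP; split => // p _; apply: hN => /= /(_ Logic.I)/=.
  rewrite /survival valIco_ge0 mul1r => -[h].
  by have := expR_gt0 (- mass p.1 0 t); rewrite h ltxx.
by have := probability_setT mu0; rewrite -NT N0 => -[/eqP]; rewrite eq_sym oner_eq0.
Qed.

Let yC_lt1 : yC mu0 t < 1.
Proof. by rewrite yCE gtrBl total_survival_gt0. Qed.

Let slice_tail y (A : set (borel (radon R))) : measurable A -> 0 <= y < 1 ->
  slice mut y A = (\int[mu0]_p (\1_A p.1 * tail mu0 t y p)%:E)%E.
Proof.
move=> mA y01.
have mB : measurable ([set q : X | A q.1 /\ y <= \val q.2]).
  apply: measurableI; last exact: measurable_pos_ge.
  by rewrite -[X in measurable X]setTI; exact: measurable_state_fst.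
transitivity (\int[mut]_q (\1_A q.1 * (y <= \val q.2)%R%:R : R)%:E)%E.
  transitivity (mut [set q : X | A q.1 /\ y <= \val q.2]); first by [].
  rewrite -[X in mut X]setIT -integral_indic//; apply: eq_integral => q _.
  rewrite !indicE; congr EFin; rewrite -natrM mulnb; congr (nat_of_bool _)%:R.
  apply/idP/idP; rewrite inE /=; first by move=> [Aq ->]; rewrite mem_set.
  by move=> /andP[]; rewrite inE.
apply: limit_measure_integral => //.
Qed.

Lemma limit_measure_is_limit : is_limit_measure mu0 t mut.
Proof.
move=> A mA; split => y /andP[h1 h2].
  have y01 : 0 <= y < 1 by rewrite h1 (le_lt_trans h2 yC_lt1).
  rewrite (slice_tail mA y01) (slice_survival _ _ _ _ mA); apply: eq_integral => p _.
  by rewrite /tail /rank_thr /time_thr h2.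
have C0 : 0 <= yC mu0 t.
  by rewrite yCE -(total_survival1 mu0 t) subr_ge0; exact: total_survival_le.
have y01 : 0 <= y < 1 by rewrite (le_trans C0).
rewrite (slice_tail mA y01) (slice_survival _ _ _ _ mA).
move: h1; rewrite le_eqVlt => /predU1P[yE|Cy]; last first.
  by apply: eq_integral => p _; rewrite /tail /rank_thr /time_thr leNgt Cy.
(* At [yC] the tail takes the time branch, whose window starts at some [a], positive if [yA] is
   constant near its end, whereas the formula to be shown has the window from 0. But [g <= f]
   pointwise and both integrate to [1 - yC], so they have the same integral over every [A]. *)
subst y.
have hat0 : yhat mu0 (yC mu0 t) t = 0.
  have [/andP[u0 _] _ hm] := yhatP contB (introT andP (conj (lexx _) h2)).
  apply/eqP; rewrite eq_le u0 andbT; apply: hm; first by rewrite lexx ltr01.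
  by rewrite yBE -yCE.
have [_ /andP[a0 at_] _ St] := thr_total t0 contA contB y01.
set a := time_thr mu0 t (yC mu0 t) in a0 at_ St.
have r0 : rank_thr mu0 t (yC mu0 t) = 0 by rewrite /rank_thr lexx.
rewrite r0 in St; rewrite hat0 /tail r0 -/a.
pose f (p : X) := survival 0 a t p; pose g (p : X) := survival 0 0 t p.
have mf : measurable_fun setT f by exact: measurable_survival.
have mg : measurable_fun setT g by exact: measurable_survival.
have mA1 : measurable_fun setT (fun p : X => \1_A p.1 : R).
  apply: (@measurableT_comp _ _ _ _ _ _ (\1_A : borel (radon R) -> R)) => //.
  exact: measurable_state_fst.
have A01 (p : X) : 0 <= (\1_A p.1 : R) <= 1 by rewrite indicE; case: (_ \in _); rewrite ?lexx ?ler01.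
have gf (p : X) : 0 <= g p <= f p by rewrite survival_ge0 survival_le.
have f1 (p : X) : f p <= 1 by exact: survival_le1.
have iAf : mu0.-integrable setT (EFin \o (fun p => \1_A p.1 * f p)).
  apply: (@bounded_integrable _ _ _ mu0 _ 1); first exact: measurable_funM.
  move=> p; have /andP[? ?] := A01 p; have /andP[? ?] := gf p; have ? := f1 p.
  have f0 : 0 <= f p by exact: survival_ge0.
  by rewrite ger0_norm; [exact: mulr_ile1|exact: mulr_ge0].
have iAg : mu0.-integrable setT (EFin \o (fun p => \1_A p.1 * g p)).
  apply: (@bounded_integrable _ _ _ mu0 _ 1); first exact: measurable_funM.
  move=> p; have /andP[? ?] := A01 p; have /andP[? ?] := gf p; have ? := f1 p.
  have g1 : g p <= 1 by exact: survival_le1.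
  by rewrite ger0_norm; [exact: mulr_ile1|exact: mulr_ge0].
have i_f : mu0.-integrable setT (EFin \o f) by exact: integrable_survival.
have i_g : mu0.-integrable setT (EFin \o g) by exact: integrable_survival.
have E : \int[mu0]_p (\1_A p.1 * f p) = \int[mu0]_p (\1_A p.1 * g p).
  apply/eqP; rewrite -subr_eq0 eq_le; apply/andP; split; last first.
    rewrite subr_ge0; apply: le_Rintegral => // p _.
    have /andP[? ?] := A01 p; have /andP[? ?] := gf p; exact: ler_wpM2l.
  rewrite -RintegralB//.
  apply: (@le_trans _ _ (\int[mu0]_p (f p - g p))).
    apply: le_Rintegral => //.
    - exact: (integrableB measurableT iAf iAg).
    - exact: (integrableB measurableT i_f i_g).
    move=> p _; rewrite -mulrBr; have /andP[? ?] := A01 p; have /andP[? ?] := gf p.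
    by rewrite ler_piMl// subr_ge0.
  rewrite RintegralB//.
  have -> : \int[mu0]_p f p = 1 - yC mu0 t by exact: St.
  have -> : \int[mu0]_p g p = 1 - yC mu0 t by rewrite yCE opprB addrC subrK.
  by rewrite subrr.
rewrite -[LHS](fineK (integrable_fin_num measurableT iAf)).
rewrite -[RHS](fineK (integrable_fin_num measurableT iAg)).
exact: (congr1 EFin E).
Qed.

Lemma limit_measure_Rintegral (h : radon R -> R) (M y : R) : continuous h ->
  (forall q, 0 <= h q <= M) -> 0 <= y < 1 ->
  \int[mut]_q (h q.1 * (y <= \val q.2)%R%:R) =
  limit_survival mu0 h (rank_thr mu0 t y) (time_thr mu0 t y) t.
Proof.
move=> ch h0M y01; rewrite /Rintegral /limit_survival; congr fine.
apply: limit_measure_integral => //; first exact: continuous_borel_real.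
by move=> q; have /andP[] := h0M q.
Qed.

End limit_measure_slices.

(** * Continuity of cylinder functions *)

Section cylinders.
Context (R : realType) (e : nat -> Rplus R -> R).
Hypothesis e_cc : forall n, compactly_supported_continuous (e n).
Variables (k : nat) (g : 'rV[R]_k * Ico01 R -> R).
Hypothesis g_cc : compactly_supported_continuous g.

Let row (q : radon R) : 'rV[R]_k := \row_(j < k) \int[q]_u e j u.

Let continuous_row : continuous row.
Proof.
move=> q; have Fq : Filter (nbhs q) by exact: nbhs_filter.
apply/(@cvg_ballP _ _ _ _ Fq) => eps eps0.
have : \forall q' \near q, forall j : 'I_k,
    ball (\int[q]_u e j u) eps (\int[q' : radon R]_u e j u).
  apply: (@filter_forall _ _ _ _ Fq) => j.
  exact: ((@cvg_ballP _ _ _ _ Fq _ _).1 (continuous_radon_integral (e_cc j) (x := q))).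
apply: filterS => q' h; split => // i j; rewrite !mxE; exact: h.
Qed.

Lemma continuous_cylinder : continuous (cylinder e g).
Proof.
move=> p; have [cg _] := g_cc.
apply: (@continuous_comp _ _ _ (fun p : radon R * Ico01 R => (row p.1, p.2)) g p); last exact: cg.
have h1 : (fun p : radon R * Ico01 R => row p.1) @ p --> row p.1.
  apply: (@continuous_comp _ _ _ (fst : radon R * Ico01 R -> radon R) row p).
    exact: cvg_fst.
  exact: continuous_row.
have h2 : (fun p : radon R * Ico01 R => p.2) @ p --> p.2 by exact: cvg_snd.
have Fp : Filter (nbhs p) by exact: nbhs_filter.
exact: (cvg_pair h1 h2).
Qed.

Lemma continuous_cylinder_fst (z : Ico01 R) : continuous (fun q => cylinder e g (q, z)).
Proof.
move=> q; have [cg _] := g_cc.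
apply: (@continuous_comp _ _ _ (fun q : radon R => (row q, z)) g q); last exact: cg.
have Fq : Filter (nbhs q) by exact: nbhs_filter.
have h2 : (fun _ : radon R => z) @ q --> z by exact: cvg_cst.
exact: (cvg_pair (@continuous_row q) h2).
Qed.

Lemma cc_bounded : exists M, forall p, `|g p| <= M.
Proof.
have [cg [K cK K0]] := g_cc.
have : compact (g @` K).
  by apply: continuous_compact => //; exact: continuous_subspaceT.
move=> /compact_bounded[M [_ /(_ (M + 1)) HM]].
exists `|M + 1| => p; have [Kp|/K0 ->] := pselect (K p); last by rewrite normr0.
apply: le_trans (ler_norm (M + 1)); apply: HM; first by rewrite ltrDl.
by exists p.
Qed.

(** Compactness gives one [delta] for all first points in [K], the second point being free to leave
    [K]; by symmetry only pairs outside [K] remain, and there both values vanish. *)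
Lemma cc_uniform eta : 0 < eta -> exists2 delta, 0 < delta &
  forall v (z z' : Ico01 R), `|\val z - \val z'| < delta ->
    `|g (v, z) - g (v, z')| <= eta.
Proof.
move=> eta0; have [cg [K cK K0]] := g_cc.
pose P (delta : R) (p : 'rV[R]_k * Ico01 R) := forall z' : Ico01 R,
  `|\val p.2 - \val z'| < delta -> `|g p - g (p.1, z')| <= eta.
have : \forall delta \near (0:R)^'+, K `<=` P delta.
  move/compact_near_coveringP : cK; apply => p Kp.
  have eta2 : 0 < eta / 2 by rewrite divr_gt0.
  have := cg p => /cvgrPdist_lt/(_ _ eta2)/nbhs_ballP[r /= r0 hr].
  have r2 : 0 < r / 2 by rewrite divr_gt0.
  near=> p' delta => z' hz'.
  have pp' : ball p (r / 2) p' by near: p'; exact: nbhsx_ballx.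
  have dr : delta < r / 2 by near: delta; exact: nbhs_right_lt.
  have b1 : ball p r p' by apply: le_ball pp'; lra.
  have b2 : ball p r (p'.1, z').
    split; first by case: b1.
    case: pp' => _ /= pp2.
    have pp2' : `|\val p.2 - \val p'.2| < r / 2 by exact: pp2.
    change (`|\val p.2 - \val z'| < r).
    have -> : \val p.2 - \val z' = (\val p.2 - \val p'.2) + (\val p'.2 - \val z') by ring.
    apply: le_lt_trans (ler_normD _ _) _.
    by rewrite [ltRHS](splitr r) ltrD// (lt_trans hz' dr).
  have := hr _ b1; have := hr _ b2; rewrite /= !ltr_norml ler_norml; lra.
move=> HP; near (0:R)^'+ => delta.
have HK : K `<=` P delta by near: delta.
exists delta => // v z z' zz'.
have [Kz|nKz] := pselect (K (v, z)); first exact: HK.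
have [Kz'|nKz'] := pselect (K (v, z')).
  by rewrite distrC; apply: (HK _ Kz'); rewrite distrC.
by rewrite !K0// subrr normr0 ltW.
Unshelve. all: by end_near.
Qed.

End cylinders.

(** * Step approximation of cylinder functions *)

Lemma Rintegral_sum_ord d (X : measurableType d) (R : realType)
    (m : {measure set X -> \bar R}) (n : nat) (phi : 'I_n -> X -> R) :
  (forall j, m.-integrable setT (EFin \o phi j)) ->
  m.-integrable setT (EFin \o (fun p => \sum_(j < n) phi j p)) /\
  \int[m]_p (\sum_(j < n) phi j p) = \sum_(j < n) \int[m]_p (phi j p).
Proof.
elim: n phi => [|n IH] phi iphi.
  split; last by rewrite big_ord0 (@eq_Rintegral _ _ _ m setT (cst 0));
    [rewrite Rintegral_cst// mul0r|move=> p _; rewrite big_ord0].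
  apply: (eq_integrable measurableT (cst 0%E)); last exact: integrable0.
  by move=> p _ /=; rewrite big_ord0.
have [i1 e1] := IH (fun j => phi (widen_ord (leqnSn n) j)) (fun j => iphi _).
have h2 := integrableD measurableT i1 (iphi ord_max).
split.
  by apply: eq_integrable h2 => // p _; rewrite /= big_ord_recr/= EFinD.
rewrite big_ord_recr/= -e1 -RintegralD//.
by apply: eq_Rintegral => p _; rewrite big_ord_recr.
Qed.

Section step_approximation.
Context (R : realType) (F : radon R * Ico01 R -> R) (M eta : R) (K : nat).
Hypothesis FM : forall p, `|F p| <= M.
Hypothesis F_uniform : forall q (z z' : Ico01 R),
  `|\val z - \val z'| <= K.+1%:R^-1 -> `|F (q, z) - F (q, z')| <= eta.

Definition level (j : nat) : R := j%:R / K.+1%:R.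

Definition level_point (j : nat) : Ico01 R := insubd (point : Ico01 R) (level j).

(** [F] with its position frozen; the shift by [M] makes it nonnegative, as the convergence of
    averages is stated for weights with [0 <= h]. *)
Definition profile (j : nat) (q : radon R) : R := F (q, level_point j) + M.

Let K0 : 0 < K.+1%:R :> R. Proof. by rewrite ltr0n. Qed.

Lemma level01 j : (j <= K)%N -> 0 <= level j < 1.
Proof. by move=> jK; rewrite /level divr_ge0//= ltr_pdivrMr// mul1r ltr_nat ltnS. Qed.

Lemma profile_bound j q : 0 <= profile j q <= M + M.
Proof.
by have := FM (q, level_point j); rewrite ler_norml /profile => /andP[? ?]; lra.
Qed.

(** The indicator of a cell is written as a difference of two tails, the functions of the position
    whose averages are controlled. *)
Let step (p : radon R * Ico01 R) : R := \sum_(j < K.+1) (profile j p.1 * (level j <= \val p.2)%R%:R -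
  profile j p.1 * (level j.+1 <= \val p.2)%R%:R).

Lemma step_dist p : `|F p - (step p - M)| <= eta.
Proof.
have z0 := valIco_ge0 p.2; have z1 := valIco_lt1 p.2.
set z := \val p.2 in z0 z1.
pose n := Num.trunc (z * K.+1%:R).
have n1 : n%:R <= z * K.+1%:R by rewrite truncn_le mulr_ge0// ltW.
have n2 : z * K.+1%:R < n.+1%:R by exact: truncnS_gt.
have nK : (n < K.+1)%N.
  by rewrite -(ltr_nat R) (le_lt_trans n1)// -[ltRHS]mul1r ltr_pM2r.
have lev j : (level j <= z) = (j <= n)%N.
  rewrite /level ler_pdivrMr//; apply/idP/idP => h.
    by rewrite -ltnS -(ltr_nat R); exact: le_lt_trans n2.
  by apply: le_trans n1; rewrite ler_nat.
have -> : step p = profile n p.1.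
  rewrite /step (bigD1 (Ordinal nK))//= -/z !lev leqnn ltnn mulr1 mulr0 subr0.
  rewrite big1 ?addr0// => j jn; rewrite !lev; have [jn'|nj|jE] := ltngtP j n.
  - by rewrite subrr.
  - by rewrite subrr.
  - by move: jn; rewrite -val_eqE/= jE eqxx.
have lp : \val (level_point n) = level n.
  by rewrite /level_point insubdK// inE/= in_itv/=; exact: level01.
have -> : F p = F (p.1, p.2) by case: (p).
rewrite /profile addrK; apply: F_uniform; rewrite lp /level -/z ger0_norm.
  rewrite lerBlDr -[X in X + _]mul1r -mulrDl addrC natr1.
  by rewrite ler_pdivlMr// ltW.
by rewrite subr_ge0 ler_pdivrMr.
Qed.

Lemma step_empirical N (z : 'I_N -> radon R * Ico01 R) : (0 < N)%N ->
  `|N%:R^-1 * \sum_(i < N) F (z i) - (\sum_(j < K.+1)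
    (N%:R^-1 * \sum_(i < N) profile j (z i).1 * (level j <= \val (z i).2)%R%:R -
     N%:R^-1 * \sum_(i < N) profile j (z i).1 * (level j.+1 <= \val (z i).2)%R%:R)
    - M)| <= eta.
Proof.
move=> N0; have N0' : 0 < N%:R :> R by rewrite ltr0n.
have -> : N%:R^-1 * \sum_(i < N) F (z i) - (\sum_(j < K.+1)
    (N%:R^-1 * \sum_(i < N) profile j (z i).1 * (level j <= \val (z i).2)%R%:R -
     N%:R^-1 * \sum_(i < N) profile j (z i).1 * (level j.+1 <= \val (z i).2)%R%:R)
    - M) = N%:R^-1 * \sum_(i < N) (F (z i) - (step (z i) - M)).
  rewrite [in RHS]sumrB [in RHS]mulrBr; congr (_ - _).
  rewrite [in RHS]sumrB [in RHS]mulrBr sumr_const card_ord -(mulr_natl M N).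
  rewrite mulKf ?gt_eqF//; congr (_ - _).
  rewrite /step exchange_big/= mulr_sumr; apply: eq_bigr => j _.
  by rewrite -mulrBr -sumrB.
rewrite normrM ger0_norm ?invr_ge0// ler_pdivrMl//.
apply: le_trans (ler_norm_sum _ _ _) _.
apply: (@le_trans _ _ (\sum_(i < N) eta)); first by apply: ler_sum => i _; exact: step_dist.
by rewrite sumr_const card_ord mulr_natl.
Qed.

Lemma step_integral (m : probability (borel (radon R * Ico01 R)%type) R) :
  continuous F -> (forall j, continuous (profile j)) ->
  `|\int[m]_p F p - (\sum_(j < K.+1)
    (\int[m]_p (profile j p.1 * (level j <= \val p.2)%R%:R) -
     \int[m]_p (profile j p.1 * (level j.+1 <= \val p.2)%R%:R)) - M)| <= eta.
Proof.
move=> cF cp; pose X := borel (radon R * Ico01 R)%type.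
have mF := continuous_borel_real cF.
have iF : m.-integrable setT (EFin \o (F : X -> R)).
  exact: (@bounded_integrable _ _ _ m _ M).
have ip (j : nat) y : m.-integrable setT
    (EFin \o (fun p : X => profile j p.1 * (y <= \val p.2)%R%:R)).
  apply: (@bounded_integrable _ _ _ m _ (M + M)).
    apply: measurable_funM.
      apply: (@measurableT_comp _ _ _ _ _ _ (profile j : borel (radon R) -> R)).
        exact: continuous_borel_real.
      exact: measurable_state_fst.
    have -> : (fun q : X => (y <= \val q.2)%R%:R : R) = \1_([set q | y <= \val q.2] : set X).
      apply/funext => p; rewrite indicE; congr (nat_of_bool _)%:R.
      by apply/idP/idP; rewrite inE.
    by apply: measurable_indic; exact: measurable_pos_ge.
  move=> p; have /andP[h0 h1] := profile_bound j p.1.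
  case: (y <= _); first by rewrite mulr1 ger0_norm.
  by rewrite mulr0 normr0 (le_trans h0).
have id_ (j : 'I_K.+1) := integrableB measurableT (ip j (level j)) (ip j (level j.+1)).
have [is_ es] := Rintegral_sum_ord id_.
have iM : m.-integrable setT (EFin \o (cst M : X -> R)) by exact: finite_measure_integrable_cst.
have isM := integrableB measurableT is_ iM.
have eqs : \int[m]_p (step p - M) = \sum_(j < K.+1)
    (\int[m]_p (profile j p.1 * (level j <= \val p.2)%R%:R) -
     \int[m]_p (profile j p.1 * (level j.+1 <= \val p.2)%R%:R)) - M.
  rewrite RintegralB//; congr (_ - _).
    rewrite -[LHS]/(\int[m]_p (\sum_(j < K.+1) _)) es; apply: eq_bigr => j _.
    by rewrite RintegralB.
  rewrite Rintegral_cst//; transitivity (M * fine (1%E : \bar R)); last by rewrite mulr1.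
  by congr (_ * fine _); exact: probability_setT.
rewrite -eqs -RintegralB//.
apply: le_trans (le_normr_Rintegral _ (integrableB measurableT iF isM)) _ => //.
apply: (@le_trans _ _ (\int[m]_p eta)).
  apply: le_Rintegral => //.
  - exact: (integrable_norm (integrableB measurableT iF isM)).
  - exact: finite_measure_integrable_cst.
  by move=> p _; exact: step_dist.
rewrite Rintegral_cst//.
have -> : fine (m setT) = 1 by rewrite (_ : m setT = 1%E)//; exact: probability_setT.
by rewrite mulr1.
Qed.

End step_approximation.

(** * Uniform convergence in time at a fixed sample point *)

Lemma sup_cvg0_near (R : realType) (T : R) (g : nat -> R -> \bar R) : 0 <= T ->
  (forall N t, (0 <= g N t)%E) ->
  (forall eps : R, 0 < eps -> \forall N \near \oo, forall t, 0 <= t <= T ->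
    (g N t <= eps%:E)%E) ->
  sup_cvg0 T g.
Proof.
move=> T0 g0 hg; rewrite /sup_cvg0.
pose s N := ereal_sup [set g N t | t in [set t | 0 <= t <= T]].
have s_ge0 N : (0 <= s N)%E.
  apply: le_trans (g0 N 0) _; apply: ereal_sup_ubound; exists 0 => //=.
  by rewrite lexx T0.
have s_le (eps : R) : 0 < eps -> \forall N \near \oo, (s N <= eps%:E)%E.
  move=> /hg; apply: filterS => N h.
  by apply: ge_ereal_sup => _ [t /= /h ht <-].
have s_fin N (r : R) : (s N <= r%:E)%E -> s N \is a fin_num.
  by move=> h; rewrite ge0_fin_numE//; apply: le_lt_trans h _; exact: ltry.
apply/fine_cvgP; split.
  by apply: filterS (s_le 1 ltr01) => N; exact: s_fin.
apply/cvgrPdist_le => eps eps0; apply: filterS (s_le eps eps0) => N h.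
change (`|0 - fine (s N)| <= eps).
rewrite sub0r normrN ger0_norm ?fine_ge0//.
by rewrite -lee_fin (fineK (s_fin _ _ h)).
Qed.

Lemma prod_norm_fst (R : realType) (a b c : R) : `|(a, c) - (b, c)| = `|a - b|.
Proof. by rewrite prod_normE/= subrr normr0 max_l. Qed.

Lemma uniformly_continuous_fst (R : realType) (D : set (R * R)) (g : R * R -> R) :
  uniformly_continuous_on D g -> forall t s eps, D (s, t) -> 0 < eps ->
  exists2 delta, 0 < delta & forall s', D (s', t) -> `|s - s'| < delta ->
    `|g (s, t) - g (s', t)| < eps.
Proof.
move=> ug t s eps Ds eps0; have [delta d0 hd] := ug _ eps0.
by exists delta => // s' Ds' ss'; apply: hd => //; rewrite prod_norm_fst.
Qed.

Section positions.
Context (R : realType) (d : measure_display) (Om : measurableType d).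
Variables (rho : forall N : nat, 'I_N -> radon R)
  (nu : forall N : nat, 'I_N -> R.-ker Om ~> borel (Rplus R))
  (tau : forall N : nat, 'I_N -> nat -> Om -> Rplus R)
  (x : forall N : nat, {perm 'I_N}).
Arguments rho : clear implicits.
Arguments nu : clear implicits.
Arguments tau : clear implicits.
Arguments x : clear implicits.
Variables (T : R) (mu0 : probability (borel (radon R * Ico01 R)%type) R).
Hypothesis contA : forall t, 0 <= t <= T -> forall s eps, 0 <= s <= t -> 0 < eps ->
  exists2 delta, 0 < delta & forall s', 0 <= s' <= t -> `|s - s'| < delta ->
    `|yA mu0 s t - yA mu0 s' t| < eps.
Hypothesis contB : forall t, 0 <= t <= T -> forall s eps, 0 <= s < 1 -> 0 < eps ->
  exists2 delta, 0 < delta & forall s', 0 <= s' < 1 -> `|s - s'| < delta ->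
    `|yB mu0 s t - yB mu0 s' t| < eps.

Variable w : Om.
Hypothesis simple_w : forall N,
  simple_points (fun i j => tau N i j w) (fun i => nu N i w).
Hypothesis fin_w : forall N (i : 'I_N), (nu N i w [set u | \val u <= T]%R < +oo)%E.

Definition uniform_at (h : radon R -> R) : Prop :=
  forall eps, 0 < eps -> \forall N \near \oo, forall y a b,
    0 <= y <= 1 -> 0 <= a <= T -> 0 <= b <= T ->
    `|empirical_survival rho nu x h N y a b w - limit_survival mu0 h y a b| <= eps.

Definition positions_above N (h : radon R -> R) (y t : R) : R :=
  N%:R^-1 * \sum_(i < N) h (rho N i) *
    (y <= \val (position (x N) (fun i j => tau N i j w) i t))%R%:R.

Lemma positions_uniform (h : radon R -> R) (M y : R) :
  (forall q, 0 <= h q <= M) -> 0 <= y < 1 ->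
  uniform_at (fun=> 1) -> uniform_at h ->
  forall eps, 0 < eps -> \forall N \near \oo, forall t, 0 <= t <= T ->
    `|positions_above N h y t -
      limit_survival mu0 h (rank_thr mu0 t y) (time_thr mu0 t y) t| <= eps.
Proof.
move=> h0M y01 U1 Uh eps eps0.
have M0 : 0 <= M by have /andP[] := h0M (radon0 R); exact: le_trans.
(* Comparing positions with survivors costs at most [M * (2 * e)], and the survivor average itself
   is within [e] of its limit. *)
pose e := eps / (2 * M + 1).
have e0 : 0 < e by rewrite divr_gt0//; lra.
have epsE : eps = (2 * M + 1) * e by rewrite /e mulrC divfK// gt_eqF//; lra.
near=> N => t /andP[t0 tT].
have N0 : (0 < N)%N by near: N; exact: nbhs_infty_gt.
have Ne : N%:R^-1 <= e.
  rewrite invf_ple ?posrE ?ltr0n//; near: N; exact: nbhs_infty_ger.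
have tT' : 0 <= t <= T by rewrite t0.
have [u01 /andP[a0 at_] ua St] := thr_total t0 (contA tT') (contB tT') y01.
set u := rank_thr mu0 t y in u01 ua St *; set a := time_thr mu0 t y in a0 at_ ua St *.
have aT : 0 <= a <= T by rewrite a0 (le_trans at_).
have H1 : `|empirical_survival rho nu x (fun=> 1) N u a t w -
    limit_survival mu0 (fun=> 1) u a t| <= e.
  have : forall y a b, 0 <= y <= 1 -> 0 <= a <= T -> 0 <= b <= T ->
      `|empirical_survival rho nu x (fun=> 1) N y a b w -
        limit_survival mu0 (fun=> 1) y a b| <= e by near: N; exact: U1.
  by apply.
have Hh : `|empirical_survival rho nu x h N u a t w -
    limit_survival mu0 h u a t| <= e.
  have : forall y a b, 0 <= y <= 1 -> 0 <= a <= T -> 0 <= b <= T ->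
      `|empirical_survival rho nu x h N y a b w -
        limit_survival mu0 h y a b| <= e by near: N; exact: Uh.
  by apply.
have L1 : limit_survival mu0 (fun=> 1) u a t = 1 - y.
  rewrite -St /limit_survival /total_survival; apply: eq_Rintegral => p _.
  by rewrite mul1r.
have fin_t i : (nu N i w [set u | \val u <= t]%R < +oo)%E.
  apply: le_lt_trans (fin_w i); apply: le_measure; rewrite ?inE.
  - exact: measurable_Rplus_le.
  - exact: measurable_Rplus_le.
  - by move=> v /= h'; exact: le_trans tT.
have := position_threshold (x N) (simple_w N) fin_t y ua (fun i => h0M (rho N i)) N0.
rewrite -/(positions_above N h y t).
have surv (h' : radon R -> R) : N%:R^-1 * \sum_(i < N) h' (rho N i) *
    ((u <= \val (initial_position (x N) i : Ico01 R)) &&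
     `[< nu N i w [set v | (a < \val v <= t)%R] = 0%E >])%:R =
    empirical_survival rho nu x h' N u a t w.
  rewrite /empirical_survival; congr (_ * _); apply: eq_bigr => i _; congr (_ * _).
  rewrite -mulnb natrM; congr (_ * (nat_of_bool _)%:R).
rewrite surv.
have -> : N%:R^-1 * \sum_(i < N)
    ((u <= \val (initial_position (x N) i : Ico01 R)) &&
     `[< nu N i w [set v | (a < \val v <= t)%R] = 0%E >])%:R =
    empirical_survival rho nu x (fun=> 1) N u a t w.
  by rewrite -surv; congr (_ * _); apply: eq_bigr => i _; rewrite mul1r.
move=> H; rewrite L1 distrC in H1.
have H2 : M * (`|1 - y - empirical_survival rho nu x (fun=> 1) N u a t w| + N%:R^-1)
    <= M * (2 * e) by apply: ler_wpM2l => //; lra.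
have H3 := le_trans H H2; rewrite epsE.
move: H3 Hh; rewrite !ler_norml => /andP[? ?] /andP[? ?].
apply/andP; split; lra.
Unshelve. all: by end_near.
Qed.

Lemma state_average_uniform (mu : R -> probability (borel (radon R * Ico01 R)%type) R)
    (F : radon R * Ico01 R -> R) (M eta : R) (K : nat) :
  (forall (t : R) (h : radon R -> R) (B y : R), 0 <= t <= T -> continuous h -> (forall q, 0 <= h q <= B) ->
    0 <= y < 1 ->
    \int[mu t]_q (h q.1 * (y <= \val q.2)%R%:R) =
    limit_survival mu0 h (rank_thr mu0 t y) (time_thr mu0 t y) t) ->
  (forall p, `|F p| <= M) ->
  (forall q (z z' : Ico01 R), `|\val z - \val z'| <= K.+1%:R^-1 ->
    `|F (q, z) - F (q, z')| <= eta) ->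
  continuous F -> (forall z, continuous (fun q => F (q, z))) ->
  uniform_at (fun=> 1) -> (forall j, uniform_at (profile F M K j)) -> 0 < eta ->
  \forall N \near \oo, forall t, 0 <= t <= T ->
    `|N%:R^-1 * \sum_(i < N) F (rho N i, position (x N) (fun i j => tau N i j w) i t)
      - \int[mu t]_p F p| <= 3 * eta.
Proof.
move=> hmu FM F_uniform cF cF1 U1 Uh eta0.
have cp j : continuous (profile F M K j).
  move=> q; apply: (@continuousD _ R^o _ (fun q => F (q, level_point R K j)) (cst M)).
    exact: cF1.
  exact: cst_continuous.
pose I t j y := \int[mu t]_p (profile F M K j p.1 * (y <= \val p.2)%R%:R).
have K0 : 0 < K.+1%:R :> R by rewrite ltr0n.
(* Each of the [K.+1] terms is a difference of two tails, so these errors add up to [eta]; the two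
   step approximations account for the remaining [2 * eta]. *)
pose eps := eta / (2 * K.+1%:R).
have eps0 : 0 < eps by rewrite divr_gt0// mulr_gt0.
have close (j k : nat) : (k <= K.+1)%N -> \forall N \near \oo, forall t, 0 <= t <= T ->
    `|positions_above N (profile F M K j) (level R K k) t - I t j (level R K k)| <= eps.
  (* The level of index [K.+1] is 1, which no position reaches, so both terms vanish;
     [positions_uniform] covers the levels below 1. *)
  rewrite leq_eqVlt => /predU1P[->|].
    have l1 : level R K K.+1 = 1 by rewrite /level divff// gt_eqF.
    apply: nearW => N t tT; rewrite /positions_above /I l1 big1 ?mulr0 => [|i _]; last first.
      by rewrite leNgt valIco_lt1 mulr0.
    rewrite (@eq_Rintegral _ _ _ (mu t) setT (cst 0)) => [|p _]; last first.
      by rewrite leNgt valIco_lt1 mulr0.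
    by rewrite Rintegral_cst// mul0r subrr normr0 ltW.
  rewrite ltnS => kK; have y01 := level01 R kK.
  have PU := positions_uniform (profile_bound K FM j) y01 U1 (Uh j) eps0.
  apply: filterS PU => N H t tT.
  rewrite /I (hmu _ _ _ _ tT (cp j) (profile_bound K FM j) y01); exact: H.
near=> N => t tT.
have N0 : (0 < N)%N by near: N; exact: nbhs_infty_gt.
have H1 : forall (j : 'I_K.+1) t, 0 <= t <= T ->
    `|positions_above N (profile F M K j) (level R K j) t - I t j (level R K j)| <= eps.
  near: N; apply: filter_forall => j; apply: close; exact: ltnW.
have H2 : forall (j : 'I_K.+1) t, 0 <= t <= T ->
    `|positions_above N (profile F M K j) (level R K j.+1) t - I t j (level R K j.+1)| <= eps.
  near: N; apply: filter_forall => j; exact: close.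
have := @step_empirical R F M eta K F_uniform N (fun i : 'I_N =>
  (rho N i, position (x N) (fun i j => tau N i j w) i t)) N0.
have := @step_integral R F M eta K FM F_uniform (mu t) cF cp.
set A := N%:R^-1 * _; set B := \int[mu t]_p F p.
set SI := \sum_(j < K.+1) _; set SE := \sum_(j < K.+1) _ => hI hE.
have hS : `|SE - SI| <= eta.
  rewrite /SE /SI -sumrB; apply: le_trans (ler_norm_sum _ _ _) _.
  apply: (@le_trans _ _ (\sum_(j < K.+1) 2 * eps)); last first.
    rewrite sumr_const card_ord -(mulr_natl _ K.+1) /eps.
    by rewrite le_eqVlt; apply/orP; left; apply/eqP; field; rewrite gt_eqF.
  apply: ler_sum => j _.
  have := H1 j t tT; have := H2 j t tT; rewrite /positions_above /I.
  by rewrite !ler_norml => /andP[? ?] /andP[? ?]; apply/andP; split; lra.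
move: hI hE hS; rewrite !ler_norml => /andP[? ?] /andP[? ?] /andP[? ?].
by apply/andP; split; lra.
Unshelve. all: by end_near.
Qed.

End positions.

(** * Convergence *)

(** Points are positive and increasing, so the first one is at most [t] exactly when some point lies
    in []0, t]]. *)
Lemma jumped_fractionE (R : realType) (d : measure_display) (Om : measurableType d)
    (rho : forall N : nat, 'I_N -> radon R)
    (nu : forall N : nat, 'I_N -> R.-ker Om ~> borel (Rplus R))
    (x : forall N : nat, {perm 'I_N}) (N : nat) (tau : 'I_N -> nat -> Rplus R)
    (w : Om) (t : R) : (0 < N)%N ->
  simple_points tau (fun i => nu N i w) ->
  jumped_fraction tau t =
  1 - empirical_survival rho nu x (fun=> 1) N 0 0 t w.
Proof.
move=> N0 simple; have [_ tpos _ _] := simple.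
have N0' : N%:R != 0 :> R by rewrite pnatr_eq0 -lt0n.
have e1 : 1 = N%:R^-1 * N%:R :> R by rewrite mulVf.
rewrite /jumped_fraction /empirical_survival mulrC [X in X - _]e1 -mulrBr.
have eN : N%:R = \sum_(i < N) 1 :> R by rewrite sumr_const card_ord.
congr (_ * _); rewrite [X in X - _]eN -sumrB natr_sum.
apply: eq_bigr => i _; rewrite valIco_ge0 !mul1r.
have -> : (w \in no_jump nu i 0 t) = ~~ (\val (tau i 0%N) <= t).
  apply/idP/negP.
    rewrite inE => /(jump_in simple) h ti; apply: (h 0%N); by rewrite tpos.
  move=> h; rewrite inE; apply/(jump_in simple) => j /andP[_ tj]; apply: h.
  by apply: le_trans tj; exact: (tau_homo simple).
by case: (_ <= t) => /=; rewrite ?subr0 ?subrr.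
Qed.

Lemma weak_dist_ge0 (R : realType) (f : nat -> radon R * Ico01 R -> R) m1 m2 :
  (0 <= weak_dist f m1 m2)%E.
Proof.
apply: nneseries_ge0 => n _ _; rewrite lee_fin mulr_ge0//.
Qed.

Theorem theorem4p1 (R : realType) (d : measure_display) (Om : measurableType d)
    (P : probability Om R)
    (rho : forall N : nat, 'I_N -> radon R)
    (nu : forall N : nat, 'I_N -> R.-ker Om ~> borel (Rplus R))
    (tau : forall N : nat, 'I_N -> nat -> Om -> Rplus R)
    (x : forall N : nat, {perm 'I_N})
    (rho_continuous : forall N (i : 'I_N) (u : Rplus R), rho N i [set u] = 0%E)
    (nu_poisson : forall N (i : 'I_N),
      poisson_random_measure P (nu N i) (rho N i))
    (nu_independent : forall N : nat,
      independent_systems P (fun i => sigma_random_measure (nu N i)))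
    (tau_points : forall N : nat, {ae P, forall w,
      simple_points (fun i j => tau N i j w) (fun i => nu N i w)})
    (T : R) (T_gt0 : 0 < T) :
  let I := [set r : R -> R | exists (N : nat) (i : 'I_N),
                               r = (fun t => mass (rho N i) 0 t)] in
  (* (1) *)
  (forall lam : R -> probability (borel (Rplus R)) R,
    (forall t, 0 <= t <= T ->
      weak_cvg (fun N => empirical (fun i => massRp (rho N i) 0 t)) (lam t)) ->
    uniformly_equicontinuous T I ->
    let y_C t := 1 - \int[lam t]_s expR (- \val s) in
    {ae P, forall w, sup_cvg0 T (fun N t =>
      (`|jumped_fraction (fun i j => tau N i j w) t - y_C t|)%:E)})
  /\
  (* (2) *)
  (forall (mu0 : probability (borel (radon R * Ico01 R)%type) R)
      (e : nat -> Rplus R -> R)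
      (fk : forall k : nat, nat -> 'rV[R]_k * Ico01 R -> R)
      (f : nat -> radon R * Ico01 R -> R),
    weak_metric_data e fk f ->
    uniformly_equicontinuous T I ->
    let mu0N N := empirical (fun i => (rho N i, initial_position (x N) i)) in
    weak_cvg mu0N mu0 ->
    let Lam := slice mu0 0 in
    (forall s t, 0 <= s <= t ->
      weak_cvg (fun N => mass_law (slice (mu0N N) 0) s t) (mass_law Lam s t)) ->
    uniformly_equicontinuous T
      [set r | exists2 q : radon R,
                 measure_support Lam q & r = (fun t => mass q 0 t)] ->
    uniformly_continuous_on [set p | 0 <= p.1 <= p.2 /\ p.2 <= T]
      (fun p => yA mu0 (p.2 - p.1) p.2) ->
    uniformly_continuous_on [set p | 0 <= p.1 < 1 /\ 0 <= p.2 <= T]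
      (fun p => yB mu0 p.1 p.2) ->
    exists mu : R -> probability (borel (radon R * Ico01 R)%type) R,
      (forall t, 0 <= t <= T -> is_limit_measure mu0 t (mu t)) /\
      {ae P, forall w, sup_cvg0 T (fun N t =>
        weak_dist f
          (empirical (fun i =>
            (rho N i, position (x N) (fun i j => tau N i j w) i t)))
          (mu t))}).
Proof.
move=> I.
have smallI : uniformly_equicontinuous T I ->
    forall eps, 0 < eps -> exists2 delta, 0 < delta &
    forall N (i : 'I_N), small_mass T delta eps (rho N i).
  move=> hI eps eps0.
  have IE : I = [set r | exists2 q, (exists N (i : 'I_N), q = rho N i) &
                         r = (fun t => mass q 0 t)].
    apply/seteqP; split => r /=.
      by move=> [N [i ->]]; exists (rho N i) => //; exists N, i.
    by move=> [_ [N [i ->]] ->]; exists N, i.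
  rewrite IE in hI; have [delta d0 hd] := equicontinuous_small_mass hI eps0.
  by exists delta => // N i; apply: hd; exists N, i.
have simple_ae : {ae P, forall w, forall N,
    simple_points (fun i j => tau N i j w) (fun i => nu N i w)}.
  by apply/ae_foralln => N; exact: tau_points.
split.
- move=> lam lam_cvg hI y_C.
  have one01 (q : radon R) : 0 <= (1 : R) <= 1 by rewrite ler01 lexx.
  (* [lam b] describes the masses of []0, b]] only, so [L] ignores its first two arguments, which
     [c := false] freezes at 0. *)
  pose L (y a b : R) := \int[lam b]_s expR (- \val s).
  have cL (y a b : R) : 0 <= y <= 1 -> 0 <= a <= T -> 0 <= b <= T ->
      (fun N => expected_survival rho x (fun=> 1) N 0 0 b) @ \oo --> L 0 0 b.
    move=> _ _ bT.
    pose g (s : Rplus R) := expR (- \val s).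
    have cg : continuous g.
      move=> s; apply: (@continuous_comp _ _ _ (\val : Rplus R -> R)
        (fun r => expR (- r)) s); first exact: continuous_valRp.
      apply: continuous_comp; first exact: opp_continuous.
      exact: continuous_expR.
    have g1 s : `|g s| <= 1.
      by rewrite ger0_norm ?expR_ge0// -expR0 ler_expR oppr_le0 valRp_ge0.
    have mg := continuous_borel_real cg.
    have -> : (fun N => expected_survival rho x (fun=> 1) N 0 0 b) =
        (fun N => N%:R^-1 * \sum_(i < N) g (massRp (rho N i) 0 b)).
      apply/funext => N; rewrite /expected_survival; congr (_ * _).
      by apply: eq_bigr => i _; rewrite /survival /= valIco_ge0 !mul1r.
    have := lam_cvg b bT g cg (ex_intro _ 1 g1).
    under eq_fun do rewrite (empirical_integral _ mg).
    rewrite -[X in _ --> X]fineK; last first.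
      by apply: integrable_fin_num => //; exact: (bounded_integrable (lam b) mg g1).
    by move=> /fine_cvg.
  have c1 : continuous (fun _ : radon R => 1 : R) by exact: cst_continuous.
  have := empirical_survival_uniform nu_poisson nu_independent T_gt0 (smallI hI)
    one01 (c := false) (L := L) c1 cL.
  move=> U; apply: filterS2 simple_ae U => w simple_w Uw.
  apply: sup_cvg0_near => //; first exact: ltW.
  move=> eps eps0; near=> N => t tT; rewrite lee_fin.
  have N0 : (0 < N)%N by near: N; exact: nbhs_infty_gt.
  rewrite (jumped_fractionE rho x t N0 (simple_w N)) /y_C.
  have H : forall y a b : R, 0 <= y <= 1 -> 0 <= a <= T -> 0 <= b <= T ->
    `|empirical_survival rho nu x (fun=> 1) N 0 0 b w - L 0 0 b| <= eps.
    by near: N; exact: (Uw _ eps0).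
  have := H 0 0 t _ _ tT; rewrite !lexx ler01 ltW// => /(_ isT isT).
  rewrite /L distrC; congr (_ <= _); congr (`|_|); ring.
- move=> mu0 e fk f wmd hI mu0N mu0N_cvg Lam _ hJ hA hB.
  have [e_cc e_metric fk_cc _ f_enum] := wmd.
  have contA t : 0 <= t <= T -> forall s eps, 0 <= s <= t -> 0 < eps ->
      exists2 delta, 0 < delta & forall s', 0 <= s' <= t -> `|s - s'| < delta ->
      `|yA mu0 s t - yA mu0 s' t| < eps.
    move=> /andP[t0 tT] s eps /andP[s0 st] eps0.
    (* [hA] is stated in the variable [t - s]; the reflection preserves distances. *)
    have Ds : 0 <= t - s <= t /\ t <= T by rewrite subr_ge0 st gerBl s0.
    have [delta d0 hd] := uniformly_continuous_fst hA (s := t - s) (t := t) Ds eps0.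
    exists delta => // s' /andP[s'0 s't] ss'.
    have Ds' : 0 <= t - s' <= t /\ t <= T by rewrite subr_ge0 s't gerBl s'0.
    have := hd (t - s') Ds'; rewrite /= !subKr; apply.
    by rewrite opprB addrC addrA subrK distrC.
  have contB t : 0 <= t <= T -> forall s eps, 0 <= s < 1 -> 0 < eps ->
      exists2 delta, 0 < delta & forall s', 0 <= s' < 1 -> `|s - s'| < delta ->
      `|yB mu0 s t - yB mu0 s' t| < eps.
    move=> tT s eps s01 eps0.
    have [delta d0 hd] := uniformly_continuous_fst hB (s := s) (t := t) (conj s01 tT) eps0.
    by exists delta => // s' s'01; exact: hd.
  have smallJ eps : 0 < eps -> exists2 delta, 0 < delta &
      {ae mu0, forall p, small_mass T delta eps p.1}.
    move=> eps0; have [delta d0 hd] := equicontinuous_small_mass hJ eps0.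
    exists delta => //.
    have [Z [mZ Z0 hZ]] := measure_support_ae mu0 e_cc e_metric.
    by exists Z; split => // p hp; apply: hZ => hs; apply: hp; exact: hd.
  have /choice[mu hmu] : forall t, exists m : probability (borel (radon R * Ico01 R)%type) R,
      0 <= t <= T -> is_limit_measure mu0 t m /\
      forall (h : radon R -> R) (M y : R), continuous h ->
        (forall q, 0 <= h q <= M) -> 0 <= y < 1 ->
        \int[m]_q (h q.1 * (y <= \val q.2)%R%:R) =
        limit_survival mu0 h (rank_thr mu0 t y) (time_thr mu0 t y) t.
    (* Nothing is asserted outside [[0, T]], where [mu0] serves as a filler. *)
    move=> t; have [tT|tT] := boolP (0 <= t <= T); last by exists mu0.
    have t0 : 0 <= t by case/andP: tT.
    exists (limit_measure e_cc e_metric t0 (contA t tT) (contB t tT)) => _.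
    split; first exact: limit_measure_is_limit.
    by move=> h M y; exact: limit_measure_Rintegral.
  exists mu; split; first by move=> t /hmu[].
  have uniform_ae (h : radon R -> R) M : continuous h -> (forall q, 0 <= h q <= M) ->
      {ae P, forall w, uniform_at rho nu x T mu0 w h}.
    move=> ch h0M.
    apply: (empirical_survival_uniform nu_poisson nu_independent T_gt0 (smallI hI)
      h0M (c := true) (L := limit_survival mu0 h) ch) => y a b y01 /andP[a0 aT] /andP[b0 bT].
    exact: (expected_cvg mu0N_cvg (smallI hI) smallJ ch h0M a0 bT).
  have fin_ae : {ae P, forall w, forall N (i : 'I_N),
      (nu N i w [set u | \val u <= T]%R < +oo)%E}.
    apply/ae_foralln => N; apply: filter_forall => i.
    apply: (poisson_fin (nu_poisson N i)); first exact: measurable_Rplus_le.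
    apply: radon_compact; exact: compact_Rplus_le.
  have approx_ae n (eta : R) : 0 < eta -> {ae P, forall w, \forall N \near \oo, forall t,
      0 <= t <= T -> `|N%:R^-1 * \sum_(i < N)
          f n (rho N i, position (x N) (fun i j => tau N i j w) i t)
        - \int[mu t]_p f n p| <= 3 * eta}.
    move=> eta0.
    have [k [i [k0 ->]]] : [set g | exists k i, (0 < k)%N /\ g = cylinder e (fk k i)] (f n).
      by rewrite -f_enum; exists n.
    have g_cc := fk_cc k i k0; set F := cylinder e (fk k i).
    have [M FM] := cc_bounded g_cc.
    have [delta d0 hd] := cc_uniform g_cc eta0.
    have [K hK] : exists K : nat, K.+1%:R^-1 < delta.
      have dV : 0 <= delta^-1 by rewrite invr_ge0 ltW.
      exists (Num.trunc delta^-1); rewrite invf_plt ?posrE//; exact: truncnS_gt.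
    have cF := continuous_cylinder e_cc g_cc.
    have cF1 := continuous_cylinder_fst e_cc g_cc.
    have FM' p : `|F p| <= M by exact: FM.
    have Fu q (z z' : Ico01 R) : `|\val z - \val z'| <= K.+1%:R^-1 ->
        `|F (q, z) - F (q, z')| <= eta.
      by move=> zz; apply: hd; exact: le_lt_trans hK.
    have U1 : {ae P, forall w, uniform_at rho nu x T mu0 w (fun=> 1)}.
      apply: (uniform_ae _ 1) => [|q]; first exact: cst_continuous.
      by rewrite ler01 lexx.
    have Uh : {ae P, forall w, forall j, uniform_at rho nu x T mu0 w (profile F M K j)}.
      apply/ae_foralln => j; apply: (uniform_ae _ (M + M)); last exact: profile_bound.
      move=> q; apply: (@continuousD _ R^o _ (fun q => F (q, level_point R K j)) (cst M)).
        exact: cF1.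
      exact: cst_continuous.
    apply: filterS3 simple_ae fin_ae (filterI U1 Uh) => w simple_w fin_w [U1w Uhw].
    apply: (state_average_uniform contA contB simple_w fin_w _ FM' Fu cF cF1 U1w Uhw eta0).
    by move=> t h B y tT; exact: (hmu t tT).2.
  (* Countably many test functions and accuracies, hence a single null set. *)
  have all_ae : {ae P, forall w, forall n m, \forall N \near \oo, forall t,
      0 <= t <= T -> `|N%:R^-1 * \sum_(i < N)
          f n (rho N i, position (x N) (fun i j => tau N i j w) i t)
        - \int[mu t]_p f n p| <= 3 * m.+1%:R^-1}.
    by apply/ae_foralln => n; apply/ae_foralln => m; apply: approx_ae.
  apply: filterS all_ae => w Hw.
  apply: sup_cvg0_near; [exact: ltW|by move=> N t; exact: weak_dist_ge0|].
  move=> eps eps0.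
  (* One half is for the first [k] test functions, the other for the total weight [2 ^- k] of the
     rest. *)
  have eps2 : 0 < eps / 2 by rewrite divr_gt0.
  have [k k_eps] := half_expn_lt eps2.
  have [m m_eps] : exists m : nat, 3 * m.+1%:R^-1 < eps / 2.
    have dV : 0 <= 3 / (eps / 2) by rewrite divr_ge0// ltW.
    exists (Num.trunc (3 / (eps / 2))); rewrite ltr_pdivrMr// mulrC.
    by rewrite -ltr_pdivrMr//; exact: truncnS_gt.
  near=> N => t tT; apply: (@le_trans _ _ (eps / 2 + 2 ^- k)%:E); last first.
    by rewrite lee_fin; lra.
  have HN : forall (n : 'I_k) t, 0 <= t <= T -> `|N%:R^-1 * \sum_(i < N)
          f n (rho N i, position (x N) (fun i j => tau N i j w) i t)
        - \int[mu t]_p f n p| <= 3 * m.+1%:R^-1.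
    near: N; apply: filter_forall => n; exact: Hw.
  apply: weighted_series_le; first exact: ltW.
    by move=> n; rewrite le_min normr_ge0 ler01 ge_min lexx orbT.
  move=> n nk; rewrite ge_min; apply/orP; left; apply: le_trans (ltW m_eps).
  have [k' [i [k0 fE]]] : [set g | exists k i, (0 < k)%N /\ g = cylinder e (fk k i)] (f n).
    by rewrite -f_enum; exists n.
  have mf : measurable_fun setT (f n : borel (radon R * Ico01 R)%type -> R).
    by rewrite fE; apply: continuous_borel_real; exact: (continuous_cylinder e_cc (fk_cc _ i k0)).
  by rewrite (empirical_integral _ mf) /=; exact: (HN (Ordinal nk)).
Unshelve. all: by end_near.
Qed.
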